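(* Let $\mathbb{F}$ be a commutative ring and let $\mathcal{H}eis$ be Khovanov's Heisenberg category over $\mathbb{F}$. There exists a replete semisimple monoidal subcategory $\mathcal{H}eis_s\subseteq\mathcal{H}eis$ for which the Heisenberg isomorphism $\downarrow\otimes\uparrow\;\cong\;\uparrow\otimes\downarrow\;\oplus\;\mathbb{1}$ holds in $\mathcal{H}eis_s$. The simple objects are given precisely by $\uparrow^{\otimes i}\otimes\downarrow^{\otimes j}$ for nonnegative integers $i,j\ge0$. There is an isomorphism $K_0(\mathcal{H}eis_s)\cong A_1$, where $A_1=\mathbb{Z}\langle x,\partial\rangle/(\partial x-x\partial-1)$ is the integral Weyl algebra on one variable, and if $\mathbb{F}$ is a field of characteristic $0$, then $K_0(\mathcal{H}eis_s)\cong K_0(\mathcal{H}eis)$. In particular (for $\mathbb{F}$ a field of characteristic $0$), given two objects $X,Y\in\mathcal{H}eis$, $X\cong Y$ in $\mathcal{H}eis$ if and only if $X\cong Y$ in $\mathcal{H}eis_s$.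
   Context: **The Heisenberg category.** $\mathcal{H}eis$ is the additive, $\mathbb{F}$-linear, strict monoidal category generated by two objects $\uparrow,\downarrow$; its objects are finite direct sums of words $X=X_1\otimes\cdots\otimes X_n$ with $X_i\in\{\uparrow,\downarrow\}$, the empty word being the unit $\mathbb{1}$. It is not idempotent completed. Its morphisms are generated under composition, $\otimes$ and $\mathbb{F}$-linear combinations by identities and $$s:\uparrow\otimes\uparrow\to\uparrow\otimes\uparrow,\quad c:\mathbb{1}\to\downarrow\otimes\uparrow,\quad d:\uparrow\otimes\downarrow\to\mathbb{1},\quad c':\mathbb{1}\to\uparrow\otimes\downarrow,\quad d':\downarrow\otimes\uparrow\to\mathbb{1}.$$ (Diagrammatically: $s$ is a crossing of two upward strands, $c,c'$ are oriented cups, $d,d'$ are oriented caps; diagrams are read from bottom to top, and $a\otimes b$ is $a$ drawn to the left of $b$.) Put $$t:=(\mathrm{id}_\downarrow\otimes\mathrm{id}_\uparrow\otimes d)\circ(\mathrm{id}_\downarrow\otimes s\otimes\mathrm{id}_\downarrow)\circ(c\otimes\mathrm{id}_\uparrow\otimes\mathrm{id}_\downarrow):\uparrow\otimes\downarrow\to\downarrow\otimes\uparrow,$$ $$t':=(d'\otimes\mathrm{id}_\uparrow\otimes\mathrm{id}_\downarrow)\circ(\mathrm{id}_\downarrow\otimes s\otimes\mathrm{id}_\downarrow)\circ(\mathrm{id}_\downarrow\otimes\mathrm{id}_\uparrow\otimes c'):\downarrow\otimes\uparrow\to\uparrow\otimes\downarrow.$$ The relations imposed are: - $s\circ s=\mathrm{id}_{\uparrow\otimes\uparrow}$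 and $(s\otimes\mathrm{id}_\uparrow)(\mathrm{id}_\uparrow\otimes s)(s\otimes\mathrm{id}_\uparrow)=(\mathrm{id}_\uparrow\otimes s)(s\otimes\mathrm{id}_\uparrow)(\mathrm{id}_\uparrow\otimes s)$; - $(d\otimes\mathrm{id}_\uparrow)(\mathrm{id}_\uparrow\otimes c)=\mathrm{id}_\uparrow$ and $(\mathrm{id}_\downarrow\otimes d)(c\otimes\mathrm{id}_\downarrow)=\mathrm{id}_\downarrow$ (right adjunction); one also has the left adjunction relations $(\mathrm{id}_\uparrow\otimes d')(c'\otimes\mathrm{id}_\uparrow)=\mathrm{id}_\uparrow$ and $(d'\otimes\mathrm{id}_\downarrow)(\mathrm{id}_\downarrow\otimes c')=\mathrm{id}_\downarrow$; - $t'\circ t=\mathrm{id}_{\uparrow\otimes\downarrow}$, $\;t\circ t'=\mathrm{id}_{\downarrow\otimes\uparrow}-c\circ d'$, $\;(d'\otimes\mathrm{id}_\uparrow)(\mathrm{id}_\downarrow\otimes s)(c\otimes\mathrm{id}_\uparrow)=0$, $\;d'\circ c=\mathrm{id}_{\mathbb{1}}$. **Conventions.** ''Replete'' and ''semisimple'' have their standard meanings; the subcategory is not assumed to be full. $K_0$ of an additive monoidal category is its split Grothendieck ring: $[X\oplus Y]=[X]+[Y]$, $[X][Y]=[X\otimes Y]$.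
   Formalization: ''Replete'' means only that the objects are closed under isomorphism: closure under all isomorphisms would put the crossing s in End(↑⊗↑), where (1+s)(1−s)=0, so ↑⊗↑ would not be simple. F is nonzero; over a general ring ''simple'' means that the endomorphisms are exactly F. *)

(* Defs.v *)
From HB Require Import structures.
From Stdlib Require List.
From mathcomp Require Import all_boot all_order all_algebra.
From mathcomp Require Import generic_quotient.
From mathcomp Require Import boolp.

Set Implicit Arguments.
Unset Strict Implicit.
Unset Printing Implicit Defensive.

Import GRing.Theory.

(** * Words and terms *)

Inductive arrow := Up | Dn.

(* Tensor words in the two generating objects; tensor is concatenation and the
   unit is the empty word. *)
Notation word := (seq arrow).

(* c' and d' are gcp and gdp. *)
Inductive gen := gs | gc | gd | gcp | gdp.

Definition gen_dom (g : gen) : word :=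
  match g with
  | gs => [:: Up; Up]
  | gc => [::]
  | gd => [:: Up; Dn]
  | gcp => [::]
  | gdp => [:: Dn; Up]
  end.

Definition gen_cod (g : gen) : word :=
  match g with
  | gs => [:: Up; Up]
  | gc => [:: Dn; Up]
  | gd => [::]
  | gcp => [:: Up; Dn]
  | gdp => [::]
  end.

(* Morphisms between words are represented by untyped terms, subject to the
   typing judgement [typed f a b], "f : a -> b"; equality of morphisms is the
   relation [meq].  Keeping words out of the type of a term makes the strict
   associativity of the tensor product expressible without casts.
   [Comp g f] is g after f. *)
Inductive mor (F : Type) :=
  | Gen of gen
  | Id of word
  | Comp of mor F & mor F
  | Tens of mor F & mor F
  | Zero of word & word
  | Add of mor F & mor F
  | Scale of F & mor F.

Arguments Gen {F}.
Arguments Id {F}.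
Arguments Zero {F}.

Inductive typed (F : Type) : mor F -> word -> word -> Prop :=
  | typed_gen g : typed (Gen g) (gen_dom g) (gen_cod g)
  | typed_id a : typed (Id a) a a
  | typed_comp a b c g f :
      typed g b c -> typed f a b -> typed (Comp g f) a c
  | typed_tens a b a' b' f f' :
      typed f a b -> typed f' a' b' -> typed (Tens f f') (a ++ a') (b ++ b')
  | typed_zero a b : typed (Zero a b) a b
  | typed_add a b f g : typed f a b -> typed g a b -> typed (Add f g) a b
  | typed_scale a b k f : typed f a b -> typed (Scale k f) a b.

(** * The defining relations *)

Section Relations.
Context {F : comNzRingType}.
Local Notation mor := (mor F).
Local Notation "g \c f" := (Comp g f) (at level 50, left associativity).
Local Notation "f \x g" := (Tens f g) (at level 40, left associativity).

Local Notation iu := (Id [:: Up]).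
Local Notation id' := (Id [:: Dn]).
Local Notation s := (Gen gs).
Local Notation c := (Gen gc).
Local Notation d := (Gen gd).
Local Notation c' := (Gen gcp).
Local Notation d' := (Gen gdp).

Definition mor_t : mor :=
  (id' \x iu \x d) \c (id' \x s \x id') \c (c \x iu \x id').

Definition mor_tp : mor :=
  (d' \x iu \x id') \c (id' \x s \x id') \c (id' \x iu \x c').

Inductive heis_rel : word -> word -> mor -> mor -> Prop :=
  | rel_ss : heis_rel [:: Up; Up] [:: Up; Up] (s \c s) (Id [:: Up; Up])
  | rel_braid : heis_rel [:: Up; Up; Up] [:: Up; Up; Up]
      ((s \x iu) \c (iu \x s) \c (s \x iu))
      ((iu \x s) \c (s \x iu) \c (iu \x s))
  | rel_radj_up : heis_rel [:: Up] [:: Up] ((d \x iu) \c (iu \x c)) iu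
  | rel_radj_dn : heis_rel [:: Dn] [:: Dn] ((id' \x d) \c (c \x id')) id'
  | rel_ladj_up : heis_rel [:: Up] [:: Up] ((iu \x d') \c (c' \x iu)) iu
  | rel_ladj_dn : heis_rel [:: Dn] [:: Dn] ((d' \x id') \c (id' \x c')) id'
  | rel_tpt : heis_rel [:: Up; Dn] [:: Up; Dn] (mor_tp \c mor_t)
      (Id [:: Up; Dn])
  | rel_ttp : heis_rel [:: Dn; Up] [:: Dn; Up] (mor_t \c mor_tp)
      (Add (Id [:: Dn; Up]) (Scale (-1)%R (c \c d')))
  | rel_curl : heis_rel [:: Up] [:: Up]
      ((d' \x iu) \c (id' \x s) \c (c \x iu)) (Zero [:: Up] [:: Up])
  | rel_bubble : heis_rel [::] [::] (d' \c c) (Id [::]).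

(* [meq a b f g]: the terms f and g represent the same morphism a -> b of the
   F-linear strict monoidal category presented by [gen] and [heis_rel]. *)
Inductive meq : word -> word -> mor -> mor -> Prop :=
  | meq_rel a b f g : heis_rel a b f g -> meq a b f g
  (* congruence *)
  | meq_refl a b f : typed f a b -> meq a b f f
  | meq_sym a b f g : meq a b f g -> meq a b g f
  | meq_trans a b f g h : meq a b f g -> meq a b g h -> meq a b f h
  | meq_comp a b c g g' f f' :
      meq b c g g' -> meq a b f f' -> meq a c (g \c f) (g' \c f')
  | meq_tens a b a1 b1 f g f1 g1 :
      meq a b f g -> meq a1 b1 f1 g1 ->
      meq (a ++ a1) (b ++ b1) (f \x f1) (g \x g1)
  | meq_add a b f f' g g' :
      meq a b f f' -> meq a b g g' -> meq a b (Add f g) (Add f' g')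
  | meq_scale a b k f g : meq a b f g -> meq a b (Scale k f) (Scale k g)
  (* category *)
  | meq_compA a b c e h g f : typed h c e -> typed g b c -> typed f a b ->
      meq a e (h \c (g \c f)) ((h \c g) \c f)
  | meq_idl a b f : typed f a b -> meq a b (Id b \c f) f
  | meq_idr a b f : typed f a b -> meq a b (f \c Id a) f
  (* strict monoidal category *)
  | meq_tensA a b a1 b1 a2 b2 f f1 f2 :
      typed f a b -> typed f1 a1 b1 -> typed f2 a2 b2 ->
      meq (a ++ (a1 ++ a2)) (b ++ (b1 ++ b2))
        (f \x (f1 \x f2)) ((f \x f1) \x f2)
  | meq_tens1l a b f : typed f a b -> meq a b (Id [::] \x f) f
  | meq_tens1r a b f : typed f a b -> meq a b (f \x Id [::]) f
  | meq_tens_id a b : meq (a ++ b) (a ++ b) (Id a \x Id b) (Id (a ++ b))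
  | meq_interchange a b c a1 b1 c1 g f g1 f1 :
      typed g b c -> typed f a b -> typed g1 b1 c1 -> typed f1 a1 b1 ->
      meq (a ++ a1) (c ++ c1)
        ((g \x g1) \c (f \x f1)) ((g \c f) \x (g1 \c f1))
  (* F-modules *)
  | meq_addA a b f g h : typed f a b -> typed g a b -> typed h a b ->
      meq a b (Add f (Add g h)) (Add (Add f g) h)
  | meq_addC a b f g : typed f a b -> typed g a b ->
      meq a b (Add f g) (Add g f)
  | meq_add0 a b f : typed f a b -> meq a b (Add (Zero a b) f) f
  | meq_scale0 a b f : typed f a b -> meq a b (Scale 0%R f) (Zero a b)
  | meq_scale1 a b f : typed f a b -> meq a b (Scale 1%R f) f
  | meq_scaleA a b k l f : typed f a b ->
      meq a b (Scale k (Scale l f)) (Scale (k * l)%R f)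
  | meq_scaleDl a b k l f : typed f a b ->
      meq a b (Scale (k + l)%R f) (Add (Scale k f) (Scale l f))
  | meq_scaleDr a b k f g : typed f a b -> typed g a b ->
      meq a b (Scale k (Add f g)) (Add (Scale k f) (Scale k g))
  (* bilinearity *)
  | meq_compDl a b c g g' f : typed g b c -> typed g' b c -> typed f a b ->
      meq a c (Add g g' \c f) (Add (g \c f) (g' \c f))
  | meq_compDr a b c g f f' : typed g b c -> typed f a b -> typed f' a b ->
      meq a c (g \c Add f f') (Add (g \c f) (g \c f'))
  | meq_compZl a b c k g f : typed g b c -> typed f a b ->
      meq a c (Scale k g \c f) (Scale k (g \c f))
  | meq_compZr a b c k g f : typed g b c -> typed f a b ->
      meq a c (g \c Scale k f) (Scale k (g \c f))
  | meq_tensDl a b a1 b1 f g h :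
      typed f a b -> typed g a b -> typed h a1 b1 ->
      meq (a ++ a1) (b ++ b1) (Add f g \x h) (Add (f \x h) (g \x h))
  | meq_tensDr a b a1 b1 f g h :
      typed f a b -> typed g a1 b1 -> typed h a1 b1 ->
      meq (a ++ a1) (b ++ b1) (f \x Add g h) (Add (f \x g) (f \x h))
  | meq_tensZl a b a1 b1 k f g : typed f a b -> typed g a1 b1 ->
      meq (a ++ a1) (b ++ b1) (Scale k f \x g) (Scale k (f \x g))
  | meq_tensZr a b a1 b1 k f g : typed f a b -> typed g a1 b1 ->
      meq (a ++ a1) (b ++ b1) (f \x Scale k g) (Scale k (f \x g)).

End Relations.

(** * The additive category: finite direct sums of words *)

(* [:: w_0; ...; w_n.-1] is the direct sum of the words w_i; the direct sum of
   two objects is their concatenation and [::] is the zero object. *)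
Notation obj := (seq (seq arrow)).

Notation comp_of X i := (nth ([::] : word) X i).

Definition ounit : obj := [:: [::]].
Definition otens (X Y : obj) : obj := [seq x ++ y | x <- X, y <- Y].
Definition opow (X : obj) (n : nat) : obj := iter n (otens X) ounit.
Definition oup : obj := [:: [:: Up]].
Definition odn : obj := [:: [:: Dn]].

(* A morphism X -> Y is a matrix, with entry (i, j) a term from the i-th summand
   of X to the j-th summand of Y; entries out of range are irrelevant. *)
Record hom (F : comNzRingType) (X Y : obj) := MkHom {
  entry :> nat -> nat -> mor F;
  entry_typed : forall i j, i < size X -> j < size Y ->
    typed (entry i j) (comp_of X i) (comp_of Y j)
}.

Definition heq (F : comNzRingType) (X Y : obj) (f g : hom F X Y) : Prop :=
  forall i j, i < size X -> j < size Y ->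
    meq (comp_of X i) (comp_of Y j) (f i j) (g i j).

Declare Scope heis_scope.
Delimit Scope heis_scope with H.
Notation "f =~ g" := (heq f g) (at level 70, no associativity) : heis_scope.
Local Open Scope heis_scope.

Lemma nth_otens (X Y : obj) (p : nat) : p < size (otens X Y) ->
  comp_of (otens X Y) p
    = comp_of X (p %/ size Y) ++ comp_of Y (p %% size Y).
Proof.
rewrite /otens; elim: X p => [|x X IH] p //=.
rewrite size_cat size_map nth_cat size_map => lt_p.
case: ltnP => [lt_pY|le_Yp].
  by rewrite divn_small // modn_small //= (nth_map [::]).
have [Y0|Ygt0] := posnP (size Y).
  by move: lt_p; rewrite size_allpairs Y0 muln0.
rewrite IH; last by rewrite ltn_subLR.
by rewrite -{3 4}(subnKC le_Yp) divnDl ?dvdnn // divnn Ygt0 modnDl.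
Qed.

Lemma otens_divn (X Y : obj) (p : nat) : p < size (otens X Y) ->
  (p %/ size Y < size X) && (p %% size Y < size Y).
Proof.
rewrite size_allpairs => lt_p.
have [Y0|Ygt0] := posnP (size Y); first by rewrite Y0 muln0 in lt_p.
by rewrite ltn_divLR // lt_p ltn_pmod.
Qed.

Section Homs.
Context {F : comNzRingType}.
Implicit Types X Y Z : obj.
Local Notation hom := (hom F).

Fact hzero_typed X Y i j : i < size X -> j < size Y ->
  typed (Zero (comp_of X i) (comp_of Y j) : mor F)
    (comp_of X i) (comp_of Y j).
Proof. by move=> *; constructor. Qed.
Definition hzero X Y : hom X Y := MkHom (@hzero_typed X Y).

Fact hadd_typed X Y (f g : hom X Y) i j : i < size X -> j < size Y ->
  typed (Add (f i j) (g i j)) (comp_of X i) (comp_of Y j).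
Proof. by move=> *; constructor; apply: entry_typed. Qed.
Definition hadd X Y (f g : hom X Y) : hom X Y := MkHom (@hadd_typed X Y f g).

Fact hscale_typed X Y k (f : hom X Y) i j : i < size X -> j < size Y ->
  typed (Scale k (f i j)) (comp_of X i) (comp_of Y j).
Proof. by move=> *; constructor; apply: entry_typed. Qed.
Definition hscale X Y k (f : hom X Y) : hom X Y := MkHom (@hscale_typed X Y k f).

(* The matrix with identities at the positions satisfying P and 0 elsewhere. *)
Fact hdelta_typed X Y (P : rel nat)
    (PXY : forall i j, i < size X -> j < size Y -> P i j ->
       comp_of X i = comp_of Y j) i j :
  i < size X -> j < size Y ->
  typed (if P i j then Id (comp_of X i)
         else Zero (comp_of X i) (comp_of Y j) : mor F)
    (comp_of X i) (comp_of Y j).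
Proof.
move=> iX jY; case: ifP => [Pij|_]; last by constructor.
by rewrite -(PXY i j) //; constructor.
Qed.
Definition hdelta X Y P PXY : hom X Y := MkHom (@hdelta_typed X Y P PXY).

Fact hid_eq X i j : i < size X -> j < size X -> i == j ->
  comp_of X i = comp_of X j.
Proof. by move=> _ _ /eqP->. Qed.
Definition hid X : hom X X := hdelta (@hid_eq X).

Fact hcomp_typed X Y Z (g : hom Y Z) (f : hom X Y) i k :
  i < size X -> k < size Z ->
  typed (foldr (@Add F) (Zero (comp_of X i) (comp_of Z k))
           [seq Comp (g j k) (f i j) | j <- iota 0 (size Y)])
    (comp_of X i) (comp_of Z k).
Proof.
move=> iX kZ.
have: all (fun j => j < size Y) (iota 0 (size Y)).
  by apply/allP => j; rewrite mem_iota.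
elim: (iota _ _) => [|j r IH] /=; first by constructor.
case/andP=> jY rY; constructor; last exact: IH.
by apply: (@typed_comp _ _ (comp_of Y j)); apply: entry_typed.
Qed.
Definition hcomp X Y Z (g : hom Y Z) (f : hom X Y) : hom X Z :=
  MkHom (@hcomp_typed X Y Z g f).

Fact htens_typed X Y X' Y' (f : hom X Y) (g : hom X' Y') p q :
  p < size (otens X X') -> q < size (otens Y Y') ->
  typed (Tens (f (p %/ size X') (q %/ size Y'))
              (g (p %% size X') (q %% size Y')))
    (comp_of (otens X X') p) (comp_of (otens Y Y') q).
Proof.
move=> pX qY; rewrite !nth_otens //.
have /andP[? ?] := otens_divn pX; have /andP[? ?] := otens_divn qY.
by constructor; apply: entry_typed.
Qed.
Definition htens X Y X' Y' (f : hom X Y) (g : hom X' Y') :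
    hom (otens X X') (otens Y Y') :=
  MkHom (@htens_typed X Y X' Y' f g).

(* Inclusions and projections of the direct sum X ++ Y. *)
Fact hinl_eq X Y i j : i < size X -> j < size (X ++ Y) -> i == j ->
  comp_of X i = comp_of (X ++ Y) j.
Proof. by move=> iX _ /eqP<-; rewrite nth_cat iX. Qed.
Definition hinl X Y : hom X (X ++ Y) := hdelta (@hinl_eq X Y).

Fact hinr_eq X Y i j : i < size Y -> j < size (X ++ Y) -> size X + i == j ->
  comp_of Y i = comp_of (X ++ Y) j.
Proof. by move=> _ _ /eqP<-; rewrite nth_cat ltnNge leq_addr addKn. Qed.
Definition hinr X Y : hom Y (X ++ Y) := hdelta (@hinr_eq X Y).

Fact hprl_eq X Y i j : i < size (X ++ Y) -> j < size X -> i == j ->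
  comp_of (X ++ Y) i = comp_of X j.
Proof. by move=> _ jX /eqP->; rewrite nth_cat jX. Qed.
Definition hprl X Y : hom (X ++ Y) X := hdelta (@hprl_eq X Y).

Fact hprr_eq X Y i j : i < size (X ++ Y) -> j < size Y -> i == size X + j ->
  comp_of (X ++ Y) i = comp_of Y j.
Proof. by move=> _ _ /eqP->; rewrite nth_cat ltnNge leq_addr addKn. Qed.
Definition hprr X Y : hom (X ++ Y) Y := hdelta (@hprr_eq X Y).

End Homs.

Notation "g \oh f" := (hcomp g f) (at level 50, left associativity)
  : heis_scope.

(** * Subcategories *)

Record subcat (F : comNzRingType) := Subcat {
  sob : obj -> Prop;
  shom : forall X Y : obj, hom F X Y -> Prop;
  shom_heq : forall X Y (f g : hom F X Y), f =~ g -> shom f -> shom g;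
  shom_ob : forall X Y (f : hom F X Y), shom f -> sob X /\ sob Y;
  shom_id : forall X, sob X -> shom (hid X);
  shom_comp : forall X Y Z (g : hom F Y Z) (f : hom F X Y),
    shom g -> shom f -> shom (g \oh f)
}.

Arguments shom {F} s {X Y} f.

(* The whole Heisenberg category, as a subcategory of itself. *)
Definition Heis (F : comNzRingType) : subcat F :=
  @Subcat F (fun _ => True) (fun _ _ _ => True)
    (fun _ _ _ _ _ _ => I) (fun _ _ _ _ => conj I I)
    (fun _ _ => I) (fun _ _ _ _ _ _ _ => I).

Section SubcatTheory.
Context {F : comNzRingType}.
Implicit Types (S : subcat F) (X Y Z : obj).
Local Notation hom := (hom F).

Definition is_iso S X Y (f : hom X Y) : Prop :=
  shom S f /\ exists g : hom Y X,
    [/\ shom S g, g \oh f =~ hid X & f \oh g =~ hid Y].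

Definition iso_in S X Y : Prop := exists f : hom X Y, is_iso S f.

(* Repleteness is closure of the class of objects under isomorphism.  Closure
   under all isomorphisms of the ambient category would put s, and hence the
   zero divisors 1 + s and 1 - s, in the endomorphism ring of Up (x) Up. *)
Definition replete S : Prop :=
  forall X Y, sob S X -> iso_in (Heis F) X Y -> sob S Y.

Definition monoidal_sub S : Prop :=
  [/\ sob S ounit,
      forall X Y, sob S X -> sob S Y -> sob S (otens X Y)
    & forall X Y X' Y' (f : hom X Y) (g : hom X' Y'),
        shom S f -> shom S g -> shom S (htens f g)].

Definition linear_sub S : Prop :=
  [/\ forall X Y, sob S X -> sob S Y -> shom S (hzero X Y),
      forall X Y (f g : hom X Y), shom S f -> shom S g -> shom S (hadd f g)
    & forall X Y k (f : hom X Y), shom S f -> shom S (hscale k f)].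

Definition sums_sub S : Prop :=
  sob S [::] /\
  forall X Y, sob S X -> sob S Y ->
    sob S (X ++ Y) /\
    [/\ shom S (hinl X Y), shom S (hinr X Y),
        shom S (hprl X Y) & shom S (hprr X Y)].

Definition additive_sub S : Prop := linear_sub S /\ sums_sub S.

(** ** Semisimplicity over a commutative ring

   Over a ring an object whose endomorphisms are the scalars can have proper
   subobjects, so an object of a linear category is called simple when its
   endomorphisms are the scalars, and the category semisimple when all objects
   are finite direct sums of simple ones and there are no nonzero morphisms
   between non-isomorphic simple objects. *)

Definition lin_simple S X : Prop :=
  [/\ sob S X,
      forall f : hom X X, shom S f -> exists k, f =~ hscale k (hid X)
    & forall k l : F, hscale k (hid X) =~ hscale l (hid X) -> k = l].

Definition lin_semisimple S : Prop :=
  [/\ additive_sub S,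
      forall X, sob S X -> exists Ls : seq obj,
        List.Forall (lin_simple S) Ls /\ iso_in S X (flatten Ls)
    & forall X Y, lin_simple S X -> lin_simple S Y -> ~ iso_in S X Y ->
        forall f : hom X Y, shom S f -> f =~ hzero X Y].

(** ** Semisimple abelian categories *)

Definition is_mono S X Y (m : hom X Y) : Prop :=
  shom S m /\ forall W (g h : hom W X), shom S g -> shom S h ->
    m \oh g =~ m \oh h -> g =~ h.

Definition is_epi S X Y (e : hom X Y) : Prop :=
  shom S e /\ forall W (g h : hom Y W), shom S g -> shom S h ->
    g \oh e =~ h \oh e -> g =~ h.

Definition is_kernel S X Y (f : hom X Y) K (k : hom K X) : Prop :=
  [/\ shom S k, f \oh k =~ hzero K Y
    & forall W (g : hom W X), shom S g -> f \oh g =~ hzero W Y ->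
        exists h : hom W K, [/\ shom S h, k \oh h =~ g
          & forall h' : hom W K, shom S h' -> k \oh h' =~ g -> h' =~ h]].

Definition is_cokernel S X Y (f : hom X Y) C (q : hom Y C) : Prop :=
  [/\ shom S q, q \oh f =~ hzero X C
    & forall W (g : hom Y W), shom S g -> g \oh f =~ hzero X W ->
        exists h : hom C W, [/\ shom S h, h \oh q =~ g
          & forall h' : hom C W, shom S h' -> h' \oh q =~ g -> h' =~ h]].

Definition abelian_sub S : Prop :=
  additive_sub S /\
  [/\ forall X Y (f : hom X Y), shom S f ->
        exists K (k : hom K X), is_kernel S f k,
      forall X Y (f : hom X Y), shom S f ->
        exists C (q : hom Y C), is_cokernel S f q,
      forall X Y (m : hom X Y), is_mono S m ->
        exists Z (f : hom Y Z), shom S f /\ is_kernel S f m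
    & forall X Y (e : hom X Y), is_epi S e ->
        exists Z (f : hom Z X), shom S f /\ is_cokernel S f e].

Definition ab_simple S X : Prop :=
  [/\ sob S X, ~ ((hid X : hom X X) =~ hzero X X)
    & forall Z (m : hom Z X), is_mono S m -> m =~ hzero Z X \/ is_iso S m].

Definition ab_semisimple S : Prop :=
  abelian_sub S /\
  forall X, sob S X -> exists Ls : seq obj,
    List.Forall (ab_simple S) Ls /\ iso_in S X (flatten Ls).

End SubcatTheory.

Definition is_field (F : comNzRingType) : Prop :=
  forall x : F, x <> 0%R -> exists y : F, (x * y)%R = 1%R.

(** * Rings presented by generators and relations *)

Inductive rterm (G : Type) :=
  | Rgen of G
  | Rzero
  | Rone
  | Radd of rterm G & rterm G
  | Ropp of rterm G
  | Rmul of rterm G & rterm G.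

Arguments Rzero {G}.
Arguments Rone {G}.

(* The ring congruence on terms generated by R. *)
Inductive rcong (G : Type) (R : rterm G -> rterm G -> Prop) :
    rterm G -> rterm G -> Prop :=
  | rcong_rel s t : R s t -> rcong R s t
  | rcong_refl t : rcong R t t
  | rcong_sym s t : rcong R s t -> rcong R t s
  | rcong_trans s t u : rcong R s t -> rcong R t u -> rcong R s u
  | rcong_add s s' t t' :
      rcong R s s' -> rcong R t t' -> rcong R (Radd s t) (Radd s' t')
  | rcong_opp s s' : rcong R s s' -> rcong R (Ropp s) (Ropp s')
  | rcong_mul s s' t t' :
      rcong R s s' -> rcong R t t' -> rcong R (Rmul s t) (Rmul s' t')
  | rcong_addA s t u : rcong R (Radd s (Radd t u)) (Radd (Radd s t) u)
  | rcong_addC s t : rcong R (Radd s t) (Radd t s)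
  | rcong_add0 t : rcong R (Radd Rzero t) t
  | rcong_addN t : rcong R (Radd (Ropp t) t) Rzero
  | rcong_mulA s t u : rcong R (Rmul s (Rmul t u)) (Rmul (Rmul s t) u)
  | rcong_mul1l t : rcong R (Rmul Rone t) t
  | rcong_mul1r t : rcong R (Rmul t Rone) t
  | rcong_mulDl s t u :
      rcong R (Rmul (Radd s t) u) (Radd (Rmul s u) (Rmul t u))
  | rcong_mulDr s t u :
      rcong R (Rmul s (Radd t u)) (Radd (Rmul s t) (Rmul s u)).

HB.instance Definition _ (G : Type) := gen_eqMixin (rterm G).
HB.instance Definition _ (G : Type) := gen_choiceMixin (rterm G).

Section PresentedRing.
Context (G : Type) (R : rterm G -> rterm G -> Prop).
Local Open Scope quotient_scope.

Definition rcongb : rel (rterm G) := fun s t => `[< rcong R s t >].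

Fact rcongb_equiv : equiv_class_of rcongb.
Proof.
split.
- by move=> t; apply/asboolP; apply: rcong_refl.
- by move=> s t; apply/asbool_equiv_eq; split; apply: rcong_sym.
- move=> t s u /asboolP st /asboolP tu; apply/asboolP.
  exact: rcong_trans st tu.
Qed.
Canonical rcongb_rel := EquivRelPack rcongb_equiv.

Definition pres_ring := {eq_quot rcongb}.
HB.instance Definition _ := Choice.on pres_ring.

Definition pres_cls (t : rterm G) : pres_ring := \pi_pres_ring t.

Lemma pres_cls_eq (s t : rterm G) :
  pres_cls s = pres_cls t <-> rcong R s t.
Proof.
split=> [/eqquotP/asboolP //|st].
by apply/eqquotP; apply/asboolP.
Qed.

Lemma pres_clsK (x : pres_ring) : pres_cls (repr x) = x.
Proof. exact: reprK. Qed.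

Lemma pres_repr (t : rterm G) : rcong R (repr (pres_cls t)) t.
Proof. by apply/pres_cls_eq; rewrite pres_clsK. Qed.

Definition pres_add (x y : pres_ring) := pres_cls (Radd (repr x) (repr y)).
Definition pres_opp (x : pres_ring) := pres_cls (Ropp (repr x)).
Definition pres_mul (x y : pres_ring) := pres_cls (Rmul (repr x) (repr y)).

Lemma pres_addE s t :
  pres_add (pres_cls s) (pres_cls t) = pres_cls (Radd s t).
Proof. by apply/pres_cls_eq; apply: rcong_add; apply: pres_repr. Qed.

Lemma pres_oppE s : pres_opp (pres_cls s) = pres_cls (Ropp s).
Proof. by apply/pres_cls_eq; apply: rcong_opp; apply: pres_repr. Qed.

Lemma pres_mulE s t :
  pres_mul (pres_cls s) (pres_cls t) = pres_cls (Rmul s t).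
Proof. by apply/pres_cls_eq; apply: rcong_mul; apply: pres_repr. Qed.

Fact pres_addA : associative pres_add.
Proof.
move=> x y z; rewrite -(pres_clsK x) -(pres_clsK y) -(pres_clsK z).
by rewrite !pres_addE; apply/pres_cls_eq; apply: rcong_addA.
Qed.

Fact pres_addC : commutative pres_add.
Proof.
move=> x y; rewrite -(pres_clsK x) -(pres_clsK y).
by rewrite !pres_addE; apply/pres_cls_eq; apply: rcong_addC.
Qed.

Fact pres_add0 : left_id (pres_cls Rzero) pres_add.
Proof.
move=> x; rewrite -(pres_clsK x).
by rewrite pres_addE; apply/pres_cls_eq; apply: rcong_add0.
Qed.

Fact pres_addN : left_inverse (pres_cls Rzero) pres_opp pres_add.
Proof.
move=> x; rewrite -(pres_clsK x).
by rewrite pres_oppE pres_addE; apply/pres_cls_eq; apply: rcong_addN.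
Qed.

HB.instance Definition _ := GRing.isZmodule.Build pres_ring
  pres_addA pres_addC pres_add0 pres_addN.

Fact pres_mulA : associative pres_mul.
Proof.
move=> x y z; rewrite -(pres_clsK x) -(pres_clsK y) -(pres_clsK z).
by rewrite !pres_mulE; apply/pres_cls_eq; apply: rcong_mulA.
Qed.

Fact pres_mul1l : left_id (pres_cls Rone) pres_mul.
Proof.
move=> x; rewrite -(pres_clsK x).
by rewrite pres_mulE; apply/pres_cls_eq; apply: rcong_mul1l.
Qed.

Fact pres_mul1r : right_id (pres_cls Rone) pres_mul.
Proof.
move=> x; rewrite -(pres_clsK x).
by rewrite pres_mulE; apply/pres_cls_eq; apply: rcong_mul1r.
Qed.

Fact pres_mulDl : left_distributive pres_mul pres_add.
Proof.
move=> x y z; rewrite -(pres_clsK x) -(pres_clsK y) -(pres_clsK z).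
by rewrite !(pres_addE, pres_mulE); apply/pres_cls_eq; apply: rcong_mulDl.
Qed.

Fact pres_mulDr : right_distributive pres_mul pres_add.
Proof.
move=> x y z; rewrite -(pres_clsK x) -(pres_clsK y) -(pres_clsK z).
by rewrite !(pres_addE, pres_mulE); apply/pres_cls_eq; apply: rcong_mulDr.
Qed.

HB.instance Definition _ := GRing.Zmodule_isPzRing.Build pres_ring
  pres_mulA pres_mul1l pres_mul1r pres_mulDl pres_mulDr.

End PresentedRing.

(** * The Weyl algebra and the split Grothendieck ring *)

Inductive weyl_gen := Wx | Wd.

Inductive weyl_rel : rterm weyl_gen -> rterm weyl_gen -> Prop :=
  | Weyl_rel : weyl_rel
      (Radd (Radd (Rmul (Rgen Wd) (Rgen Wx)) (Ropp (Rmul (Rgen Wx) (Rgen Wd))))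
            (Ropp Rone))
      Rzero.

Definition A1 := pres_ring weyl_rel.
HB.instance Definition _ := GRing.PzRing.on A1.

Definition sobj (F : comNzRingType) (S : subcat F) := {X : obj | sob S X}.

Inductive K0_rel (F : comNzRingType) (S : subcat F) :
    rterm (sobj S) -> rterm (sobj S) -> Prop :=
  | K0_iso (X Y : sobj S) : iso_in S (sval X) (sval Y) ->
      K0_rel (Rgen X) (Rgen Y)
  | K0_sum (X Y Z : sobj S) : sval Z = sval X ++ sval Y ->
      K0_rel (Rgen Z) (Radd (Rgen X) (Rgen Y))
  | K0_unit (X : sobj S) : sval X = ounit -> K0_rel (Rgen X) Rone
  | K0_tens (X Y Z : sobj S) : sval Z = otens (sval X) (sval Y) ->
      K0_rel (Rgen Z) (Rmul (Rgen X) (Rgen Y)).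

(* For an additive monoidal subcategory the additive group of K0 S is the group
   generated by isomorphism classes modulo direct sums, as products of classes
   are classes of tensor products. *)
Definition K0 (F : comNzRingType) (S : subcat F) := pres_ring (@K0_rel F S).
HB.instance Definition _ (F : comNzRingType) (S : subcat F) :=
  GRing.PzRing.on (K0 S).

Definition K0_cls (F : comNzRingType) (S : subcat F) (X : sobj S) : K0 S :=
  pres_cls _ (Rgen X).

Definition heis_ob (F : comNzRingType) (X : obj) : sobj (Heis F) :=
  exist _ X I.

(* Main.v *)
(* The subcategory has all objects, and morphisms generated by t, t', c and d'.
   The relations make (t', d') an isomorphism from Dn (x) Up to
   (Up (x) Dn) (+) 1 with inverse (t, c).  The redexes Dn (x) Up of a word do
   not overlap, so a generated morphism from a word to Up^i Dn^j is a combination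
   of composites of whiskered copies of t' and d'; as these cannot start at a
   normal word, the morphisms between normal words are scalars or 0, and every
   word is a direct sum of normal words.

   Faithfulness comes from the action of the Heisenberg category on finite sets,
   where Up chooses a point to remove and Dn adds one.  It represents morphisms by
   matrices over F, so isomorphic objects of the whole category have the same
   numbers of routes from n-point to m-point sets.  These numbers are triangular
   on the words Up^i Dn^j and determine their multiplicities, which compares both
   Grothendieck rings with the Weyl algebra. *)

Require Import Defs.
From HB Require Import structures.
From Stdlib Require Import Setoid Morphisms.
From mathcomp Require Import all_boot all_order all_algebra.
From mathcomp Require Import finmap generic_quotient boolp zify.

Set Implicit Arguments.
Unset Strict Implicit.
Unset Printing Implicit Defensive.
Import GRing.Theory.

(** * Typing of the relations and of provable equalities *)

Section Typing.
Context {F : comNzRingType}.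
Implicit Types (f g : mor F) (a b : word).

(** A point added to a finite set needs a name, and [fresh U] depends on [U]. Removing and adding
    points in different orders therefore leads to sets that agree only up to a bijection, and the
    rest of a route has to be renamed along it by [ren]. The hard axiom for the action is the
    interchange law: an operator on the left must commute with whatever acts further right. It
    follows from two properties proved by induction on typing derivations, the locality in
    [typed_local] and the equivariance in [op_equiv]. The equations d't = 0 and t'c = 0, needed for
    the inverse matrices, are not among the relations; they are derived from those for t't, tt' and
    d'c. The map from K0 to the Weyl algebra is well defined because isomorphic objects have the
    same normal summands and rewriting a redex keeps the value of an object in every ring with dx =
    xd + 1. Over a field, morphisms between sums of normal words are matrices graded by words. These
    have graded generalised inverses, and kernels, cokernels and the splitting of monos, epis and
    idempotents all come from that. *)

Lemma typed_tup : typed (mor_t : mor F) [:: Up; Dn] [:: Dn; Up].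
Proof.
pose ti := @typed_id F; pose tg := @typed_gen F.
exact: (typed_comp (typed_comp
  (typed_tens (typed_tens (ti [:: Dn]) (ti [:: Up])) (tg gd))
  (typed_tens (typed_tens (ti [:: Dn]) (tg gs)) (ti [:: Dn])))
  (typed_tens (typed_tens (tg gc) (ti [:: Up])) (ti [:: Dn]))).
Qed.

Lemma typed_tpdn : typed (mor_tp : mor F) [:: Dn; Up] [:: Up; Dn].
Proof.
pose ti := @typed_id F; pose tg := @typed_gen F.
exact: (typed_comp (typed_comp
  (typed_tens (typed_tens (tg gdp) (ti [:: Up])) (ti [:: Dn]))
  (typed_tens (typed_tens (ti [:: Dn]) (tg gs)) (ti [:: Dn])))
  (typed_tens (typed_tens (ti [:: Dn]) (ti [:: Up])) (tg gcp))).
Qed.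

Lemma heis_rel_typed a b f g :
  heis_rel a b f g -> typed f a b /\ typed g a b.
Proof.
pose ti := @typed_id F; pose tg := @typed_gen F.
case; (split; first last; [try exact: typed_id; try exact: typed_zero|]).
- exact: typed_comp (tg gs) (tg gs).
- exact: (typed_comp (typed_comp (typed_tens (ti [:: Up]) (tg gs))
    (typed_tens (tg gs) (ti [:: Up]))) (typed_tens (ti [:: Up]) (tg gs))).
- exact: (typed_comp (typed_comp (typed_tens (tg gs) (ti [:: Up]))
    (typed_tens (ti [:: Up]) (tg gs))) (typed_tens (tg gs) (ti [:: Up]))).
- exact: (typed_comp (typed_tens (tg gd) (ti [:: Up]))
    (typed_tens (ti [:: Up]) (tg gc))).
- exact: (typed_comp (typed_tens (ti [:: Dn]) (tg gd))
    (typed_tens (tg gc) (ti [:: Dn]))).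
- exact: (typed_comp (typed_tens (ti [:: Up]) (tg gdp))
    (typed_tens (tg gcp) (ti [:: Up]))).
- exact: (typed_comp (typed_tens (tg gdp) (ti [:: Dn]))
    (typed_tens (ti [:: Dn]) (tg gcp))).
- exact: typed_comp typed_tpdn typed_tup.
- apply: typed_add; [exact: typed_id | apply: typed_scale].
  exact: typed_comp (tg gc) (tg gdp).
- exact: typed_comp typed_tup typed_tpdn.
- exact: (typed_comp (typed_comp (typed_tens (tg gdp) (ti [:: Up]))
    (typed_tens (ti [:: Dn]) (tg gs))) (typed_tens (tg gc) (ti [:: Up]))).
- exact: typed_comp (tg gdp) (tg gc).
Qed.

(** Induction over the rules; with it a provable equation supplies the typing of both its sides. *)
Lemma meq_typed a b f g : meq a b f g -> typed f a b /\ typed g a b.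
Proof.
elim=> {a b f g}.
- exact: heis_rel_typed.
- by [].
- by move=> > _ [].
- by move=> > _ [? _] _ [_ ?].
- by move=> > _ [? ?] _ [? ?]; split; apply: typed_comp; eassumption.
- by move=> > _ [? ?] _ [? ?]; split; apply: typed_tens; eassumption.
- by move=> > _ [? ?] _ [? ?]; split; apply: typed_add; eassumption.
- by move=> > _ [? ?]; split; apply: typed_scale; eassumption.
- by move=> > h1 h2 h3; split; [apply: typed_comp h1 (typed_comp h2 h3) | apply: typed_comp (typed_comp h1 h2) h3].
- by move=> > h; split=> //; apply: typed_comp (typed_id _ _) h.
- by move=> > h; split=> //; apply: typed_comp h (typed_id _ _).
- move=> > h1 h2 h3; split; first by apply: typed_tens h1 (typed_tens h2 h3).
  by rewrite !catA; apply: typed_tens (typed_tens h1 h2) h3.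
- by move=> > h; split=> //; apply: (typed_tens (typed_id _ [::]) h).
- by move=> > h; split=> //; have := typed_tens h (typed_id _ [::]); rewrite !cats0.
- by move=> >; split; [apply: typed_tens; exact: typed_id | exact: typed_id].
- move=> > h1 h2 h3 h4; split; last exact: typed_tens (typed_comp h1 h2) (typed_comp h3 h4).
  exact: typed_comp (typed_tens h1 h3) (typed_tens h2 h4).
- by move=> > ? ? ?; split; do !apply: typed_add.
- by move=> > ? ?; split; do !apply: typed_add.
- by move=> > ?; split=> //; apply: typed_add => //; exact: typed_zero.
- by move=> > ?; split; [apply: typed_scale | exact: typed_zero].
- by move=> > ?; split=> //; apply: typed_scale.
- by move=> > ?; split; do !apply: typed_scale.
- by move=> > ?; split; [apply: typed_scale | apply: typed_add; apply: typed_scale].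
- by move=> > ? ?; split; [apply: typed_scale; apply: typed_add | apply: typed_add; apply: typed_scale].
- by move=> > h1 h2 h3; split; [apply: typed_comp (typed_add h1 h2) h3 | apply: typed_add; [apply: typed_comp h1 h3 | apply: typed_comp h2 h3]].
- by move=> > h1 h2 h3; split; [apply: typed_comp h1 (typed_add h2 h3) | apply: typed_add; [apply: typed_comp h1 h2 | apply: typed_comp h1 h3]].
- by move=> > h1 h2; split; [apply: typed_comp (typed_scale _ h1) h2 | apply: typed_scale (typed_comp h1 h2)].
- by move=> > h1 h2; split; [apply: typed_comp h1 (typed_scale _ h2) | apply: typed_scale (typed_comp h1 h2)].
- by move=> > h1 h2 h3; split; [apply: typed_tens (typed_add h1 h2) h3 | apply: typed_add; [apply: typed_tens h1 h3 | apply: typed_tens h2 h3]].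
- by move=> > h1 h2 h3; split; [apply: typed_tens h1 (typed_add h2 h3) | apply: typed_add; [apply: typed_tens h1 h2 | apply: typed_tens h1 h3]].
- by move=> > h1 h2; split; [apply: typed_tens (typed_scale _ h1) h2 | apply: typed_scale (typed_tens h1 h2)].
- by move=> > h1 h2; split; [apply: typed_tens h1 (typed_scale _ h2) | apply: typed_scale (typed_tens h1 h2)].
Qed.

End Typing.

(** * The module of morphisms between two words *)

HB.instance Definition _ (F : Type) := gen_eqMixin (mor F).
HB.instance Definition _ (F : Type) := gen_choiceMixin (mor F).

Section MorQuotient.
Context {F : comNzRingType}.
Variables a b : word.
Local Open Scope quotient_scope.
Implicit Types f g : mor F.

(* Ill-typed terms are sent to 0, so that the classes of terms form a module. *)
Definition mfix f : mor F := if `[< typed f a b >] then f else Zero a b.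

Lemma mfix_typed f : typed (mfix f) a b.
Proof. by rewrite /mfix; case: asboolP => // _; apply: typed_zero. Qed.

Lemma mfixE f : typed f a b -> mfix f = f.
Proof. by rewrite /mfix; case: asboolP. Qed.

Definition meqb : rel (mor F) := fun f g => `[< meq a b (mfix f) (mfix g) >].

Fact meqb_equiv : equiv_class_of meqb.
Proof.
split.
- by move=> f; apply/asboolP/meq_refl/mfix_typed.
- by move=> f g; apply/asbool_equiv_eq; split; apply: meq_sym.
- by move=> g f h /asboolP fg /asboolP gh; apply/asboolP; apply: meq_trans fg gh.
Qed.
Canonical meqb_rel := EquivRelPack meqb_equiv.

Definition mcls := {eq_quot meqb}.
HB.instance Definition _ := Choice.on mcls.

Definition cl f : mcls := \pi_mcls f.

Lemma cl_mfix f g : cl f = cl g <-> meq a b (mfix f) (mfix g).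
Proof. by split=> [/eqquotP/asboolP //|fg]; apply/eqquotP/asboolP. Qed.

Lemma clP f g : typed f a b -> typed g a b -> cl f = cl g <-> meq a b f g.
Proof. by move=> ft gt; rewrite cl_mfix !mfixE. Qed.

Lemma cl_meq f g : meq a b f g -> cl f = cl g.
Proof. by move=> fg; have [ft gt] := meq_typed fg; apply/clP. Qed.

Variant mcls_spec (x : mcls) : Prop :=
  MclsSpec f of typed f a b & x = cl f.

Lemma mclsP x : mcls_spec x.
Proof.
exists (mfix (repr x)); first exact: mfix_typed.
rewrite -[LHS]reprK; apply/cl_mfix; rewrite (mfixE (mfix_typed _)).
exact/meq_refl/mfix_typed.
Qed.

Definition mcls_rep (x : mcls) := mfix (repr x).

Lemma mcls_repK x : cl (mcls_rep x) = x.
Proof.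
rewrite -[RHS]reprK; apply/cl_mfix; rewrite (mfixE (mfix_typed _)).
exact/meq_refl/mfix_typed.
Qed.

Lemma mcls_rep_typed x : typed (mcls_rep x) a b.
Proof. exact: mfix_typed. Qed.

Lemma mcls_rep_cl f : typed f a b -> meq a b (mcls_rep (cl f)) f.
Proof. by move=> ft; apply/clP=> //; [exact: mcls_rep_typed | rewrite mcls_repK]. Qed.

Definition mcls_add x y := cl (Add (mcls_rep x) (mcls_rep y)).
Definition mcls_scale k x := cl (Scale k (mcls_rep x)).
Definition mcls_opp x := mcls_scale (-1)%R x.

Lemma mcls_addE f g : typed f a b -> typed g a b ->
  mcls_add (cl f) (cl g) = cl (Add f g).
Proof. by move=> ft gt; apply/cl_meq/meq_add; apply: mcls_rep_cl. Qed.

Lemma mcls_scaleE k f : typed f a b -> mcls_scale k (cl f) = cl (Scale k f).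
Proof. by move=> ft; apply/cl_meq/meq_scale; apply: mcls_rep_cl. Qed.

Fact mcls_addA : associative mcls_add.
Proof.
move=> x y z; have [f ft ->] := mclsP x; have [g gt ->] := mclsP y.
have [h ht ->] := mclsP z; rewrite !mcls_addE //; try exact: typed_add.
exact/cl_meq/meq_addA.
Qed.

Fact mcls_addC : commutative mcls_add.
Proof.
move=> x y; have [f ft ->] := mclsP x; have [g gt ->] := mclsP y.
by rewrite !mcls_addE //; apply/cl_meq/meq_addC.
Qed.

Fact mcls_add0 : left_id (cl (Zero a b)) mcls_add.
Proof.
move=> x; have [f ft ->] := mclsP x.
by rewrite mcls_addE; [apply/cl_meq/meq_add0 | apply: typed_zero |].
Qed.

Fact mcls_scaleDl x k l : mcls_scale (k + l)%R x =
  mcls_add (mcls_scale k x) (mcls_scale l x).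
Proof.
have [f ft ->] := mclsP x; rewrite !mcls_scaleE // mcls_addE; try exact: typed_scale.
exact/cl_meq/meq_scaleDl.
Qed.

Fact mcls_scale1 : left_id 1%R mcls_scale.
Proof.
move=> x; have [f ft ->] := mclsP x; rewrite mcls_scaleE //.
exact/cl_meq/meq_scale1.
Qed.

Fact mcls_addN : left_inverse (cl (Zero a b)) mcls_opp mcls_add.
Proof.
(* Negation is scaling by -1, so the inverse law reduces to the rule for the scalar 0. *)
move=> x; rewrite -{2}[x]mcls_scale1 /mcls_opp -mcls_scaleDl addNr.
by have [f ft ->] := mclsP x; rewrite mcls_scaleE //; apply/cl_meq/meq_scale0.
Qed.

HB.instance Definition _ := GRing.isZmodule.Build mcls
  mcls_addA mcls_addC mcls_add0 mcls_addN.

Fact mcls_scaleA k l x : mcls_scale k (mcls_scale l x) = mcls_scale (k * l)%R x.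
Proof.
have [f ft ->] := mclsP x; rewrite !mcls_scaleE //; last exact: typed_scale.
exact/cl_meq/meq_scaleA.
Qed.

Fact mcls_scaleDr : right_distributive mcls_scale mcls_add.
Proof.
move=> k x y; have [f ft ->] := mclsP x; have [g gt ->] := mclsP y.
rewrite mcls_addE // !mcls_scaleE //; last exact: typed_add.
rewrite mcls_addE; try exact: typed_scale.
exact/cl_meq/meq_scaleDr.
Qed.

HB.instance Definition _ := GRing.Zmodule_isLmodule.Build F mcls
  mcls_scaleA mcls_scale1 mcls_scaleDr mcls_scaleDl.

Local Open Scope ring_scope.

Lemma cl0 : cl (Zero a b) = 0. Proof. by []. Qed.

Lemma clD f g : typed f a b -> typed g a b -> cl (Add f g) = cl f + cl g.
Proof. by move=> ft gt; rewrite -mcls_addE. Qed.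

Lemma clZ k f : typed f a b -> cl (Scale k f) = k *: cl f.
Proof. by move=> ft; rewrite -mcls_scaleE. Qed.

(** The fold is the form in which [hcomp] writes the sum over the summands of the middle object. *)
Lemma cl_sum (I : Type) (r : seq I) (E : I -> mor F) :
  (forall i, List.In i r -> typed (E i) a b) ->
  cl (foldr (@Add F) (Zero a b) [seq E i | i <- r]) = \sum_(i <- r) cl (E i).
Proof.
elim: r => [|i r IH] Er /=; first by rewrite big_nil.
rewrite big_cons -IH => [|j jr]; last by apply: Er; right.
rewrite clD //; first by apply: Er; left.
elim: r Er {IH} => [|j r IH] Er /=; first exact: typed_zero.
apply: typed_add; first by apply: Er; right; left.
by apply: IH => k [<-|kr]; apply: Er; [left | right; right].
Qed.

End MorQuotient.

Arguments cl {F} a b f.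

(** * Bilinear composition of morphism classes *)

Section Composition.
Context {F : comNzRingType}.
Local Notation mcls := (@mcls F).
Local Open Scope ring_scope.

Definition ccomp (a b c : word) (y : mcls b c) (x : mcls a b) : mcls a c :=
  cl a c (Comp (mcls_rep y) (mcls_rep x)).

Lemma cl_comp a b c (g f : mor F) : typed g b c -> typed f a b ->
  cl a c (Comp g f) = ccomp (cl b c g) (cl a b f).
Proof.
move=> gt ft; apply/cl_meq/meq_sym.
by apply: (@meq_comp _ _ b); apply: mcls_rep_cl.
Qed.

Lemma ccompA a b c e (z : mcls c e) (y : mcls b c) (x : mcls a b) :
  ccomp z (ccomp y x) = ccomp (ccomp z y) x.
Proof.
have [f ft ->] := mclsP x; have [g gt ->] := mclsP y; have [h ht ->] := mclsP z.
rewrite -!cl_comp //; try by apply: typed_comp; eassumption.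
by apply/cl_meq; apply: meq_compA; eassumption.
Qed.

Lemma ccomp1l a b (x : mcls a b) : ccomp (cl b b (Id b)) x = x.
Proof.
have [f ft ->] := mclsP x; rewrite -cl_comp //; last exact: typed_id.
exact/cl_meq/meq_idl.
Qed.

Lemma ccomp1r a b (x : mcls a b) : ccomp x (cl a a (Id a)) = x.
Proof.
have [f ft ->] := mclsP x; rewrite -cl_comp //; last exact: typed_id.
exact/cl_meq/meq_idr.
Qed.

Lemma ccompDl a b c (y y' : mcls b c) (x : mcls a b) :
  ccomp (y + y') x = ccomp y x + ccomp y' x.
Proof.
have [f ft ->] := mclsP x; have [g gt ->] := mclsP y; have [h ht ->] := mclsP y'.
rewrite -clD // -!cl_comp //; last exact: typed_add.
rewrite -clD; try by apply: typed_comp; eassumption.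
by apply/cl_meq; apply: meq_compDl; eassumption.
Qed.

Lemma ccompDr a b c (y : mcls b c) (x x' : mcls a b) :
  ccomp y (x + x') = ccomp y x + ccomp y x'.
Proof.
have [f ft ->] := mclsP x; have [g gt ->] := mclsP x'; have [h ht ->] := mclsP y.
rewrite -clD // -!cl_comp //; last exact: typed_add.
rewrite -clD; try by apply: typed_comp; eassumption.
by apply/cl_meq; apply: meq_compDr; eassumption.
Qed.

Lemma ccompZl a b c k (y : mcls b c) (x : mcls a b) :
  ccomp (k *: y) x = k *: ccomp y x.
Proof.
have [f ft ->] := mclsP x; have [g gt ->] := mclsP y.
rewrite -clZ // -!cl_comp //; last exact: typed_scale.
rewrite -clZ; last by apply: typed_comp; eassumption.
by apply/cl_meq; apply: meq_compZl; eassumption.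
Qed.

Lemma ccompZr a b c k (y : mcls b c) (x : mcls a b) :
  ccomp y (k *: x) = k *: ccomp y x.
Proof.
have [f ft ->] := mclsP x; have [g gt ->] := mclsP y.
rewrite -clZ // -!cl_comp //; last exact: typed_scale.
rewrite -clZ; last by apply: typed_comp; eassumption.
by apply/cl_meq; apply: meq_compZr; eassumption.
Qed.

Lemma ccomp0l a b c (x : mcls a b) : ccomp (0 : mcls b c) x = 0.
Proof. by rewrite -[0 in LHS](scale0r 0) ccompZl scale0r. Qed.

Lemma ccomp0r a b c (y : mcls b c) : ccomp y (0 : mcls a b) = 0.
Proof. by rewrite -[0 in LHS](scale0r 0) ccompZr scale0r. Qed.

Lemma ccomp_suml a b c (I : Type) (r : seq I) (P : pred I)
    (E : I -> mcls b c) (x : mcls a b) :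
  ccomp (\sum_(i <- r | P i) E i) x = \sum_(i <- r | P i) ccomp (E i) x.
Proof. by rewrite (big_morph (fun y => ccomp y x) (fun y y' => ccompDl y y' x) (@ccomp0l a b c x)). Qed.

Lemma ccomp_sumr a b c (I : Type) (r : seq I) (P : pred I)
    (E : I -> mcls a b) (y : mcls b c) :
  ccomp y (\sum_(i <- r | P i) E i) = \sum_(i <- r | P i) ccomp y (E i).
Proof. by rewrite (big_morph (ccomp y) (ccompDr y) (@ccomp0r a b c y)). Qed.

End Composition.

(** * Matrices of morphism classes *)

Section HomTheory.
Context {F : comNzRingType}.
Local Notation hom := (Defs.hom F).
Local Notation mcls := (@mcls F).
Local Open Scope heis_scope.
Implicit Types X Y Z : obj.

Definition hcl X Y (f : hom X Y) i j : mcls (comp_of X i) (comp_of Y j) :=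
  cl _ _ (f i j).

(** Moves entrywise provable equality into the modules of classes, where equations can be rewritten
    and summed. *)
Definition heqP X Y (f g : hom X Y) :
  f =~ g <-> forall i j, i < size X -> j < size Y -> hcl f i j = hcl g i j.
Proof.
split=> fg i j iX jY; first exact/cl_meq/fg.
by apply/clP; [exact: entry_typed.. | exact: fg].
Qed.

Lemma hcl_hid X i j : hcl (hid X) i j =
  cl _ _ (if i == j then Id (comp_of X i) else Zero (comp_of X i) (comp_of X j)).
Proof. by []. Qed.

Lemma hcl_comp X Y Z (g : hom Y Z) (f : hom X Y) i k :
  i < size X -> k < size Z ->
  hcl (g \oh f) i k = (\sum_(0 <= j < size Y) ccomp (hcl g j k) (hcl f i j))%R.
Proof.
move=> iX kZ; rewrite /hcl /= cl_sum.
  rewrite /index_iota subn0 big_seq_cond [RHS]big_seq_cond; apply: eq_bigr => j.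
  rewrite andbT mem_iota => /= jY; rewrite /hcl (@cl_comp _ _ (comp_of Y j)) //; exact: entry_typed.
move=> j; have: all (fun j => j < size Y) (iota 0 (size Y)).
  by apply/allP => l; rewrite mem_iota.
elim: (iota _ _) => [|l r IH] //= /andP[lY rY] [<-|/IH]; last exact.
by apply: (@typed_comp _ _ (comp_of Y l)); apply: entry_typed.
Qed.

Lemma hcl_add X Y (f g : hom X Y) i j : i < size X -> j < size Y ->
  hcl (hadd f g) i j = (hcl f i j + hcl g i j)%R.
Proof. by move=> iX jY; rewrite /hcl clD //; apply: entry_typed. Qed.

Lemma hcl_scale X Y k (f : hom X Y) i j : i < size X -> j < size Y ->
  hcl (hscale k f) i j = (k *: hcl f i j)%R.
Proof. by move=> iX jY; rewrite /hcl clZ //; apply: entry_typed. Qed.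

Lemma hcl0 X Y i j : hcl (hzero X Y) i j = 0%R.
Proof. by []. Qed.

Lemma heq_refl X Y (f : hom X Y) : f =~ f.
Proof. exact/heqP. Qed.

Lemma heq_sym X Y (f g : hom X Y) : f =~ g -> g =~ f.
Proof. by move=> /heqP fg; apply/heqP => i j iX jY; rewrite fg. Qed.

Lemma heq_trans X Y (f g h : hom X Y) : f =~ g -> g =~ h -> f =~ h.
Proof. by move=> /heqP fg /heqP gh; apply/heqP => i j iX jY; rewrite fg ?gh. Qed.

Lemma hcomp_heq X Y Z (g g' : hom Y Z) (f f' : hom X Y) :
  g =~ g' -> f =~ f' -> g \oh f =~ g' \oh f'.
Proof.
move=> /heqP gg /heqP ff; apply/heqP => i k iX kZ; rewrite !hcl_comp //.
by rewrite !big_mkord; apply: eq_bigr => j _; rewrite gg ?ff.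
Qed.

Lemma hadd_heq X Y (f f' g g' : hom X Y) :
  f =~ f' -> g =~ g' -> hadd f g =~ hadd f' g'.
Proof.
by move=> /heqP ff /heqP gg; apply/heqP => i k iX kZ; rewrite !hcl_add // ff ?gg.
Qed.

Lemma hscale_heq X Y k (f f' : hom X Y) :
  f =~ f' -> hscale k f =~ hscale k f'.
Proof. by move=> /heqP ff; apply/heqP => i j iX jY; rewrite !hcl_scale // ff. Qed.

Lemma hcompA X Y Z T (h : hom Z T) (g : hom Y Z) (f : hom X Y) :
  h \oh (g \oh f) =~ h \oh g \oh f.
Proof.
apply/heqP => i l iX lT; rewrite !hcl_comp // !big_mkord.
under eq_bigr => k _ do rewrite hcl_comp // big_mkord ccomp_sumr.
rewrite exchange_big; apply: eq_bigr => j _ /=.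
rewrite hcl_comp // big_mkord ccomp_suml; apply: eq_bigr => k _.
exact: ccompA.
Qed.

Lemma hcomp1l X Y (f : hom X Y) : hid Y \oh f =~ f.
Proof.
apply/heqP => i l iX lT; rewrite !hcl_comp // !big_mkord.
rewrite (bigD1 (Ordinal lT)) //= hcl_hid eqxx ccomp1l big1 ?addr0 // => j.
by rewrite -val_eqE /= hcl_hid => /negPf ->; rewrite cl0 ccomp0l.
Qed.

Lemma hcomp1r X Y (f : hom X Y) : f \oh hid X =~ f.
Proof.
apply/heqP => i l iX lT; rewrite !hcl_comp // !big_mkord.
rewrite (bigD1 (Ordinal iX)) //= hcl_hid eqxx ccomp1r big1 ?addr0 // => j.
by rewrite -val_eqE /= hcl_hid eq_sym => /negPf ->; rewrite cl0 ccomp0r.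
Qed.

Lemma hcompDl X Y Z (g g' : hom Y Z) (f : hom X Y) :
  hadd g g' \oh f =~ hadd (g \oh f) (g' \oh f).
Proof.
apply/heqP => i l iX lT; rewrite hcl_add // !hcl_comp // !big_mkord -big_split.
by apply: eq_bigr => j _; rewrite hcl_add // ccompDl.
Qed.

Lemma hcompDr X Y Z (g : hom Y Z) (f f' : hom X Y) :
  g \oh hadd f f' =~ hadd (g \oh f) (g \oh f').
Proof.
apply/heqP => i l iX lT; rewrite hcl_add // !hcl_comp // !big_mkord -big_split.
by apply: eq_bigr => j _; rewrite hcl_add // ccompDr.
Qed.

Lemma hcompZl X Y Z k (g : hom Y Z) (f : hom X Y) :
  hscale k g \oh f =~ hscale k (g \oh f).
Proof.
apply/heqP => i l iX lT; rewrite hcl_scale // !hcl_comp // !big_mkord scaler_sumr.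
by apply: eq_bigr => j _; rewrite hcl_scale // ccompZl.
Qed.

Lemma hcompZr X Y Z k (g : hom Y Z) (f : hom X Y) :
  g \oh hscale k f =~ hscale k (g \oh f).
Proof.
apply/heqP => i l iX lT; rewrite hcl_scale // !hcl_comp // !big_mkord scaler_sumr.
by apply: eq_bigr => j _; rewrite hcl_scale // ccompZr.
Qed.

Lemma hcomp0l X Y Z (f : hom X Y) : hzero Y Z \oh f =~ hzero X Z.
Proof.
apply/heqP => i l iX lT; rewrite !hcl_comp // big1 ?hcl0 // => j _.
by rewrite hcl0 ccomp0l.
Qed.

Lemma hcomp0r X Y Z (g : hom Y Z) : g \oh hzero X Y =~ hzero X Z.
Proof.
apply/heqP => i l iX lT; rewrite !hcl_comp // big1 ?hcl0 // => j _.
by rewrite hcl0 ccomp0r.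
Qed.

End HomTheory.

(** * Routes *)

Notation state := {fset nat}.
Notation route := (seq (option nat)).

(* The action on set species behind Khovanov's action on induction and
   restriction of symmetric groups: Up removes a point from a finite set U,
   Dn adds the point [fresh U].  Reading a word from the left, the choices
   made form a route: [Some u] removes u, [None] adds the new point. *)
Definition fresh (U : state) : nat := (\max_(x <- U) x).+1.

Notation reopen U u := (fresh (U `\ u) |` (U `\ u))%fset.
Notation inj_on U f := {in (U : {fset nat}) &, injective (f : nat -> nat)}.

Section Routes.
Local Open Scope fset_scope.

Lemma fresh_notin U : fresh U \notin U.
Proof.
apply/negP => fU; have := @leq_bigmax_seq _ (enum_fset U) xpredT id _ fU isT.
by rewrite /fresh ltnn.
Qed.

Lemma fresh_neq (U : state) x : x \in U -> (x == fresh U) = false.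
Proof. by move=> xU; apply/negbTE/eqP => xf; have := fresh_notin U; rewrite -xf xU. Qed.

Lemma fresh1K (U : state) : (fresh U |` U) `\ fresh U = U.
Proof. by rewrite fsetU1K // fresh_notin. Qed.

Definition step (U : state) (o : option nat) : state :=
  if o is Some u then U `\ u else fresh U |` U.

Definition st (U : state) (l : route) : state := foldl step U l.

Fixpoint ok (U : state) (l : route) : bool :=
  if l is o :: l' then (if o is Some u then u \in U else true) && ok (step U o) l'
  else true.

Definition wd (l : route) : word := [seq if o is Some _ then Up else Dn | o <- l].

(* [upf], [ren] and [sg] transport a function on U, a route from U, and the
   function itself to the end of that route along an injection. *)
Definition upf (U : state) (f : nat -> nat) : nat -> nat :=
  fun x => if x == fresh U then fresh (f @` U) else f x.

Fixpoint ren (U : state) (f : nat -> nat) (l : route) : route :=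
  match l with
  | [::] => [::]
  | Some u :: l' => Some (f u) :: ren (U `\ u) f l'
  | None :: l' => None :: ren (fresh U |` U) (upf U f) l'
  end.

Fixpoint sg (U : state) (f : nat -> nat) (l : route) : nat -> nat :=
  match l with
  | [::] => f
  | Some u :: l' => sg (U `\ u) f l'
  | None :: l' => sg (fresh U |` U) (upf U f) l'
  end.

Lemma inj_onS (U V : state) f : V `<=` U -> inj_on U f -> inj_on V f.
Proof. by move=> /fsubsetP VU fU x y /VU xU /VU yU; apply: fU. Qed.

Lemma im_fsetD1 (U : state) f u : inj_on U f -> u \in U ->
  f @` (U `\ u) = (f @` U) `\ f u.
Proof.
move=> fU uU; apply/fsetP => y; apply/imfsetP/fsetD1P.
  move=> [x /= /fsetD1P[xu xU] ->]; split; last exact: in_imfset.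
  by apply/eqP => /(fU _ _ xU uU) /eqP; apply/negP.
move=> [yu /imfsetP[x /= xU yE]]; exists x => //=; apply/fsetD1P; split=> //.
by apply: contraNneq yu => <-; rewrite yE.
Qed.

Lemma upf_fresh U f : upf U f (fresh U) = fresh (f @` U).
Proof. by rewrite /upf eqxx. Qed.

Lemma upf_in (U : state) f x : x \in U -> upf U f x = f x.
Proof. by move=> xU; rewrite /upf fresh_neq. Qed.

Lemma eq_im (U : state) (f g : nat -> nat) : {in U, f =1 g} -> f @` U = g @` U.
Proof. by move=> fg; apply: eq_in_imfset. Qed.

Lemma im_upf U f : upf U f @` (fresh U |` U) = fresh (f @` U) |` (f @` U).
Proof.
rewrite imfsetU imfset_fset1 upf_fresh; congr (_ |` _).
by apply: eq_in_imfset => // x xU; rewrite upf_in.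
Qed.

Lemma inj_upf U f : inj_on U f -> inj_on (fresh U |` U) (upf U f).
Proof.
have fN x : x \in U -> f x != fresh (f @` U).
  by move=> xU; rewrite fresh_neq //; apply: in_imfset.
move=> fU x y /fset1UP[->|xU] /fset1UP[->|yU] //; rewrite ?upf_fresh ?upf_in //.
- by move=> E; case/eqP: (fN _ yU).
- by move=> E; case/eqP: (fN _ xU).
exact: fU.
Qed.

Lemma inj_D1 (U : state) f u : inj_on U f -> inj_on (U `\ u) f.
Proof. exact/inj_onS/fsubD1set. Qed.
Hint Resolve inj_upf inj_D1 : core.

Lemma st_cat U l1 l2 : st U (l1 ++ l2) = st (st U l1) l2.
Proof. exact: foldl_cat. Qed.

Lemma ok_cat U l1 l2 : ok U (l1 ++ l2) = ok U l1 && ok (st U l1) l2.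
Proof. by elim: l1 U => //= o l1 IH U; rewrite IH andbA. Qed.

Lemma wd_cat l1 l2 : wd (l1 ++ l2) = wd l1 ++ wd l2.
Proof. exact: map_cat. Qed.

Lemma size_wd l : size (wd l) = size l.
Proof. exact: size_map. Qed.

Lemma ren_cat U f l1 l2 :
  ren U f (l1 ++ l2) = ren U f l1 ++ ren (st U l1) (sg U f l1) l2.
Proof. by elim: l1 U f => [|[u|] l1 IH] U f //=; rewrite IH. Qed.

Lemma wd_ren U f l : wd (ren U f l) = wd l.
Proof. by elim: l U f => [|[u|] l IH] U f //=; rewrite IH. Qed.

Lemma size_ren U f l : size (ren U f l) = size l.
Proof. by rewrite -!size_wd wd_ren. Qed.

Lemma inj_sg U f l : inj_on U f -> inj_on (st U l) (sg U f l).
Proof. by elim: l U f => [|[u|] l IH] U f fU //=; apply: IH; auto. Qed.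

Lemma st_ren U f l : inj_on U f -> ok U l ->
  st (f @` U) (ren U f l) = sg U f l @` st U l.
Proof.
elim: l U f => [|[u|] l IH] U f fU //= => [/andP[uU okl]|okl].
  by rewrite -im_fsetD1 // IH; auto.
by rewrite -im_upf IH; auto.
Qed.

Lemma ok_ren U f l : inj_on U f -> ok U l -> ok (f @` U) (ren U f l).
Proof.
elim: l U f => [|[u|] l IH] U f fU //= => [/andP[uU okl]|okl].
  by rewrite in_imfset //= -im_fsetD1 // IH; auto.
by rewrite -im_upf IH; auto.
Qed.

(** A legal route removes only points of [U] and points added on the way, and the new names of the
    latter depend only on the image of [U]. *)
Lemma ren_ext U f g l : {in U, f =1 g} -> ok U l -> ren U f l = ren U g l.
Proof.
elim: l U f g => [|[u|] l IH] U f g fg //= => [/andP[uU okl]|okl].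
  by rewrite fg // (IH _ f g) // => x /fsetD1P[_]; apply: fg.
rewrite (IH _ _ (upf U g)) // => x /fset1UP[->|xU].
  by rewrite !upf_fresh (eq_im fg).
by rewrite !upf_in // fg.
Qed.

Lemma ren_id U f l : {in U, f =1 id} -> ok U l -> ren U f l = l.
Proof.
elim: l U f => [|[u|] l IH] U f fg //= => [/andP[uU okl]|okl].
  by rewrite fg // IH // => x /fsetD1P[_]; apply: fg.
rewrite IH // => x /fset1UP[->|xU]; last by rewrite !upf_in // fg.
by rewrite upf_fresh (eq_im fg) // imfset_id.
Qed.

Lemma ren_comp U f g l : inj_on U f -> ok U l ->
  ren (f @` U) g (ren U f l) = ren U (g \o f) l.
Proof.
elim: l U f g => [|[u|] l IH] U f g fU //= => [/andP[uU okl]|okl].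
  by rewrite -im_fsetD1 // IH; auto.
rewrite -im_upf IH; auto.
congr (_ :: _); apply: ren_ext => // x /fset1UP[->|xU] /=.
  by rewrite !upf_fresh -imfset_comp.
by rewrite !upf_in //; apply: in_imfset.
Qed.

(* The bijections between U and U - u with a new point added. *)
Definition glue (U : state) (u : nat) : nat -> nat :=
  fun x => if x == fresh (U `\ u) then u else x.

Definition cut (U : state) (u : nat) : nat -> nat :=
  fun x => if x == u then fresh (U `\ u) else x.

Lemma glue_fresh U u : glue U u (fresh (U `\ u)) = u.
Proof. by rewrite /glue eqxx. Qed.

Lemma glue_in (U : state) u x : x \in U `\ u -> glue U u x = x.
Proof. by move=> xU; rewrite /glue fresh_neq. Qed.

Lemma cut_self U u : cut U u u = fresh (U `\ u).
Proof. by rewrite /cut eqxx. Qed.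

Lemma cut_in (U : state) u x : x \in U `\ u -> cut U u x = x.
Proof. by move=> /fsetD1P[/negbTE xu _]; rewrite /cut xu. Qed.

Lemma glueK U u : {in reopen U u, cancel (glue U u) (cut U u)}.
Proof.
by move=> x /fset1UP[->|xU]; rewrite ?glue_fresh ?cut_self // glue_in ?cut_in.
Qed.

Lemma cutK (U : state) u : {in U, cancel (cut U u) (glue U u)}.
Proof.
move=> x xU; have [->|xu] := eqVneq x u; first by rewrite cut_self glue_fresh.
by rewrite cut_in ?glue_in // !inE xu.
Qed.

Lemma inj_glue U u : inj_on (reopen U u) (glue U u).
Proof. exact: can_in_inj (@glueK U u). Qed.

Lemma inj_cut (U : state) u : inj_on U (cut U u).
Proof. exact: can_in_inj (@cutK U u). Qed.

Lemma im_cut (U : state) u : u \in U -> cut U u @` U = reopen U u.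
Proof.
move=> uU; transitivity (cut U u @` (u |` U `\ u)); first by rewrite fsetD1K.
rewrite imfsetU imfset_fset1 cut_self; congr (_ |` _); rewrite -[RHS]imfset_id.
by apply: eq_im => x xU; rewrite cut_in.
Qed.

Lemma im_glue (U : state) u : u \in U -> glue U u @` reopen U u = U.
Proof.
move=> uU; transitivity (glue U u @` (cut U u @` U)); first by rewrite im_cut.
rewrite -imfset_comp -[RHS]imfset_id.
by apply: eq_im => x xU /=; rewrite cutK.
Qed.

End Routes.

(** * The action of terms on functions of routes *)

Section Action.
Context {F : comNzRingType}.
Local Open Scope fset_scope.
Local Open Scope ring_scope.
Implicit Types (chi : route -> F) (U : state) (l r k : route).

(** The recursion of [op] runs over raw terms, and in a tensor product it must know how many letters
    the left factor leaves before the right factor acts. *)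
Fixpoint mcod (f : mor F) : word :=
  match f with
  | Gen g => gen_cod g
  | Id a => a
  | Comp g f => mcod g
  | Tens f g => mcod f ++ mcod g
  | Zero a b => b
  | Add f g => mcod f
  | Scale k f => mcod f
  end.

Lemma mcodE f a b : typed f a b -> mcod f = b.
Proof. by elim=> //= *; congruence. Qed.

(* A morphism a -> b acts contravariantly, from functions of routes along b to
   functions of routes along a; routes may continue beyond the word. *)
Definition opgen (g : gen) U chi l : F :=
  match g with
  | gs => if l is Some u :: Some v :: r then chi (Some v :: Some u :: r) else 0
  | gc => chi (None :: Some (fresh U) :: l)
  | gd => if l is Some u :: None :: r then chi (ren (reopen U u) (glue U u) r)
          else 0
  | gcp => \sum_(u <- U) chi (Some u :: None :: ren U (cut U u) l)
  | gdp => if l is None :: Some y :: r then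
             if y == fresh U then chi r else 0
           else 0
  end.

Definition after (k : nat) (G : state -> (route -> F) -> route -> F) U chi l : F :=
  G (st U (take k l)) (fun r => chi (take k l ++ r)) (drop k l).

Fixpoint op (f : mor F) U chi l {struct f} : F :=
  match f with
  | Gen g => opgen g U chi l
  | Id a => chi l
  | Comp g f => op f U (op g U chi) l
  | Tens f g => op f U (after (size (mcod f)) (op g) U chi) l
  | Zero a b => 0
  | Add f g => op f U chi l + op g U chi l
  | Scale k f => k * op f U chi l
  end.

Lemma after_cat n G U chi l r : size l = n ->
  after n G U chi (l ++ r) = G (st U l) (fun r => chi (l ++ r)) r.
Proof. by move=> <-; rewrite /after take_size_cat // drop_size_cat. Qed.

Lemma size_wdE l a : wd l = a -> size l = size a.
Proof. by move=> <-; rewrite size_wd. Qed.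

(* Operators of the form chi, r |-> sum_i c_i chi (k_i ++ t_i r), for routes
   k_i along b and bijections t_i between the final sets of l and of k_i. *)
Inductive local U l (b : word) : ((route -> F) -> route -> F) -> Prop :=
  | local0 T : (forall chi r, ok (st U l) r -> T chi r = 0) -> local U l b T
  | localS c k t T T' : ok U k -> wd k = b -> inj_on (st U l) t ->
      t @` (st U l) = st U k -> local U l b T' ->
      (forall chi r, ok (st U l) r ->
         T chi r = c * chi (k ++ ren (st U l) t r) + T' chi r) ->
      local U l b T.

Lemma local_eq U l b T T' :
  (forall chi r, ok (st U l) r -> T chi r = T' chi r) ->
  local U l b T' -> local U l b T.
Proof.
move=> TT' T'loc; case: T'loc TT' => [T1 T10|c k t T1 T1' okk kb tinj tst T1loc T1E] TT'.
  by apply: local0 => chi r rok; rewrite TT' // T10.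
by apply: (localS (c := c) okk kb tinj tst T1loc) => chi r rok; rewrite TT' // T1E.
Qed.

Lemma local1 U l b k t T : ok U k -> wd k = b -> inj_on (st U l) t ->
  t @` (st U l) = st U k ->
  (forall chi r, ok (st U l) r -> T chi r = chi (k ++ ren (st U l) t r)) ->
  local U l b T.
Proof.
move=> okk kb tinj tst TE.
apply: (localS (c := 1) (T' := fun _ _ => 0) okk kb tinj tst); first exact: local0.
by move=> chi r rok; rewrite TE // mul1r addr0.
Qed.

Lemma local1id U l b k T : ok U k -> wd k = b -> st U l = st U k ->
  (forall chi r, ok (st U l) r -> T chi r = chi (k ++ r)) ->
  local U l b T.
Proof.
move=> okk kb stk TE; apply: (local1 (t := id) okk kb) => //.
  by rewrite -stk imfset_id.
by move=> chi r rok; rewrite TE // ren_id.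
Qed.

Lemma localD U l b T T' : local U l b T -> local U l b T' ->
  local U l b (fun chi r => T chi r + T' chi r).
Proof.
move=> Tloc T'loc; elim: Tloc => [T1 T10|c k t T1 T1' okk kb tinj tst _ IH T1E].
  by apply: local_eq T'loc => chi r rok; rewrite T10 // add0r.
apply: (localS (c := c) okk kb tinj tst IH) => chi r rok.
by rewrite T1E // addrA.
Qed.

Lemma localZ U l b a T : local U l b T -> local U l b (fun chi r => a * T chi r).
Proof.
elim=> [T1 T10|c k t T1 T1' okk kb tinj tst _ IH T1E].
  by apply: local0 => chi r rok; rewrite T10 // mulr0.
apply: (localS (c := a * c) okk kb tinj tst IH) => chi r rok.
by rewrite T1E // mulrDr mulrA.
Qed.

Lemma local_sum (I : eqType) (s : seq I) U l b (T : I -> (route -> F) -> route -> F) :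
  (forall i, i \in s -> local U l b (T i)) ->
  local U l b (fun chi r => \sum_(i <- s) T i chi r).
Proof.
elim: s => [|i s IH] Ts.
  by apply: local0 => chi r _; rewrite big_nil.
apply: (@local_eq _ _ _ _ (fun chi r => T i chi r + \sum_(j <- s) T j chi r)).
  by move=> chi r _; rewrite big_cons.
apply: localD; first by apply: Ts; rewrite inE eqxx.
by apply: IH => j js; apply: Ts; rewrite inE js orbT.
Qed.

Lemma local_trans U l k c t R : inj_on (st U l) t -> t @` (st U l) = st U k ->
  local U k c R -> local U l c (fun chi r => R chi (ren (st U l) t r)).
Proof.
move=> tinj tst; elim=> [R1 R10|c' k' t' R1 R1' okk' k'b t'inj t'st _ IH R1E].
  by apply: local0 => chi r rok; rewrite R10 // -tst ok_ren.
have inj' : inj_on (st U l) (t' \o t).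
  move=> x y xU yU /= /t'inj; rewrite -tst => /(_ _ _)/tinj -> //; exact: in_imfset.
have st' : (t' \o t) @` (st U l) = st U k' by rewrite -t'st -tst imfset_comp.
apply: (localS (c := c') okk' k'b inj' st' IH) => chi r rok.
by rewrite R1E -tst ?ok_ren // ren_comp.
Qed.

Lemma local_comp U l b c T (S : (route -> F) -> route -> F) : local U l b T ->
  (forall k, ok U k -> wd k = b -> local U k c (fun chi r => S chi (k ++ r))) ->
  local U l c (fun chi r => T (S chi) r).
Proof.
move=> Tloc Sloc; elim: Tloc => [T1 T10|c' k t T1 T1' okk kb tinj tst _ IH T1E].
  by apply: local0 => chi r rok; rewrite T10.
apply: local_eq (localD (localZ c' (local_trans tinj tst (Sloc k okk kb))) IH).
by move=> chi r rok; rewrite T1E.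
Qed.

Lemma local_prefix U k b l b' R : ok U k -> wd k = b ->
  local (st U k) l b' R ->
  local U (k ++ l) (b ++ b') (fun chi r => R (fun r => chi (k ++ r)) r).
Proof.
move=> okk kb; elim=> [R1 R10|c' k' t R1 R1' okk' k'b tinj tst _ IH R1E].
  by apply: local0 => chi r; rewrite st_cat => rok; rewrite R10.
apply: (localS (c := c') (k := k ++ k') (t := t) _ _ _ _ IH).
- by rewrite ok_cat okk.
- by rewrite wd_cat kb k'b.
- by rewrite st_cat.
- by rewrite !st_cat.
by move=> chi r; rewrite st_cat => rok; rewrite R1E // catA.
Qed.

(** The left operator replaces [l] by [k] and renames what follows along [t]. So [G] meets a renamed
    copy of [l2], of the same shape, and the tail beyond it is renamed along [sg (st U l) t l2]. *)
Lemma local_tens U l b l2 b' T (G : state -> (route -> F) -> route -> F) :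
  local U l b T -> ok U (l ++ l2) ->
  (forall V l2', ok V l2' -> wd l2' = wd l2 ->
     local V l2' b' (fun chi r => G V chi (l2' ++ r))) ->
  local U (l ++ l2) (b ++ b')
    (fun chi r => T (after (size b) G U chi) (l2 ++ r)).
Proof.
move=> Tloc + Gloc; rewrite ok_cat => /andP[okl okl2].
elim: Tloc => [T1 T10|c' k t T1 T1' okk kb tinj tst _ IH T1E].
  by apply: local0 => chi r; rewrite st_cat => rok; rewrite T10 // ok_cat okl2.
set l2' := ren (st U l) t l2.
have okl2' : ok (st U k) l2' by rewrite -tst ok_ren.
have locG := local_prefix okk kb (Gloc _ _ okl2' (wd_ren _ _ _)).
have inj' : inj_on (st U (l ++ l2)) (sg (st U l) t l2) by rewrite st_cat; apply: inj_sg.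
have st' : sg (st U l) t l2 @` st U (l ++ l2) = st U (k ++ l2').
  by rewrite !st_cat -tst st_ren.
apply: local_eq (localD (localZ c' (local_trans inj' st' locG)) IH).
move=> chi r; rewrite st_cat => rok; rewrite T1E; last by rewrite ok_cat okl2.
by rewrite after_cat ?(size_wdE kb) // ren_cat.
Qed.

Lemma wd2 l x y : wd l = [:: x; y] ->
  exists o1 o2, [/\ l = [:: o1; o2], x = (if o1 is Some _ then Up else Dn)
    & y = (if o2 is Some _ then Up else Dn)].
Proof. by case: l => [|o1 [|o2 []]] //= [<- <-]; exists o1, o2. Qed.

Lemma wd_catP l a b : wd l = a ++ b ->
  exists l1 l2, [/\ l = l1 ++ l2, wd l1 = a & wd l2 = b].
Proof.
move=> lE; exists (take (size a) l), (drop (size a) l).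
by rewrite cat_take_drop /wd map_take map_drop -/(wd l) lE take_size_cat ?drop_size_cat.
Qed.

(** The set reached by a surviving route is identified with the old one by equality for s, c and d',
    by [glue] for d, where the added point takes over the name of the removed one, and by [cut] in
    the other direction for c'. *)
Lemma opgen_local g U l : wd l = gen_dom g -> ok U l ->
  local U l (gen_cod g) (fun chi r => opgen g U chi (l ++ r)).
Proof.
case: g => /=.
- move=> /wd2[[u|] [[v|] [-> //= _ _]]] /andP[uU /andP[/fsetD1P[vu vU] _]].
  apply: (@local1id _ _ _ [:: Some v; Some u]) => //=.
    by rewrite vU /= !inE uU eq_sym vu.
  by apply/fsetP => x; rewrite !inE andbCA.
- case: l => // _ _ /=; apply: (@local1id _ _ _ [:: None; Some (fresh U)]) => //=.
    by rewrite !inE eqxx.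
  by rewrite fresh1K.
- move=> /wd2[[u|] [[v|] [-> //= _ _]]] /andP[uU _].
  by apply: (@local1 _ _ _ [::] (glue U u)) => //=; [exact: inj_glue | exact: im_glue].
- case: l => // _ _ /=; apply: local_sum => u uU.
  apply: (@local1 _ _ _ [:: Some u; None] (cut U u)) => //=; first by rewrite uU.
    exact: inj_cut.
  exact: im_cut.
move=> /wd2[[u|] [[v|] [-> //= _ _]]] /andP[vU _].
have [->|vf] := eqVneq v (fresh U); last by apply: local0.
by apply: (@local1id _ _ _ [::]) => //=; rewrite fresh1K.
Qed.

(** An operator sees only finitely many routes along b, each continued by a renamed tail.
    Extensionality, linearity and naturality are all read off from this form. *)
Lemma typed_local f a b : typed f a b -> forall U l, wd l = a -> ok U l ->
  local U l b (fun chi r => op f U chi (l ++ r)).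
Proof.
elim=> {f a b}.
- by move=> g U l; apply: opgen_local.
- by move=> a U l la okl; apply: (@local1id _ _ _ l).
- move=> a b c g f gt IHg ft IHf U l la okl /=.
  by apply: (local_comp (IHf U l la okl)) => k okk kb; apply: IHg.
- move=> a b a' b' f g ft IHf gt IHg U l la okl /=.
  rewrite (mcodE ft); have [l1 [l2 [lE l1a l2a]]] := wd_catP la; subst l.
  move: (okl); rewrite ok_cat => /andP[okl1 okl2].
  apply: local_eq (local_tens (IHf U l1 l1a okl1) okl _); last first.
    by move=> V l2' okl2' wdl2'; apply: (IHg V l2'); rewrite ?wdl2'.
  by move=> chi r _; rewrite catA.
- by move=> a b U l _ _; apply: local0.
- by move=> a b f g _ IHf _ IHg U l la okl /=; apply: localD; [apply: IHf | apply: IHg].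
- by move=> a b k f _ IHf U l la okl /=; apply: localZ; apply: IHf.
Qed.
End Action.

(** * Invariance of the action under the relations *)

Section Soundness.
Context {F : comNzRingType}.
Local Open Scope fset_scope.
Local Open Scope ring_scope.
Implicit Types (chi : route -> F) (U : state) (l r k : route).
Local Notation op := (@op F).

Lemma local_ext U l b (T : (route -> F) -> route -> F) chi chi' r :
  local U l b T -> ok (st U l) r ->
  (forall k r', wd k = b -> ok U (k ++ r') -> wd r' = wd r ->
     #|` st U k| = #|` st U l| -> chi (k ++ r') = chi' (k ++ r')) ->
  T chi r = T chi' r.
Proof.
move=> Tloc rok chiE; elim: Tloc => [T1 T10|c k t T1 T1' okk kb tinj tst _ IH T1E].
  by rewrite !T10.
rewrite !T1E // IH chiE ?wd_ren //; first by rewrite ok_cat okk -tst ok_ren.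
by rewrite -tst card_in_imfset.
Qed.

Lemma local_lin U l b (T : (route -> F) -> route -> F) a chi chi' r :
  local U l b T -> ok (st U l) r ->
  T (fun k => a * chi k + chi' k) r = a * T chi r + T chi' r.
Proof.
move=> Tloc rok; elim: Tloc => [T1 T10|c k t T1 T1' okk kb tinj tst _ IH T1E].
  by rewrite !T10 // mulr0 addr0.
by rewrite !T1E // IH !mulrDr addrACA mulrCA.
Qed.

(** The shape of the tail is recorded so that a further tensor factor can act on it, and the
    cardinality so that the action can be cut down to finite matrices. *)
Lemma op_ext f a b U chi chi' l r : typed f a b -> wd l = a -> ok U (l ++ r) ->
  (forall k r', wd k = b -> ok U (k ++ r') -> wd r' = wd r ->
     #|` st U k| = #|` st U l| -> chi (k ++ r') = chi' (k ++ r')) ->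
  op f U chi (l ++ r) = op f U chi' (l ++ r).
Proof.
rewrite ok_cat => ft la /andP[okl okr] chiE.
exact: (local_ext (typed_local ft la okl)).
Qed.

Lemma op_lin f a b U c chi chi' l r : typed f a b -> wd l = a -> ok U (l ++ r) ->
  op f U (fun k => c * chi k + chi' k) (l ++ r) =
  c * op f U chi (l ++ r) + op f U chi' (l ++ r).
Proof.
rewrite ok_cat => ft la /andP[okl okr].
exact: (local_lin c chi chi' (typed_local ft la okl)).
Qed.

Lemma op0 f a b U l r : typed f a b -> wd l = a -> ok U (l ++ r) ->
  op f U (fun=> 0) (l ++ r) = 0.
Proof.
move=> ft la okl.
(* Linearity with coefficient -1 on two zero functions makes the value equal to its negative plus
   itself. *)
have := op_lin (-1) (fun=> 0) (fun=> 0) ft la okl.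
rewrite (_ : (fun _ : route => _) = (fun=> 0)); last by apply/funext => k; rewrite mulr0 add0r.
by rewrite mulN1r addNr.
Qed.

Lemma opD f a b U chi chi' l r : typed f a b -> wd l = a -> ok U (l ++ r) ->
  op f U (fun k => chi k + chi' k) (l ++ r) =
  op f U chi (l ++ r) + op f U chi' (l ++ r).
Proof.
move=> ft la okl; have := op_lin 1 chi chi' ft la okl; rewrite mul1r => <-.
by congr (op _ _ _ _); apply/funext => k; rewrite mul1r.
Qed.

Lemma opZ f a b U c chi l r : typed f a b -> wd l = a -> ok U (l ++ r) ->
  op f U (fun k => c * chi k) (l ++ r) = c * op f U chi (l ++ r).
Proof.
move=> ft la okl; have := op_lin c chi (fun=> 0) ft la okl.
rewrite (op0 ft la okl) addr0 => <-.
by congr (op _ _ _ _); apply/funext => k; rewrite addr0.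
Qed.

(** The image of a fresh point need not be the fresh point of the image; [upf] absorbs the
    difference, and up to this correction [glue] and [cut] commute with the injection. *)
Lemma opgen_equiv g U t chi l r : inj_on U t -> wd l = gen_dom g ->
  ok U (l ++ r) ->
  opgen g (t @` U)%fset chi (ren U t (l ++ r)) =
  opgen g U (fun k => chi (ren U t k)) (l ++ r).
Proof.
move=> tU; case: g => /=.
- move=> /wd2[[u|] [[v|] [-> //= _ _]]] /and3P[uU /fsetD1P[vu vU] _].
  by congr (chi [:: _, _ & ren _ _ _]); apply/fsetP => x; rewrite !inE andbCA.
- case: l => //= _ okr; rewrite upf_fresh fresh1K; congr (chi [:: _, _ & _]).
  by apply: ren_ext => // x xU; rewrite upf_in.
- move=> /wd2[[u|] [[v|] [-> //= _ _]]] /andP[uU okr].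
  congr chi; rewrite -im_fsetD1 // -im_upf.
  rewrite ren_comp //; last by apply: inj_upf; apply: inj_D1.
  have -> : ren U t (ren (reopen U u) (glue U u) r)
      = ren (reopen U u) (t \o glue U u) r.
    by rewrite -ren_comp ?im_glue //; apply: inj_glue.
  apply: ren_ext => // x /fset1UP[->|xV] /=.
    by rewrite glue_fresh upf_fresh im_fsetD1 // glue_fresh.
  by rewrite upf_in // !glue_in // -im_fsetD1 // in_imfset.
- case: l => //= _ okr; rewrite big_imfset //=.
  rewrite big_seq [RHS]big_seq; apply: eq_bigr => u uU.
  rewrite ren_comp //; congr (chi [:: _, _ & _]).
  have -> : ren (reopen U u) (upf (U `\ u) t) (ren U (cut U u) r)
      = ren U (upf (U `\ u) t \o cut U u) r.
    by rewrite -ren_comp ?im_cut //; apply: inj_cut.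
  apply: ren_ext => // x xU /=; have [->|xu] := eqVneq x u.
    by rewrite !cut_self upf_fresh im_fsetD1.
  have xV : x \in U `\ u by rewrite !inE xu.
  by rewrite (cut_in xV) upf_in // cut_in // -im_fsetD1 // in_imfset.
move=> /wd2[[u|] [[v|] [-> //= _ _]]] /andP[vU okr].
case/fset1UP: vU okr => [->|vU]; first rewrite upf_fresh !eqxx fresh1K => okr.
  by congr chi; apply: ren_ext => // x xU; rewrite upf_in.
by rewrite upf_in // !fresh_neq // in_imfset.
Qed.

Lemma op_equiv f a b : typed f a b -> forall U t chi l r, inj_on U t ->
  wd l = a -> ok U (l ++ r) ->
  op f (t @` U)%fset chi (ren U t (l ++ r)) =
  op f U (fun k => chi (ren U t k)) (l ++ r).
Proof.
elim=> {f a b}.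
- by move=> g U t chi l r tU; apply: opgen_equiv.
- by [].
- move=> a b c g f gt IHg ft IHf U t chi l r tU la okl /=.
  rewrite IHf //; apply: (op_ext ft la okl) => k r' kb okk _ _.
  exact: IHg.
- move=> a b a' b' f g ft IHf gt IHg U t chi l r tU la okl /=.
  have [l1 [l2 [lE l1a l2a]]] := wd_catP la; subst l.
  rewrite -catA in okl *; rewrite IHf //; apply: (op_ext ft l1a okl) => k r' kb.
  rewrite ok_cat => /andP[okk okr'].
  rewrite (mcodE ft) wd_cat ren_cat => r'a _.
  rewrite !after_cat ?size_ren ?(size_wdE kb) //.
  have [r1 [r2 [rE r1a _]]] := wd_catP r'a; subst r'.
  rewrite st_ren // IHg //; last 2 first.
  + exact: inj_sg.
  + by rewrite r1a.
  by congr (op _ _ _ _); apply/funext => k'; rewrite ren_cat.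
- by [].
- by move=> a b f g ft IHf gt IHg U t chi l r tU la okl /=; rewrite IHf // IHg.
- by move=> a b c f ft IHf U t chi l r tU la okl /=; rewrite IHf.
Qed.

(* Naturality: an operation on the left letters commutes with one on the
   letters to their right. *)
Lemma local_comm U l b T g a' b' chi l2 r : typed g a' b' ->
  local U l b T -> wd l2 = a' -> ok (st U l) (l2 ++ r) ->
  T (after (size b) (op g) U chi) (l2 ++ r) = op g (st U l) (T chi) (l2 ++ r).
Proof.
move=> gt Tloc l2a okl2.
elim: Tloc => [T1 T10|c k t T1 T1' okk kb tinj tst _ IH T1E].
  rewrite T10 // -(op0 gt l2a okl2); apply: (op_ext gt l2a okl2) => k r' _ okk _ _.
  by rewrite T10.
rewrite T1E // IH after_cat ?(size_wdE kb) // -tst (op_equiv gt) //.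
rewrite -(op_lin _ _ _ gt l2a okl2); apply/esym.
by apply: (op_ext gt l2a okl2) => k' r' _ okk' _ _; rewrite T1E.
Qed.

Lemma wd1 l x : wd l = [:: x] ->
  exists2 o, l = [:: o] & x = (if o is Some _ then Up else Dn).
Proof. by case: l => [|o []] //= [<-]; exists o. Qed.

Lemma wd3 l x y z : wd l = [:: x; y; z] ->
  exists o1 o2 o3, [/\ l = [:: o1; o2; o3], x = (if o1 is Some _ then Up else Dn),
    y = (if o2 is Some _ then Up else Dn) & z = (if o3 is Some _ then Up else Dn)].
Proof. by case: l => [|o1 [|o2 [|o3 []]]] //= [<- <- <-]; exists o1, o2, o3. Qed.

Lemma sum_pick U x (E : nat -> F) :
  \sum_(u <- U) (if u == x then E u else 0) = if x \in U then E x else 0.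
Proof.
rewrite -big_mkcond; case: ifP => xU.
  by rewrite (big_rem x) //= eqxx big_seq_cond big1 ?addr0 // => u /andP[]; rewrite mem_rem_uniq ?fset_uniq // !inE => /andP[/negbTE->].
by rewrite big_seq_cond big1 // => u /andP[uU /eqP ux]; rewrite -ux uU in xU.
Qed.

Lemma fsetU1D1C U x y : x != y -> ((x |` U) `\ y = x |` (U `\ y))%fset.
Proof.
move=> xy; apply/fsetP => z; rewrite !inE.
by case: (eqVneq z x) => [->|]; rewrite ?xy.
Qed.

Lemma fresh_neq' U x : x \in U -> fresh U != x.
Proof. by move=> xU; rewrite eq_sym fresh_neq. Qed.

(** In t't and tt' a point is added once before and once after a removal and so carries two names in
    turn; the two renamings cancel. *)
Lemma renameK V x y r : x \notin V -> y \notin V -> ok (x |` V)%fset r ->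
  ren (y |` V)%fset (fun z => if z == y then x else z)
    (ren (x |` V)%fset (fun z => if z == x then y else z) r) = r.
Proof.
move=> xV yV okr; set t := fun z => if z == x then y else z.
have xN z : z \in V -> (z == x) = false by move=> zV; apply: contraNF xV => /eqP<-.
have yN z : z \in V -> (z == y) = false by move=> zV; apply: contraNF yV => /eqP<-.
have im_t : (t @` (x |` V) = y |` V)%fset.
  rewrite imfsetU imfset_fset1 /t eqxx; congr (_ |` _)%fset.
  by rewrite -[RHS]imfset_id; apply: eq_im => z /xN->.
have tK : {in (x |` V)%fset, cancel t (fun z => if z == y then x else z)}.
  by move=> z /fset1UP[->|zV]; rewrite /t ?eqxx ?xN ?yN.
rewrite -im_t ren_comp //; first by apply: ren_id.
exact: can_in_inj tK.
Qed.

Lemma op_t U chi u r : u \in U ->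
  op mor_t U chi [:: Some u, None & r] = chi [:: None, Some u &
    ren (reopen U u) (fun x => if x == fresh (U `\ u) then fresh U else x) r].
Proof.
move=> uU; rewrite /= /after /= /glue.
have -> // : (((fresh U |` U) `\ u) `\ fresh U = U `\ u)%fset.
by rewrite fsetU1D1C ?fresh_neq' // fsetU1K // !inE (negbTE (fresh_notin U)) andbF.
Qed.

(** The cup in t' sums over all remaining points and the cap d' keeps the one just added. If that
    point is itself the one removed, nothing is left to keep; these routes are where tt' differs
    from the identity. *)
Lemma op_tp U chi u r :
  op mor_tp U chi [:: None, Some u & r] = if u == fresh U then 0 else
    chi [:: Some u, None & ren ((fresh U |` U) `\ u)%fset
      (fun x => if x == fresh U then fresh (U `\ u) else x) r].
Proof.
rewrite /= /after /= ?(take0, drop0) /= sum_pick !inE eqxx eq_sym.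
have [-> //|uf] := eqVneq; rewrite ?(take0, drop0) /cut.
have -> // : (((fresh U |` U) `\ u) `\ fresh U = U `\ u)%fset.
by rewrite fsetU1D1C 1?eq_sym // fsetU1K // !inE (negbTE (fresh_notin U)) andbF.
Qed.

Lemma heis_rel_sound a b f g : heis_rel a b f g -> forall U chi l r,
  wd l = a -> ok U (l ++ r) -> op f U chi (l ++ r) = op g U chi (l ++ r).
Proof.
case=> U chi l r.
- by move=> /wd2[[u|] [[v|] [-> //= _ _]]].
- by move=> /wd3[[u|] [[v|] [[w|] [-> //= _ _ _]]]].
- move=> /wd1[[u|] -> //= _] /andP[uU okr]; rewrite /after /=.
  rewrite ?(take0, drop0) /= ?(take0, drop0) glue_fresh fresh1K; congr (chi (_ :: _)).
  by apply: ren_id => // x; apply: glue_in.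
- move=> /wd1[[u|] -> //= _] okr; rewrite /after /= !fresh1K; congr (chi (_ :: _)).
  apply: ren_id => // x /fset1UP[->|xU]; first by rewrite /glue fresh1K eqxx.
  by rewrite glue_in // fresh1K.
- move=> /wd1[[u|] -> //= _] /andP[uU okr]; rewrite /after /=.
  (* The cap d' requires the next point removed to be the one just added, which selects the summand
     v = u of the cup. *)
  rewrite (eq_big_seq (fun v => if v == u then chi (Some v :: r) else 0)).
    by rewrite sum_pick uU.
  move=> v vU; have [->|vu] := eqVneq v u.
    by rewrite cut_self eqxx ren_id // => x; apply: cut_in.
  have uV : u \in U `\ v by rewrite !inE eq_sym vu.
  by rewrite cut_in // fresh_neq.
- move=> /wd1[[u|] -> //= _] okr; rewrite /after /= ?(take0, drop0) /=.
  rewrite sum_pick !inE eqxx /= ?(take0, drop0); congr (chi (_ :: _)).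
  apply: ren_id => // x; rewrite /cut fresh1K; by case: eqP.
- move=> /wd2[[u|] [[v|] [-> // _ _]]] /andP[uU okr].
  transitivity (op mor_t U (op mor_tp U chi) [:: Some u, None & r]); first by [].
  rewrite op_t // op_tp fresh_neq //; congr (chi [:: _, _ & _]).
  have UV : U `\ u `<=` U by apply: fsubD1set.
  rewrite fsetU1D1C ?fresh_neq' // renameK ?fresh_notin //.
  by apply: contra (fresh_notin U) => /(fsubsetP UV).
- move=> /wd2[[u|] [[v|] [-> // _ _]]] /andP[_ /andP[vU okr]].
  transitivity (op mor_tp U (op mor_t U chi) [:: None, Some v & r]); first by [].
  rewrite op_tp [RHS]/= mulN1r; case: eqVneq vU okr => [->|vf] vU okr.
    by rewrite subrr.
  rewrite subr0 op_t; last by move: vU; rewrite !inE (negbTE vf).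
  have UV : U `\ v `<=` U by apply: fsubD1set.
  have vU' : fresh U != v by rewrite eq_sym.
  rewrite /= fsetU1D1C // in okr *; congr (chi [:: _, _ & _]).
  rewrite renameK ?fresh_notin //.
  by apply: contra (fresh_notin U) => /(fsubsetP UV).
(* In the left curl the cap d' compares [u] with the point just added, and [u] is an old point. *)
- move=> /wd1[[u|] -> //= _] /andP[uU okr]; rewrite /after /=.
  by rewrite fresh_neq.
- move: l => [] //= _ okr.
  by rewrite eqxx.
Qed.

Lemma meq_sound a b f g : meq a b f g -> forall U chi l r,
  wd l = a -> ok U (l ++ r) -> op f U chi (l ++ r) = op g U chi (l ++ r).
Proof.
elim=> {a b f g}.
- exact: heis_rel_sound.
- by [].
- by move=> a b f g _ IH U chi l r la okl; rewrite IH.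
- by move=> a b f g h _ IH _ IH' U chi l r la okl; rewrite IH ?IH'.
- move=> a b c g g' f f' gg IHg ff IHf U chi l r la okl /=.
  have [ft _] := meq_typed ff.
  rewrite -IHf //; apply: (op_ext ft la okl) => k r' kb okk _ _.
  exact: IHg.
- move=> a b a1 b1 f g f1 g1 fg IHf fg1 IHf1 U chi l r la okl /=.
  have [ft gt] := meq_typed fg; rewrite (mcodE ft) (mcodE gt).
  have [l1 [l2 [lE l1a l2a]]] := wd_catP la; subst l; rewrite -catA in okl *.
  rewrite -IHf //; apply: (op_ext ft l1a okl) => k r' kb.
  rewrite ok_cat => /andP[okk okr']; rewrite wd_cat => r'a _.
  have [r1 [r2 [rE r1a _]]] := wd_catP r'a; subst r'.
  by rewrite !after_cat ?(size_wdE kb) // IHf1 // r1a.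
- by move=> a b f f' g g' _ IH _ IH' U chi l r la okl /=; rewrite IH // IH'.
- by move=> a b c f f' _ IH U chi l r la okl /=; rewrite IH.
- by [].
- by [].
- by [].
- move=> a b a1 b1 a2 b2 f f1 f2 ft f1t f2t U chi l r la okl /=.
  rewrite (mcodE ft) (mcodE f1t).
  have [l1 [l2 [lE l1a l2a]]] := wd_catP la; subst l; rewrite -catA in okl *.
  apply: (op_ext ft l1a okl) => k r' kb.
  rewrite ok_cat => /andP[okk okr']; rewrite wd_cat l2a -catA => r'a _.
  have [r1 [r2 [rE r1a r2a]]] := wd_catP r'a; subst r'.
  rewrite !after_cat ?(size_wdE kb) //.
  apply: (op_ext f1t r1a okr') => k1 r1' k1b okk1 _ _.
  rewrite after_cat ?(size_wdE k1b) // catA after_cat; last first.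
    by rewrite !size_cat (size_wdE kb) (size_wdE k1b).
  by rewrite st_cat; congr (op _ _ _ _); apply/funext => k2; rewrite catA.
- by move=> a b f ft U chi l r la okl /=; rewrite /after take0 drop0.
- move=> a b f ft U chi l r la okl /=.
  by apply: (op_ext ft la okl) => k r' kb okk _ _; rewrite /after cat_take_drop.
- by move=> a b U chi l r la okl /=; rewrite /after cat_take_drop.
- move=> a b c a1 b1 c1 g f g1 f1 gt ft g1t f1t U chi l r la okl /=.
  rewrite (mcodE ft) (mcodE gt).
  have [l1 [l2 [lE l1a l2a]]] := wd_catP la; subst l; rewrite -catA in okl *.
  apply: (op_ext ft l1a okl) => k r' kb.
  rewrite ok_cat => /andP[okk okr']; rewrite wd_cat l2a => r'a _.
  have [r1 [r2 [rE r1a r2a]]] := wd_catP r'a; subst r'.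
  rewrite after_cat ?(size_wdE kb) //.
  (* The interchange law: naturality slides f1 on the right past g on the left. *)
  rewrite -(local_comm (after (size c) (op g1) U chi) f1t (typed_local gt kb okk) r1a okr').
  apply: (local_ext (typed_local gt kb okk) okr') => k1 r1' k1b.
  rewrite ok_cat => /andP[okk1 okr1'] _ _.
  rewrite !after_cat ?(size_wdE k1b) //.
  by congr (op _ _ _ _); apply/funext => k2; rewrite after_cat ?(size_wdE k1b).
- by move=> a b f g h *; rewrite /= addrA.
- by move=> a b f g *; rewrite /= addrC.
- by move=> a b f *; rewrite /= add0r.
- by move=> a b f *; rewrite /= mul0r.
- by move=> a b f *; rewrite /= mul1r.
- by move=> a b k1 k2 f *; rewrite /= mulrA.
- by move=> a b k1 k2 f *; rewrite /= mulrDl.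
- by move=> a b k f g *; rewrite /= mulrDr.
- by move=> a b c g g' f gt g't ft U chi l r la okl; rewrite /= (opD _ _ ft).
- by [].
- by move=> a b c k g f gt ft U chi l r la okl; rewrite /= (opZ _ _ ft).
- by [].
- move=> a b a1 b1 f g h ft gt ht U chi l r la okl /=.
  by rewrite (mcodE ft) (mcodE gt).
- move=> a b a1 b1 f g h ft gt ht U chi l r la okl /=.
  rewrite (mcodE ft).
  have [l1 [l2 [lE l1a l2a]]] := wd_catP la; subst l; rewrite -catA in okl *.
  by rewrite -(opD _ _ ft).
- by [].
- move=> a b a1 b1 k f g ft gt U chi l r la okl /=.
  rewrite (mcodE ft).
  have [l1 [l2 [lE l1a l2a]]] := wd_catP la; subst l; rewrite -catA in okl *.
  by rewrite -(opZ _ _ ft).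
Qed.
End Soundness.

(** * Counting routes *)

Lemma seq_ibn (F : comNzRingType) (T1 T2 : eqType) (s : seq T1) (t : seq T2)
    (A : T1 -> T2 -> F) (B : T2 -> T1 -> F) : uniq s ->
  {in s &, forall x y, (\sum_(z <- t) A x z * B z y = (x == y)%:R)%R} ->
  size s <= size t.
Proof.
case: s => // x0 s; case: t => [|z0 t] us AB.
  have := AB x0 x0 (mem_head _ _) (mem_head _ _).
  by rewrite big_nil eqxx => /eqP; rewrite eq_sym oner_eq0.
pose MA := (\matrix_(i < size (x0 :: s), j < size (z0 :: t))
  A (nth x0 (x0 :: s) i) (nth z0 (z0 :: t) j))%R.
pose MB := (\matrix_(j < size (z0 :: t), i < size (x0 :: s))
  B (nth z0 (z0 :: t) j) (nth x0 (x0 :: s) i))%R.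
(* Over a nonzero commutative ring, an identity matrix cannot factor through a smaller one. *)
apply: (@mulmx1_min _ _ _ MA MB); apply/matrixP => i j; rewrite !mxE.
have := AB _ _ (mem_nth x0 (ltn_ord i)) (mem_nth x0 (ltn_ord j)).
rewrite (big_nth z0) big_mkord nth_uniq // => <-.
by apply: eq_bigr => k _; rewrite !mxE.
Qed.

Fixpoint routes (w : word) (U : state) (m : nat) : seq route :=
  match w with
  | [::] => if #|` U| == m then [:: [::]] else [::]
  | Up :: w => [seq Some u :: l | u <- U, l <- routes w (U `\ u)%fset m]
  | Dn :: w => [seq None :: l | l <- routes w (fresh U |` U)%fset m]
  end.

Fixpoint nroutes (n m : nat) (w : word) : nat :=
  match w with
  | [::] => n == m
  | Up :: w => n * nroutes n.-1 m w
  | Dn :: w => nroutes n.+1 m w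
  end.

Lemma routesP w U m l :
  reflect [/\ wd l = w, ok U l & #|` st U l| = m] (l \in routes w U m).
Proof.
elim: w U l => [|[] w IH] U l /=.
- case: eqP => [Um|Um]; rewrite ?inE; last by constructor=> -[]; case: l.
  by apply: (iffP eqP) => [->|[]]; case: l.
- apply: (iffP allpairsPdep) => [[u [l' [uU /IH[l'w okl' st'] ->]]]|[]].
    by split=> //=; [rewrite l'w | rewrite uU].
  case: l => // -[u|] l //= [lw] /andP[uU okl] stl; exists u, l; split=> //.
  exact/IH.
apply: (iffP mapP) => [[l' /IH[l'w okl' st'] ->]|[]].
  by split=> //=; rewrite l'w.
by case: l => // -[u|] l //= [lw] okl stl; exists l => //; apply/IH.
Qed.

Lemma uniq_routes w U m : uniq (routes w U m).
Proof.
elim: w U => [|[] w IH] U /=; first by case: ifP.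
  apply: allpairs_uniq_dep => //; first exact: fset_uniq.
  by move=> [u l] [u' l'] _ _ /= [-> ->].
by rewrite map_inj_uniq // => l l' [].
Qed.

Lemma size_routes w U m : size (routes w U m) = nroutes #|` U| m w.
Proof.
elim: w U => [|[] w IH] U /=; first by case: ifP.
  rewrite size_allpairs_dep sumnE big_map.
  rewrite (eq_big_seq (fun=> nroutes #|` U|.-1 m w)); last first.
    by move=> u uU; rewrite IH (cardfsD1 u U) uU.
  by rewrite big_const_seq count_predT iter_addn_0 mulnC.
by rewrite size_map IH cardfsU1 fresh_notin.
Qed.

Section IsoCount.
Context {F : comNzRingType}.
Local Open Scope ring_scope.
Local Notation op := (@op F).

Definition dirac (k k' : route) : F := (k' == k)%:R.

Lemma op_sum f a b U l (s : seq route) (c : route -> F) : typed f a b ->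
  wd l = a -> ok U l ->
  op f U (fun k' => \sum_(k <- s) c k * dirac k k') l =
  \sum_(k <- s) c k * op f U (dirac k) l.
Proof.
move=> ft la okl; rewrite -[l]cats0; rewrite -[l]cats0 in okl.
elim: s => [|k s IH].
  rewrite big_nil -[RHS](op0 ft la okl); congr (op _ _ _ _).
  by apply/funext => k; rewrite big_nil.
rewrite big_cons -IH -(op_lin _ _ _ ft la okl); congr (op _ _ _ _).
by apply/funext => k'; rewrite big_cons.
Qed.

(** Locality preserves the size of the final set, so fixing [U] and [m] turns the action of [f] into
    a finite matrix from routes along b to routes along a. *)
Lemma op_routes f a b U m l chi : typed f a b -> l \in routes a U m ->
  op f U chi l = \sum_(k <- routes b U m) chi k * op f U (dirac k) l.
Proof.
move=> ft /routesP[la okl stl]; rewrite -(op_sum _ _ ft la okl) -[l]cats0.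
rewrite -[l]cats0 in okl; apply: (op_ext ft la okl) => k r' kb okk.
move=> /(congr1 size); rewrite !size_wd => /size0nil r'0 stk.
subst r'; rewrite cats0 in okk *.
rewrite (big_rem k) /=; last first.
  by apply/routesP; rewrite stk stl.
rewrite /dirac eqxx mulr1 big_seq big1 ?addr0 // => k'.
by rewrite mem_rem_uniq ?uniq_routes // !inE eq_sym => /andP[/negbTE-> _]; rewrite mulr0.
Qed.

Definition base (X : obj) (U : state) (m : nat) : seq (nat * route) :=
  [seq (i, l) | i <- iota 0 (size X), l <- routes (comp_of X i) U m].

Lemma size_base X U m : size (base X U m) = (\sum_(w <- X) nroutes #|` U| m w)%N.
Proof.
rewrite /base size_allpairs_dep (eq_map (fun i => size_routes _ _ _)).
rewrite -[X in RHS](mkseq_nth [::]) /mkseq big_map sumnE big_map.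
by apply: eq_bigr => i _.
Qed.

Lemma uniq_base X U m : uniq (base X U m).
Proof.
apply: allpairs_uniq_dep => [|i _|]; [exact: iota_uniq | exact: uniq_routes |].
by move=> [i l] [i' l'] _ _ /= [-> ->].
Qed.

(** The equation gf = 1 factors the identity matrix on the routes of X through the routes of Y. *)
Lemma base_leq X Y (f : Defs.hom F X Y) (g : Defs.hom F Y X) U m :
  heq (hcomp g f) (hid X) -> (size (base X U m) <= size (base Y U m))%N.
Proof.
move=> gf.
pose A (p q : nat * route) := op (f p.1 q.1) U (dirac q.2) p.2.
pose B (q p : nat * route) := op (g q.1 p.1) U (dirac p.2) q.2.
apply: (@seq_ibn F _ _ _ _ A B); first exact: uniq_base.
move=> p p' /allpairsPdep[i [l [iX lw ->]]] /allpairsPdep[i' [l' [i'X l'w ->]]].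
rewrite !mem_iota /= in iX i'X.
rewrite big_allpairs_dep /= /A /B /=.
transitivity (op (hcomp g f i i') U (dirac l') l).
  rewrite /=; have: all (fun j => (j < size Y)%N) (iota 0 (size Y)).
    by apply/allP => j; rewrite mem_iota.
  elim: (iota _ _) => [|j r IH] /=; first by rewrite big_nil.
  case/andP => jY rY; rewrite big_cons IH //; congr (_ + _).
  rewrite (op_routes _ (entry_typed f iX jY) lw).
  by apply: eq_bigr => k _; rewrite mulrC.
have [la okl _] := routesP _ _ _ _ lw.
have := meq_sound (gf i i' iX i'X) (dirac l') (l := l) (r := [::]).
rewrite cats0 => -> //; rewrite /= xpair_eqE.
by case: eqP => [_|_] //=; rewrite /dirac.
Qed.

Lemma iso_nroutes X Y : iso_in (Heis F) X Y ->
  forall n m, (\sum_(w <- X) nroutes n m w = \sum_(w <- Y) nroutes n m w)%N.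
Proof.
move=> [f [_ [g [_ gf fg]]]] n m.
pose U := [fset x in iota 0 n]%fset.
have Un : #|` U| = n by rewrite card_fseq undup_id ?iota_uniq // size_iota.
rewrite -Un -!size_base; apply/eqP; rewrite eqn_leq.
by rewrite (base_leq _ _ gf) (base_leq _ _ fg).
Qed.

(** A set with as many points as [w] has letters admits a route along [w], and on the constant
    function 1 the two sides take the values k and k' there. *)
Lemma meq_scale_id_inj (w : word) (k k' : F) :
  meq w w (Scale k (Id w)) (Scale k' (Id w)) -> k = k'.
Proof.
move=> kk'; pose U := [fset x in iota 0 (size w)]%fset.
have Un : #|` U| = size w by rewrite card_fseq undup_id ?iota_uniq // size_iota.
have [l lw okl] : exists2 l, wd l = w & ok U l.
  have: (size w <= #|` U|)%N by rewrite Un.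
  elim: w U {kk' Un} => [|[] w IH] U; first by exists [::].
    move=> /= wU; have [u uU] : exists u, u \in U.
      by apply/fset0Pn; rewrite -cardfs_gt0; apply: leq_ltn_trans wU.
    have [|l lw okl] := IH (U `\ u)%fset.
      by rewrite -ltnS (leq_trans wU) // (cardfsD1 u U) uU.
    by exists (Some u :: l); rewrite /= ?lw ?uU.
  move=> /= wU; have [|l lw okl] := IH (fresh U |` U)%fset.
    by rewrite cardfsU1 fresh_notin (leq_trans (ltnW wU)) // leq_addl.
  by exists (None :: l); rewrite /= ?lw.
have := meq_sound kk' (U := U) (fun=> 1) (l := l) (r := [::]).
by rewrite cats0 /= !mulr1 => ->.
Qed.

End IsoCount.

Definition is_up (x : arrow) : bool := if x is Up then true else false.
Lemma is_upK : cancel is_up (fun b : bool => if b then Up else Dn).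
Proof. by case. Qed.
HB.instance Definition _ := Equality.copy arrow (can_type is_upK).

(** * Whiskering *)

Section Whisker.
Context {F : comNzRingType}.
Implicit Types (f g h : mor F) (a b c x y z p q : word).

Local Notation "g \c f" := (Comp g f) (at level 50, left associativity).
Local Notation "f \x g" := (Tens f g) (at level 40, left associativity).

Definition whisk x f y : mor F := Id x \x (f \x Id y).

Lemma whisk_typed x f y a b : typed f a b -> typed (whisk x f y) (x ++ (a ++ y)) (x ++ (b ++ y)).
Proof. by move=> ft; apply: typed_tens (typed_id _ _) (typed_tens ft (typed_id _ _)). Qed.

Lemma meqid a : meq a a (Id a : mor F) (Id a).
Proof. exact/meq_refl/typed_id. Qed.

Lemma tens_compr x a b c (u v : mor F) : typed u b c -> typed v a b ->
  meq (x ++ a) (x ++ c) (Id x \x (u \c v)) ((Id x \x u) \c (Id x \x v)).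
Proof.
move=> ut vt; have ix := typed_id F x.
apply: meq_trans (meq_sym (meq_interchange ix ix ut vt)).
apply: meq_tens; first exact/meq_sym/meq_idl.
exact/meq_refl/(typed_comp ut vt).
Qed.

Lemma tens_compl y a b c (u v : mor F) : typed u b c -> typed v a b ->
  meq (a ++ y) (c ++ y) ((u \c v) \x Id y) ((u \x Id y) \c (v \x Id y)).
Proof.
move=> ut vt; have iy := typed_id F y.
apply: meq_trans (meq_sym (meq_interchange ut vt iy iy)).
apply: meq_tens; last exact/meq_sym/meq_idl.
exact/meq_refl/(typed_comp ut vt).
Qed.

Lemma tens_split a b a1 b1 f g : typed f a b -> typed g a1 b1 ->
  meq (a ++ a1) (b ++ b1) (f \x g) ((f \x Id b1) \c (Id a \x g)).
Proof.
move=> ft gt; have i1 := typed_id F a; have i2 := typed_id F b1.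
apply: meq_trans (meq_sym (meq_interchange ft i1 i2 gt)).
by apply: meq_tens; apply: meq_sym; [apply: meq_idr | apply: meq_idl].
Qed.

Lemma tens_split' a b a1 b1 f g : typed f a b -> typed g a1 b1 ->
  meq (a ++ a1) (b ++ b1) (f \x g) ((Id b \x g) \c (f \x Id a1)).
Proof.
move=> ft gt; have i1 := typed_id F b; have i2 := typed_id F a1.
apply: meq_trans (meq_sym (meq_interchange i1 ft gt i2)).
by apply: meq_tens; apply: meq_sym; [apply: meq_idl | apply: meq_idr].
Qed.

Lemma tens_idA x z f a b : typed f a b ->
  meq (x ++ (z ++ a)) (x ++ (z ++ b)) (Id (x ++ z) \x f) (Id x \x (Id z \x f)).
Proof.
move=> ft; apply: meq_sym; apply: meq_trans.
  exact: meq_tensA (typed_id _ _) (typed_id _ _) ft.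
by rewrite !catA; apply: meq_tens; [exact: meq_tens_id | exact: meq_refl].
Qed.

Lemma whisk_meq x y f g a b : meq a b f g ->
  meq (x ++ (a ++ y)) (x ++ (b ++ y)) (whisk x f y) (whisk x g y).
Proof. by move=> fg; do 2?[apply: meq_tens; try exact: meqid]. Qed.

Lemma whisk_comp x y g f a b c : typed g b c -> typed f a b ->
  meq (x ++ (a ++ y)) (x ++ (c ++ y)) (whisk x (g \c f) y) (whisk x g y \c whisk x f y).
Proof.
move=> gt ft; apply: meq_trans (tens_compr _ _ _).
- apply: meq_tens; first exact: meqid.
  exact: tens_compl gt ft.
- exact: typed_tens gt (typed_id _ _).
- exact: typed_tens ft (typed_id _ _).
Qed.

Lemma whisk_id x y a : meq (x ++ (a ++ y)) (x ++ (a ++ y)) (whisk x (Id a) y) (Id (x ++ (a ++ y))).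
Proof.
apply: meq_trans (meq_tens_id _ _); apply: meq_tens; first exact: meqid.
exact: meq_tens_id.
Qed.

Lemma whisk_add x y f g a b : typed f a b -> typed g a b ->
  meq (x ++ (a ++ y)) (x ++ (b ++ y)) (whisk x (Add f g) y) (Add (whisk x f y) (whisk x g y)).
Proof.
move=> ft gt; have iy := typed_id F y.
apply: meq_trans (meq_tensDr (typed_id _ _) (typed_tens ft iy) (typed_tens gt iy)).
by apply: meq_tens; [exact: meqid | exact: meq_tensDl].
Qed.

Lemma whisk_scale x y k f a b : typed f a b ->
  meq (x ++ (a ++ y)) (x ++ (b ++ y)) (whisk x (Scale k f) y) (Scale k (whisk x f y)).
Proof.
move=> ft; have iy := typed_id F y.
apply: meq_trans (meq_tensZr _ (typed_id _ _) (typed_tens ft iy)).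
by apply: meq_tens; [exact: meqid | exact: meq_tensZl].
Qed.

Lemma whisk_zero x y a b :
  meq (x ++ (a ++ y)) (x ++ (b ++ y)) (whisk x (Zero a b) y) (Zero (x ++ (a ++ y)) (x ++ (b ++ y))).
Proof.
have zt := typed_zero F a b.
apply: meq_trans (meq_scale0 (whisk_typed x y zt)).
apply: meq_trans (whisk_scale x y 0%R zt); apply: whisk_meq.
exact/meq_sym/meq_scale0.
Qed.

Lemma whisk_cat x z f y a b : typed f a b ->
  meq (x ++ (z ++ (a ++ y))) (x ++ (z ++ (b ++ y))) (whisk (x ++ z) f y) (Id x \x whisk z f y).
Proof. by move=> ft; apply: tens_idA (typed_tens ft (typed_id _ _)). Qed.

Lemma whisk_tens x y f g a b a1 b1 : typed f a b -> typed g a1 b1 ->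
  meq (x ++ ((a ++ a1) ++ y)) (x ++ ((b ++ b1) ++ y)) (whisk x (f \x g) y)
    (whisk x f (b1 ++ y) \c whisk (x ++ a) g y).
Proof.
move=> ft gt; have gyt := typed_tens gt (typed_id F y).
have fyt := typed_tens ft (typed_id F (b1 ++ y)).
have agt := typed_tens (typed_id F a) gyt.
rewrite -!catA.
apply: (@meq_trans _ _ _ _ (Id x \x (f \x (g \x Id y)))).
  apply: meq_tens; first exact: meqid.
  rewrite !catA; apply: meq_sym; rewrite -!catA.
  exact: meq_tensA ft gt (typed_id _ _).
apply: (@meq_trans _ _ _ _ (Id x \x ((f \x Id (b1 ++ y)) \c (Id a \x (g \x Id y))))).
  by apply: meq_tens; [exact: meqid | apply: tens_split].
apply: meq_trans (tens_compr x fyt agt) _.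
apply: (@meq_comp _ _ (x ++ (a ++ (b1 ++ y)))).
  exact/meq_refl/(typed_tens (typed_id _ _) fyt).
exact/meq_sym/whisk_cat.
Qed.

(** Interchange at two disjoint places: both sides equal [Id x \x (g \x whisk z h y)]. *)
Lemma whisk_commute x y z p q p' q' g h : typed g p q -> typed h p' q' ->
  meq (x ++ (p ++ (z ++ (p' ++ y)))) (x ++ (q ++ (z ++ (q' ++ y))))
    (whisk (x ++ (q ++ z)) h y \c whisk x g (z ++ (p' ++ y)))
    (whisk x g (z ++ (q' ++ y)) \c whisk (x ++ (p ++ z)) h y).
Proof.
move=> gt ht.
have Ht := whisk_typed z y ht.
have cat3 w : meq (x ++ (w ++ (z ++ (p' ++ y)))) (x ++ (w ++ (z ++ (q' ++ y))))
    (whisk (x ++ (w ++ z)) h y) (Id x \x (Id w \x whisk z h y)).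
  apply: (@meq_trans _ _ _ _ (Id x \x whisk (w ++ z) h y)).
    by have := whisk_cat x (w ++ z) y ht; rewrite -!catA.
  by apply: meq_tens; [exact: meqid | apply: whisk_cat].
have gt1 := typed_tens gt (typed_id F (z ++ (p' ++ y))).
have gt2 := typed_tens gt (typed_id F (z ++ (q' ++ y))).
apply: (@meq_trans _ _ _ _ (Id x \x (g \x whisk z h y))).
  apply: (@meq_trans _ _ _ _ ((Id x \x (Id q \x whisk z h y)) \c whisk x g (z ++ (p' ++ y)))).
    apply: (@meq_comp _ _ (x ++ (q ++ (z ++ (p' ++ y))))); first exact: cat3.
    exact/meq_refl/whisk_typed.
  apply: meq_sym; apply: (@meq_trans _ _ _ _ (Id x \x ((Id q \x whisk z h y) \c (g \x Id (z ++ (p' ++ y)))))).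
    by apply: meq_tens; [exact: meqid | apply: tens_split'].
  exact: tens_compr (typed_tens (typed_id _ _) Ht) gt1.
apply: (@meq_trans _ _ _ _ (whisk x g (z ++ (q' ++ y)) \c (Id x \x (Id p \x whisk z h y)))).
  apply: (@meq_trans _ _ _ _ (Id x \x ((g \x Id (z ++ (q' ++ y))) \c (Id p \x whisk z h y)))).
    by apply: meq_tens; [exact: meqid | apply: tens_split].
  exact: tens_compr gt2 (typed_tens (typed_id _ _) Ht).
apply: (@meq_comp _ _ (x ++ (p ++ (z ++ (q' ++ y))))); first exact/meq_refl/whisk_typed.
exact/meq_sym/cat3.
Qed.

(** Whiskering on classes, through which the identities between t, t', c and d' are carried from a
    redex to the word around it. *)
Definition wcl x y a b (u : mcls a b) : mcls (x ++ (a ++ y)) (x ++ (b ++ y)) :=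
  cl _ _ (whisk x (mcls_rep u) y).

Lemma wclE x y a b f : typed f a b ->
  cl (x ++ (a ++ y)) (x ++ (b ++ y)) (whisk x f y) = wcl x y (cl a b f).
Proof. by move=> ft; apply/esym/cl_meq/whisk_meq/mcls_rep_cl. Qed.

Lemma wcl_comp x y a b c (v : mcls b c) (u : mcls a b) :
  wcl x y (ccomp v u) = ccomp (wcl x y v) (wcl x y u).
Proof.
have [f ft ->] := mclsP u; have [g gt ->] := mclsP v.
rewrite -(cl_comp gt ft) -!wclE //; last exact: typed_comp gt ft.
rewrite -(cl_comp (whisk_typed x y gt) (whisk_typed x y ft)).
exact: cl_meq (whisk_comp x y gt ft).
Qed.

Lemma wcl_add x y a b (u v : mcls a b) :
  wcl x y (u + v)%R = (wcl x y u + wcl x y v)%R.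
Proof.
have [f ft ->] := mclsP u; have [g gt ->] := mclsP v.
rewrite -clD // -!wclE //; last exact: typed_add.
rewrite -(clD (whisk_typed x y ft) (whisk_typed x y gt)).
exact: cl_meq (whisk_add x y ft gt).
Qed.

Lemma wcl_id x y a : wcl x y (cl a a (Id a)) = cl _ _ (Id (x ++ (a ++ y))).
Proof. by rewrite -wclE ?(cl_meq (whisk_id x y a)) //; apply: typed_id. Qed.

Lemma wcl0 x y a b : wcl x y (0 : mcls a b)%R = 0%R.
Proof. by rewrite -!cl0 -wclE ?(cl_meq (whisk_zero x y a b)) //; apply: typed_zero. Qed.

Lemma typed_c : typed (Gen gc : mor F) [::] [:: Dn; Up].
Proof. exact: (typed_gen F gc). Qed.

Lemma typed_dp : typed (Gen gdp : mor F) [:: Dn; Up] [::].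
Proof. exact: (typed_gen F gdp). Qed.

Local Notation clt := (cl [:: Up; Dn] [:: Dn; Up] (mor_t : mor F)).
Local Notation cltp := (cl [:: Dn; Up] [:: Up; Dn] (mor_tp : mor F)).
Local Notation clc := (cl [::] [:: Dn; Up] (Gen gc : mor F)).
Local Notation cldp := (cl [:: Dn; Up] [::] (Gen gdp : mor F)).

Lemma cl_tpt : ccomp cltp clt = cl _ _ (Id [:: Up; Dn]).
Proof.
rewrite -cl_comp; [|exact: typed_tpdn|exact: typed_tup].
exact/cl_meq/meq_rel/rel_tpt.
Qed.

Lemma cl_ttp : ccomp clt cltp = (cl _ _ (Id [:: Dn; Up]) - ccomp clc cldp)%R.
Proof.
rewrite -cl_comp; [|exact: typed_tup|exact: typed_tpdn].
rewrite (cl_meq (meq_rel rel_ttp)) clD; last 2 first.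
- exact: typed_id.
- exact: typed_scale (typed_comp typed_c typed_dp).
rewrite clZ ?scaleN1r ?(cl_comp typed_c typed_dp) //.
exact: typed_comp typed_c typed_dp.
Qed.

Lemma cl_dpc : ccomp cldp clc = cl _ _ (Id [::]).
Proof.
rewrite -cl_comp; [|exact: typed_dp|exact: typed_c].
exact/cl_meq/meq_rel/rel_bubble.
Qed.

(** From t = t t' t = (1 - c d') t one gets c d' t = 0, and composing with d' removes the c because
    d' c = 1. *)
Lemma cl_dpt : (ccomp cldp clt = 0)%R.
Proof.
have cdt : (ccomp clc (ccomp cldp clt) = 0)%R.
  have := ccompA clt cltp clt; rewrite cl_tpt ccomp1r cl_ttp.
  rewrite ccompDl -scaleN1r ccompZl ccomp1l scaleN1r => /esym/eqP.
  by rewrite -subr_eq0 addrAC subrr sub0r oppr_eq0 -ccompA => /eqP.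
by rewrite -[LHS]ccomp1l -cl_dpc -ccompA cdt ccomp0r.
Qed.

(** Dually, t' = t' t t' = t' (1 - c d') gives t' c d' = 0, and composing with c on the right
    removes the d'. *)
Lemma cl_tpc : (ccomp cltp clc = 0)%R.
Proof.
have cdt : (ccomp (ccomp cltp clc) cldp = 0)%R.
  have := ccompA cltp clt cltp; rewrite cl_tpt ccomp1l cl_ttp.
  rewrite ccompDr -scaleN1r ccompZr ccomp1r scaleN1r => /eqP.
  by rewrite -subr_eq0 addrAC subrr sub0r oppr_eq0 ccompA => /eqP.
by rewrite -[LHS]ccomp1r -cl_dpc ccompA cdt ccomp0l.
Qed.

End Whisker.

(** * Generated morphisms to normal words *)

Fixpoint normal (w : word) : bool :=
  match w with
  | [::] => true
  | Up :: w => normal w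
  | Dn :: w => all (pred1 Dn) w
  end.

Definition nword (i j : nat) : word := nseq i Up ++ nseq j Dn.

Lemma normal_nword i j : normal (nword i j).
Proof.
by elim: i => //=; case: j => //= j; rewrite all_nseq orbT.
Qed.

Lemma normal_nwordP w : reflect (exists i j, w = nword i j) (normal w).
Proof.
apply: (iffP idP) => [|[i [j ->]]]; last exact: normal_nword.
elim: w => [_|[] w IH] /=; first by exists 0, 0.
  by move=> /IH[i [j ->]]; exists i.+1, j.
by move=> /all_pred1P ->; exists 0, (size w).+1.
Qed.

Lemma nonnormal x y : normal (x ++ [:: Dn, Up & y]) = false.
Proof.
by elim: x => [|[] x IH] //=; rewrite all_cat /= andbF.
Qed.

(** A proper overlap of two redexes would make one letter both Up and Dn. *)
Lemma two_redexes x y x' y' :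
  x ++ [:: Dn, Up & y] = x' ++ [:: Dn, Up & y'] ->
  [\/ x = x' /\ y = y',
      exists z, x' = x ++ [:: Dn, Up & z] /\ y = z ++ [:: Dn, Up & y']
    | exists z, x = x' ++ [:: Dn, Up & z] /\ y' = z ++ [:: Dn, Up & y]].
Proof.
elim: x x' => [|o x IH] [|o' x'] //=.
- by case=> ->; constructor 1.
- case=> <-; case: x' => [//|o'' x'] /= [<- ->]; constructor 2; by exists x'.
- case=> ->; case: x {IH} => [//|o'' x] /= [-> <-]; constructor 3; by exists x.
case=> -> /IH[[-> ->]|[z [-> ->]]|[z [-> ->]]].
- by constructor 1.
- by constructor 2; exists z.
- by constructor 3; exists z.
Qed.

Section Generated.
Context {F : comNzRingType}.
Implicit Types (f g h : mor F) (a b c x y z p q : word).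

Local Notation "g \c f" := (Comp g f) (at level 50, left associativity).
Local Notation "f \x g" := (Tens f g) (at level 40, left associativity).

(** The rule [stm_meq] makes membership a property of the morphism rather than of the term that
    represents it. *)
Inductive stm : word -> word -> mor F -> Prop :=
  | stm_t : stm [:: Up; Dn] [:: Dn; Up] mor_t
  | stm_tp : stm [:: Dn; Up] [:: Up; Dn] mor_tp
  | stm_c : stm [::] [:: Dn; Up] (Gen gc)
  | stm_dp : stm [:: Dn; Up] [::] (Gen gdp)
  | stm_id a : stm a a (Id a)
  | stm_comp a b c g f : stm b c g -> stm a b f -> stm a c (g \c f)
  | stm_tens a b a1 b1 f g :
      stm a b f -> stm a1 b1 g -> stm (a ++ a1) (b ++ b1) (f \x g)
  | stm_zero a b : stm a b (Zero a b)
  | stm_add a b f g : stm a b f -> stm a b g -> stm a b (Add f g)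
  | stm_scale a b k f : stm a b f -> stm a b (Scale k f)
  | stm_meq a b f g : meq a b f g -> stm a b f -> stm a b g.

Lemma stm_typed a b f : stm a b f -> typed f a b.
Proof.
elim=> {a b f}.
- exact: (@typed_tup F).
- exact: (@typed_tpdn F).
- exact: (@typed_c F).
- exact: (@typed_dp F).
- exact: typed_id.
- by move=> a b c g f _ gt _ ft; apply: typed_comp gt ft.
- by move=> *; apply: typed_tens.
- exact: typed_zero.
- by move=> *; apply: typed_add.
- by move=> *; apply: typed_scale.
- by move=> a b f g /meq_typed[].
Qed.

Section Reduced.
Variable v : word.
Hypothesis v_normal : normal v.

Inductive down : word -> mor F -> Prop :=
  | down_tp : down [:: Up; Dn] mor_tp
  | down_dp : down [::] (Gen gdp).

Lemma down_typed q h : down q h -> typed h [:: Dn; Up] q.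
Proof. by case; [exact: typed_tpdn | exact: typed_dp]. Qed.

(* The span of the composites of steps rewriting a redex Dn (x) Up. *)
Inductive red : word -> mor F -> Prop :=
  | red_id : red v (Id v)
  | red_step x y q h f : down q h -> red (x ++ (q ++ y)) f ->
      red (x ++ [:: Dn, Up & y]) (f \c whisk x h y)
  | red_zero a : red a (Zero a v)
  | red_add a f g : red a f -> red a g -> red a (Add f g)
  | red_scale a k f : red a f -> red a (Scale k f)
  | red_meq a f g : meq a v f g -> red a f -> red a g.

Lemma red_typed a f : red a f -> typed f a v.
Proof.
elim=> {a f}.
- exact: typed_id.
- move=> x y q h f /down_typed ht _ ft.
  exact: typed_comp ft (whisk_typed x y ht).
- by move=> a; apply: typed_zero.
- by move=> a f g _ ft _ gt; apply: typed_add.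
- by move=> a k f _ ft; apply: typed_scale.
- by move=> a f g /meq_typed[].
Qed.

Lemma comp_zerol a b g : typed g a b -> meq a v (Zero b v \c g) (Zero a v).
Proof.
move=> gt; have zt := typed_zero F b v; apply/clP.
- exact: typed_comp zt gt.
- exact: typed_zero.
by rewrite (cl_comp zt gt) !cl0 ccomp0l.
Qed.

Lemma comp_zeror a b f : typed f b v -> meq a v (f \c Zero a b) (Zero a v).
Proof.
move=> ft; have zt := typed_zero F a b; apply/clP.
- exact: typed_comp ft zt.
- exact: typed_zero.
by rewrite (cl_comp ft zt) !cl0 ccomp0r.
Qed.

Lemma red_lin a b g : typed g a b ->
  (forall f f', red a (f \c g) -> red a (f' \c g) -> typed f b v ->
     typed f' b v -> red a (Add f f' \c g)) /\
  (forall k f, red a (f \c g) -> typed f b v -> red a (Scale k f \c g)).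
Proof.
move=> gt; split=> [f f' rf rf' ft f't|k f rf ft].
  by apply: red_meq (red_add rf rf'); apply/meq_sym/(meq_compDl ft f't gt).
by apply: red_meq (red_scale k rf); apply/meq_sym/(meq_compZl k ft gt).
Qed.

(* As redexes do not overlap, g slides past a step at another redex, while a
   step at the redex created by g is absorbed by the hypothesis. *)
Lemma red_insert p g : typed g p [:: Dn; Up] ->
  (forall q h x y f, down q h -> red (x ++ (q ++ y)) f ->
     red (x ++ (p ++ y)) (f \c whisk x (h \c g) y)) ->
  forall a f, red a f -> forall x y, a = x ++ [:: Dn, Up & y] ->
    red (x ++ (p ++ y)) (f \c whisk x g y).
Proof.
move=> gt g_down a f; elim=> {a f}.
(* The target is normal, hence contains no redex, and g cannot end in the identity of [v]. *)
- by move=> x y vE; have := nonnormal x y; rewrite -vE v_normal.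
- move=> x' y' q h f hq rf IH x y E; have ft := red_typed rf.
  have ht := down_typed hq.
  case: (two_redexes (esym E)) => [[xx yy]|[z [xx yy]]|[z [xx yy]]].
  + subst x' y'; apply: red_meq (g_down q h x y f hq rf).
    have wt := whisk_typed x y ht; have wgt := whisk_typed x y gt.
    apply: (meq_trans _ (meq_compA ft wt wgt)).
    apply: meq_comp (whisk_comp x y ht gt); exact: meq_refl.
  + subst x' y; have wgt := whisk_typed x (z ++ ([:: Dn; Up] ++ y')) gt.
    have wgt' := whisk_typed x (z ++ (q ++ y')) gt.
    have wtt := whisk_typed (x ++ [:: Dn, Up & z]) y' ht.
    have wtt' := whisk_typed (x ++ (p ++ z)) y' ht.
    have rfg : red (x ++ (p ++ (z ++ (q ++ y')))) (f \c whisk x g (z ++ (q ++ y'))).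
      by apply: IH; rewrite -catA.
    have := red_step (x := x ++ (p ++ z)) (y := y') (f := f \c whisk x g (z ++ (q ++ y'))) hq.
    rewrite -!catA => /(_ rfg); apply: red_meq.
    rewrite -!catA /= in wtt wtt' ft.
    apply: meq_trans (meq_sym (meq_compA ft wgt' wtt')) _.
    apply: meq_trans (meq_compA ft wtt wgt).
    apply: meq_comp; first exact/meq_refl/ft.
    exact/meq_sym/(whisk_commute x y' z gt ht).
  subst x y'; have wgt := whisk_typed (x' ++ ([:: Dn; Up] ++ z)) y gt.
  have wgt' := whisk_typed (x' ++ (q ++ z)) y gt.
  have wtt := whisk_typed x' (z ++ [:: Dn, Up & y]) ht.
  have wtt' := whisk_typed x' (z ++ (p ++ y)) ht.
  have rfg : red (x' ++ (q ++ (z ++ (p ++ y)))) (f \c whisk (x' ++ (q ++ z)) g y).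
    by have := IH (x' ++ (q ++ z)) y; rewrite -!catA; apply.
  have := red_step hq rfg; rewrite -!catA; apply: red_meq.
  rewrite -!catA /= in wgt wgt' ft.
  apply: meq_trans (meq_sym (meq_compA ft wgt' wtt')) _.
  apply: meq_trans (meq_compA ft wtt wgt).
  apply: meq_comp; first exact/meq_refl/ft.
  exact: (whisk_commute x' y z ht gt).
- move=> a x y aE; subst a; apply: red_meq (red_zero _).
  exact: meq_sym (comp_zerol (whisk_typed x y gt)).
- move=> a f f' rf IHf rf' IHf' x y aE; subst a.
  have [radd _] := red_lin (whisk_typed x y gt).
  by apply: radd; [apply: IHf | apply: IHf' | apply: red_typed | apply: red_typed].
- move=> a k f rf IHf x y aE; subst a.
  have [_ rscale] := red_lin (whisk_typed x y gt).
  by apply: rscale; [apply: IHf | apply: red_typed].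
move=> a f f' ff' rf IHf x y aE; subst a; apply: red_meq (IHf x y erefl).
exact: meq_comp ff' (meq_refl (whisk_typed x y gt)).
Qed.

Lemma red_whisk_id x y p g f : meq p p g (Id p) ->
  red (x ++ (p ++ y)) f -> red (x ++ (p ++ y)) (f \c whisk x g y).
Proof.
move=> gE rf; have ft := red_typed rf; apply: red_meq rf; apply: meq_sym.
apply: meq_trans (meq_idr ft); apply: meq_comp; first exact/meq_refl/ft.
exact: meq_trans (whisk_meq x y gE) (whisk_id x y p).
Qed.

Lemma red_whisk_zero x y p q g f : meq p q g (Zero p q) ->
  red (x ++ (q ++ y)) f -> red (x ++ (p ++ y)) (f \c whisk x g y).
Proof.
move=> gE rf; have ft := red_typed rf; apply: red_meq (red_zero _); apply: meq_sym.
apply: meq_trans (comp_zeror _ ft); apply: meq_comp; first exact/meq_refl/ft.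
exact: meq_trans (whisk_meq x y gE) (whisk_zero x y p q).
Qed.

(** Precomposition with t' or d' adds one step. Precomposition with t or c creates a redex, and when
    a later step meets that redex the outcome is one of t't = 1, d't = 0, t'c = 0 and d'c = 1. This
    handles the generators; the other cases follow formally. *)
Lemma red_stm a b g : stm a b g -> forall x y f,
  red (x ++ (b ++ y)) f -> red (x ++ (a ++ y)) (f \c whisk x g y).
Proof.
elim=> {a b g}.
- move=> x y f rf; apply: (red_insert (@typed_tup F) _ rf) => // q h x' y' f' [] rf'.
    apply: (red_whisk_id (p := [:: Up; Dn])) => //.
    exact/meq_rel/rel_tpt.
  apply: (red_whisk_zero (p := [:: Up; Dn]) (q := [::])) => //.
  apply/clP; [exact: typed_comp (@typed_dp F) (@typed_tup F) | exact: typed_zero |].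
  by rewrite (cl_comp (@typed_dp F) (@typed_tup F)) cl_dpt cl0.
- by move=> x y f; apply: red_step down_tp.
- move=> x y f rf; apply: (red_insert (@typed_c F) _ rf) => // q h x' y' f' [] rf'.
    apply: (red_whisk_zero (p := [::]) (q := [:: Up; Dn])) => //.
    apply/clP; [exact: typed_comp (@typed_tpdn F) (@typed_c F) | exact: typed_zero |].
    by rewrite (cl_comp (@typed_tpdn F) (@typed_c F)) cl_tpc cl0.
  apply: (red_whisk_id (p := [::])) => //.
  exact/meq_rel/rel_bubble.
- by move=> x y f; apply: red_step down_dp.
- by move=> a x y f; apply/red_whisk_id/meqid.
- move=> a b c g g' sg IHg sg' IHg' x y f rf.
  have [gt g't] := (stm_typed sg, stm_typed sg').
  have ft := red_typed rf.
  apply: red_meq (IHg' _ _ _ (IHg _ _ _ rf)).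
  apply: meq_trans (meq_sym (meq_compA ft (whisk_typed x y gt) (whisk_typed x y g't))) _.
  apply: meq_comp (meq_sym (whisk_comp x y gt g't)); exact/meq_refl/ft.
- move=> a b a1 b1 g g1 sg IHg sg1 IHg1 x y f rf.
  have [gt g1t] := (stm_typed sg, stm_typed sg1).
  have ft := red_typed rf.
  have rf1 : red (x ++ (a ++ (b1 ++ y))) (f \c whisk x g (b1 ++ y)).
    by apply: IHg; rewrite catA in rf *; rewrite -!catA in rf *.
  have := IHg1 (x ++ a) y _; rewrite -!catA => /(_ _ rf1); apply: red_meq.
  rewrite -!catA in ft.
  have w1t := whisk_typed x (b1 ++ y) gt; have w2t := whisk_typed (x ++ a) y g1t.
  rewrite -!catA in w2t.
  apply: meq_trans (meq_sym (meq_compA ft w1t w2t)) _.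
  apply: meq_comp; first exact/meq_refl/ft.
  by have := whisk_tens x y gt g1t; rewrite -!catA; apply: meq_sym.
- by move=> a b x y f rf; apply: (red_whisk_zero _ rf); apply/meq_refl/typed_zero.
- move=> a b g g' sg IHg sg' IHg' x y f rf.
  have [gt g't] := (stm_typed sg, stm_typed sg').
  have ft := red_typed rf; have [wt w't] := (whisk_typed x y gt, whisk_typed x y g't).
  apply: red_meq (red_add (IHg _ _ _ rf) (IHg' _ _ _ rf)).
  apply: meq_trans (meq_sym (meq_compDr ft wt w't)) _.
  apply: meq_comp; [exact/meq_refl/ft | exact/meq_sym/whisk_add].
- move=> a b k g sg IHg x y f rf.
  have gt := stm_typed sg; have ft := red_typed rf; have wt := whisk_typed x y gt.
  apply: red_meq (red_scale k (IHg _ _ _ rf)).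
  apply: meq_trans (meq_sym (meq_compZr k ft wt)) _.
  apply: meq_comp; [exact/meq_refl/ft | exact/meq_sym/whisk_scale].
move=> a b g g' gg' sg IHg x y f rf; apply: red_meq (IHg _ _ _ rf).
apply: (@meq_comp _ _ (x ++ (b ++ y))); last exact: whisk_meq.
exact/meq_refl/red_typed.
Qed.

Lemma stm_red a f : stm a v f -> red a f.
Proof.
move=> sf; have ft := stm_typed sf.
have := red_stm sf (x := [::]) (y := [::]) (f := Id v).
rewrite /= !cats0 => /(_ red_id); apply: red_meq.
have WE : meq a v (whisk [::] f [::]) f.
  have := typed_tens ft (typed_id F [::]); rewrite !cats0 => fit.
  exact: meq_trans (meq_tens1l fit) (meq_tens1r ft).
apply: meq_trans (meq_idl ft); apply: meq_comp WE; exact: meqid.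
Qed.

(** A step needs a redex in its source, so from a normal word only multiples of the identity and 0
    survive. *)
Lemma red_scalar a f : red a f -> normal a ->
  exists k, meq a v f (if a == v then Scale k (Id a) else Zero a v).
Proof.
elim=> {a f}.
- move=> _; exists 1%R; rewrite eqxx; apply/meq_sym/meq_scale1/typed_id.
- by move=> x y q h f _ _ _; rewrite nonnormal.
- move=> a _; exists 0%R; case: eqP => [->|_]; last exact/meq_refl/typed_zero.
  exact/meq_sym/meq_scale0/typed_id.
- move=> a f g rf IHf rg IHg na; have [k kE] := IHf na; have [l lE] := IHg na.
  exists (k + l)%R; apply: meq_trans (meq_add kE lE) _.
  case: eqP => [av|_]; last exact/meq_add0/typed_zero.
  by rewrite av; apply/meq_sym/meq_scaleDl/typed_id.
- move=> a k f rf IHf na; have [l lE] := IHf na.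
  exists (k * l)%R; apply: meq_trans (meq_scale k lE) _.
  case: eqP => [av|_]; first by rewrite av; apply/meq_scaleA/typed_id.
  apply/clP; [exact/typed_scale/typed_zero | exact: typed_zero |].
  by rewrite clZ ?cl0 ?scaler0 //; apply: typed_zero.
move=> a f g fg rf IHf na; have [k kE] := IHf na; exists k.
exact: meq_trans (meq_sym fg) kE.
Qed.

End Reduced.

Lemma stm_scalar a v f : normal a -> normal v -> stm a v f ->
  exists k, meq a v f (if a == v then Scale k (Id a) else Zero a v).
Proof. by move=> na nv /(stm_red nv)/red_scalar; apply. Qed.

End Generated.

Local Open Scope heis_scope.

(** * The generated subcategory *)

Section Subcategory.
Context {F : comNzRingType}.
Implicit Types X Y Z : obj.
Local Notation hom := (Defs.hom F).

Definition gen_hom X Y (f : hom X Y) : Prop :=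
  forall i j, i < size X -> j < size Y -> stm (comp_of X i) (comp_of Y j) (f i j).

Fact gen_hom_heq X Y (f g : hom X Y) : f =~ g -> gen_hom f -> gen_hom g.
Proof. by move=> fg fs i j iX jY; apply: stm_meq (fg i j iX jY) (fs i j iX jY). Qed.

Fact gen_hom_delta X Y P PXY : gen_hom (@hdelta F X Y P PXY).
Proof.
move=> i j iX jY /=; case: ifP => [Pij|_]; last exact: stm_zero.
by rewrite -(PXY i j) //; apply: stm_id.
Qed.

Fact gen_hom_id X : True -> gen_hom (hid X : hom X X).
Proof. by move=> _; apply: gen_hom_delta. Qed.

Fact gen_hom_comp X Y Z (g : hom Y Z) (f : hom X Y) :
  gen_hom g -> gen_hom f -> gen_hom (g \oh f).
Proof.
move=> gs fs i k iX kZ /=.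
have: all (fun j => j < size Y) (iota 0 (size Y)).
  by apply/allP => j; rewrite mem_iota.
elim: (iota _ _) => [|j r IH] /=; first by move=> _; apply: stm_zero.
case/andP=> jY rY; apply: stm_add; last exact: IH.
exact: stm_comp (gs j k jY kZ) (fs i j iX jY).
Qed.

Definition Heis_s : subcat F :=
  @Subcat F (fun _ => True) gen_hom gen_hom_heq (fun _ _ _ _ => conj I I)
    gen_hom_id gen_hom_comp.

Lemma replete_Heis_s : replete Heis_s.
Proof. by []. Qed.

Lemma monoidal_Heis_s : monoidal_sub Heis_s.
Proof.
split=> // X Y X' Y' f g fs gs p q pX qY.
rewrite !nth_otens //=; have /andP[? ?] := otens_divn pX.
by have /andP[? ?] := otens_divn qY; apply: stm_tens; [apply: fs | apply: gs].
Qed.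

Lemma linear_Heis_s : linear_sub Heis_s.
Proof.
split=> [X Y _ _ i j _ _|X Y f g fs gs i j iX jY|X Y k f fs i j iX jY].
- exact: stm_zero.
- by apply: stm_add; [apply: fs | apply: gs].
- by apply: stm_scale; apply: fs.
Qed.

Lemma additive_Heis_s : additive_sub Heis_s.
Proof.
by split; [exact: linear_Heis_s | split=> // X Y _ _; do !split; exact: gen_hom_delta].
Qed.

(** * Matrices of scalars *)

(** Between distinct words the scalar is discarded, so the formulas for composites have to test
    whether the source and the middle word agree. *)
Definition delta_cl (a b : word) (k : F) : mcls a b :=
  cl a b (if a == b then Scale k (Id a) else Zero a b).

Lemma delta_cl0 a b : (delta_cl a b 0 = 0)%R.
Proof.
rewrite /delta_cl; case: eqP => [->|_]; last by rewrite cl0.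
by rewrite !clZ ?scale0r //; apply: typed_id.
Qed.

Lemma delta_cl_comp a b c k l :
  ccomp (delta_cl b c l) (delta_cl a b k) = delta_cl a c (if a == b then k * l else 0)%R.
Proof.
have [<-|ab] := eqVneq a b; last first.
  by rewrite delta_cl0 /delta_cl (negbTE ab) cl0 ccomp0r.
rewrite /delta_cl eqxx; have it := typed_id F a; have [<-|ac] := eqVneq a c; last by rewrite !cl0 ccomp0l.
by rewrite !clZ // ccompZl ccompZr ccomp1l scalerA mulrC.
Qed.

Lemma delta_clD a b k l : (delta_cl a b (k + l) = delta_cl a b k + delta_cl a b l)%R.
Proof.
rewrite /delta_cl; case: eqP => [->|_]; last by rewrite !cl0 addr0.
by rewrite !clZ ?scalerDl //; apply: typed_id.
Qed.

Lemma delta_clZ a b k l : (delta_cl a b (k * l) = k *: delta_cl a b l)%R.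
Proof.
rewrite /delta_cl; case: eqP => [->|_]; last by rewrite cl0 scaler0.
by rewrite !clZ ?scalerA //; apply: typed_id.
Qed.

Lemma delta_cl_sum a b (I : Type) (r : seq I) (E : I -> F) :
  (delta_cl a b (\sum_(i <- r) E i) = \sum_(i <- r) delta_cl a b (E i))%R.
Proof. exact: (big_morph (delta_cl a b) (delta_clD a b) (delta_cl0 a b)). Qed.

Lemma delta_cl_inj a : injective (delta_cl a a).
Proof.
move=> k l; rewrite /delta_cl eqxx => /clP kl.
by apply: (@meq_scale_id_inj _ a); apply: kl; apply/typed_scale/typed_id.
Qed.

Fact smx_typed X Y (A : nat -> nat -> F) i j : i < size X -> j < size Y ->
  typed (if comp_of X i == comp_of Y j then Scale (A i j) (Id (comp_of X i))
         else Zero (comp_of X i) (comp_of Y j)) (comp_of X i) (comp_of Y j).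
Proof.
move=> _ _; case: eqP => [->|_]; last exact: typed_zero.
exact/typed_scale/typed_id.
Qed.
Definition smx X Y A : hom X Y := MkHom (@smx_typed X Y A).

Lemma hcl_smx X Y A i j : hcl (smx X Y A) i j = delta_cl _ _ (A i j).
Proof. by []. Qed.

Lemma smx_gen X Y A : gen_hom (smx X Y A).
Proof.
move=> i j _ _ /=; case: eqP => [->|_]; last exact: stm_zero.
exact/stm_scale/stm_id.
Qed.

Lemma smx_heq X Y A B :
  (forall i j, i < size X -> j < size Y -> comp_of X i = comp_of Y j -> A i j = B i j) ->
  smx X Y A =~ smx X Y B.
Proof.
move=> AB; apply/heqP => i j iX jY; rewrite !hcl_smx /delta_cl.
by case: eqP => // /(AB i j iX jY) ->.
Qed.

Lemma smx_inj X Y A B : smx X Y A =~ smx X Y B ->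
  forall i j, i < size X -> j < size Y -> comp_of X i = comp_of Y j -> A i j = B i j.
Proof.
move=> /heqP AB i j iX jY; have := AB i j iX jY; rewrite !hcl_smx.
by move=> + E; rewrite E => /delta_cl_inj.
Qed.

Lemma smx_comp X Y Z A B : smx Y Z B \oh smx X Y A =~
  smx X Z (fun i k => \sum_(0 <= j < size Y)
    if comp_of X i == comp_of Y j then A i j * B j k else 0)%R.
Proof.
apply/heqP => i k iX kZ; rewrite hcl_comp // hcl_smx delta_cl_sum.
by apply: eq_bigr => j _; rewrite !hcl_smx delta_cl_comp.
Qed.

Lemma smx_add X Y A B : hadd (smx X Y A) (smx X Y B) =~
  smx X Y (fun i j => A i j + B i j)%R.
Proof. by apply/heqP => i j iX jY; rewrite hcl_add // !hcl_smx delta_clD. Qed.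

Lemma smx_scale X Y k A : hscale k (smx X Y A) =~ smx X Y (fun i j => k * A i j)%R.
Proof. by apply/heqP => i j iX jY; rewrite hcl_scale // !hcl_smx delta_clZ. Qed.

Lemma smx_zero X Y : hzero X Y =~ smx X Y (fun _ _ => 0)%R.
Proof. by apply/heqP => i j iX jY; rewrite hcl_smx delta_cl0. Qed.

Lemma smx_delta X Y P PXY :
  @hdelta F X Y P PXY =~ smx X Y (fun i j => (P i j)%:R)%R.
Proof.
apply/heqP => i j iX jY; rewrite hcl_smx /delta_cl /hcl /=.
have := PXY i j iX jY; case: (P i j) => [/(_ isT) ->|_].
  by rewrite eqxx clZ ?scale1r //; apply: typed_id.
case: eqP => [->|_] //; rewrite cl0 clZ ?scale0r //; exact: typed_id.
Qed.

(** Each entry is a scalar or 0 by [stm_scalar], and choice collects the scalars into one matrix. *)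
Lemma gen_hom_smx X Y (f : hom X Y) : all normal X -> all normal Y ->
  gen_hom f -> exists A, f =~ smx X Y A.
Proof.
move=> /allP nX /allP nY fs.
have /choice[A AP] (p : nat * nat) : exists k, p.1 < size X -> p.2 < size Y ->
    hcl f p.1 p.2 = delta_cl _ _ k.
  have [iX|?] := boolP (p.1 < size X); last by exists 0%R.
  have [jY|?] := boolP (p.2 < size Y); last by exists 0%R.
  have [k kE] := stm_scalar (nX _ (mem_nth _ iX)) (nY _ (mem_nth _ jY)) (fs _ _ iX jY).
  by exists k => _ _; apply: cl_meq.
exists (fun i j => A (i, j)); apply/heqP => i j iX jY.
by rewrite hcl_smx; apply: (AP (i, j)).
Qed.

End Subcategory.
Arguments Heis_s : clear implicits.

#[export] Instance heq_equiv (F : comNzRingType) X Y : Equivalence (@heq F X Y).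
Proof.
split; [exact: heq_refl | exact: heq_sym | exact: heq_trans].
Qed.

#[export] Hint Resolve heq_refl : core.

#[export] Instance hcomp_proper (F : comNzRingType) X Y Z :
  Proper (@heq F Y Z ==> @heq F X Y ==> @heq F X Z) (@hcomp F X Y Z).
Proof. by move=> g g' gg f f' ff; apply: hcomp_heq. Qed.

#[export] Instance hadd_proper (F : comNzRingType) X Y :
  Proper (@heq F X Y ==> @heq F X Y ==> @heq F X Y) (@hadd F X Y).
Proof. by move=> g g' gg f f' ff; apply: hadd_heq. Qed.

#[export] Instance hscale_proper (F : comNzRingType) X Y k :
  Proper (@heq F X Y ==> @heq F X Y) (@hscale F X Y k).
Proof. by move=> g g' gg; apply: hscale_heq. Qed.

(** * Biproducts and the Heisenberg isomorphism *)

Section Biproducts.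
Context {F : comNzRingType}.
Implicit Types X Y Z : obj.
Local Notation hom := (Defs.hom F).

Lemma sum_nat_pick (n i : nat) (Q : pred nat) (B : nat -> F) :
  (\sum_(0 <= j < n) (if Q j then (i == j)%:R * B j else 0) =
   if (i < n)%N && Q i then B i else 0)%R.
Proof.
have [ni|ni] := ltnP i n; last first.
  rewrite big_nat big1 // => j /andP[_ jn]; rewrite (negbTE (_ : i != j)).
    by rewrite mul0r if_same.
  by rewrite neq_ltn (leq_trans jn ni) orbT.
rewrite (bigD1_seq i) ?iota_uniq ?mem_index_iota //= eqxx mul1r big1 ?addr0 // => j ji.
by rewrite eq_sym (negbTE ji) mul0r if_same.
Qed.

Lemma hprl_inl X Y : hprl X Y \oh hinl X Y =~ (hid X : hom X X).
Proof.
rewrite /hprl /hinl /hid !smx_delta smx_comp; apply: smx_heq => i k iX kX ik.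
rewrite sum_nat_pick size_cat nth_cat iX eqxx.
by rewrite (leq_trans iX) ?leq_addr.
Qed.

Lemma hprr_inr X Y : hprr X Y \oh hinr X Y =~ (hid Y : hom Y Y).
Proof.
rewrite /hprr /hinr /hid !smx_delta smx_comp; apply: smx_heq => i k iX kX ik.
rewrite sum_nat_pick size_cat nth_cat ltn_add2l iX ltnNge leq_addr /= addKn eqxx.
by rewrite eqn_add2l.
Qed.

Lemma hprl_inr X Y : hprl X Y \oh hinr X Y =~ (hzero Y X : hom Y X).
Proof.
rewrite /hprl /hinr smx_zero !smx_delta smx_comp; apply: smx_heq => i k iX kX ik.
rewrite sum_nat_pick; case: ifP => // _; case: eqP => // ik'.
by move: kX; rewrite -ik' ltnNge leq_addr.
Qed.

Lemma hprr_inl X Y : hprr X Y \oh hinl X Y =~ (hzero X Y : hom X Y).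
Proof.
rewrite /hprr /hinl smx_zero !smx_delta smx_comp; apply: smx_heq => i k iX kX ik.
rewrite sum_nat_pick; case: ifP => // _; case: eqP => // ik'.
by move: iX; rewrite ik' ltnNge leq_addr.
Qed.

Lemma hsum_id X Y :
  hadd (hinl X Y \oh hprl X Y) (hinr X Y \oh hprr X Y) =~ (hid (X ++ Y) : hom _ _).
Proof.
rewrite /hprr /hinl /hprl /hinr /hid !smx_delta !smx_comp smx_add.
apply: smx_heq => i k; rewrite size_cat => iX kX ik.
rewrite sum_nat_pick nth_cat.
have [iX'|Xi] := ltnP i (size X).
  rewrite eqxx [X in (_ + X)%R]big1_seq ?addr0 // => j _.
  case: eqP => // _; case: eqP => // ij; last by rewrite mul0r.
  by move: iX'; rewrite ij ltnNge leq_addr.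
rewrite /= add0r (eq_big_nat _ _ (F2 := fun j => if comp_of Y (i - size X) == comp_of Y j
    then ((i - size X)%N == j)%:R * ((size X + j)%N == k)%:R else 0)%R); last first.
  by move=> j _; rewrite -{2}(subnKC Xi) eqn_add2l.
by rewrite sum_nat_pick eqxx subnKC // ltn_subLR // iX.
Qed.

Lemma hadd0l X Y (f : hom X Y) : hadd (hzero X Y) f =~ f.
Proof. by apply/heqP => i j iX jY; rewrite hcl_add // hcl0 add0r. Qed.

Lemma hadd0r X Y (f : hom X Y) : hadd f (hzero X Y) =~ f.
Proof. by apply/heqP => i j iX jY; rewrite hcl_add // hcl0 addr0. Qed.

Lemma haddC X Y (f g : hom X Y) : hadd f g =~ hadd g f.
Proof. by apply/heqP => i j iX jY; rewrite !hcl_add // addrC. Qed.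

(** Stands for both the generated subcategory and the whole category, which have to be compared
    through the same constructions. *)
Variable T : subcat F.
Hypothesis T_ob : forall X, sob T X.
Hypothesis T_gen : forall X Y (f : hom X Y), gen_hom f -> shom T f.
Hypothesis T_add : forall X Y (f g : hom X Y), shom T f -> shom T g -> shom T (hadd f g).

Lemma iso_refl X : iso_in T X X.
Proof.
exists (hid X); split; first exact: shom_id.
by exists (hid X); split; [exact: shom_id | exact: hcomp1l..].
Qed.

Lemma iso_sym X Y : iso_in T X Y -> iso_in T Y X.
Proof. by move=> [f [fT [g [gT gf fg]]]]; exists g; split=> //; exists f. Qed.

Lemma iso_trans X Y Z : iso_in T X Y -> iso_in T Y Z -> iso_in T X Z.
Proof.
move=> [f [fT [g [gT gf fg]]]] [f' [f'T [g' [g'T gf' fg']]]].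
exists (f' \oh f); split; first exact: shom_comp.
exists (g \oh g'); split; first exact: shom_comp.
  by rewrite hcompA -(hcompA g g' f') gf' hcomp1r.
by rewrite hcompA -(hcompA f' f g) fg hcomp1r.
Qed.

Lemma iso_sum X Y X' Y' : iso_in T X X' -> iso_in T Y Y' ->
  iso_in T (X ++ Y) (X' ++ Y').
Proof.
move=> [f [fT [f' [f'T ff' f'f]]]] [g [gT [g' [g'T gg' g'g]]]].
have del P Q R PQR : shom T (@hdelta F P Q R PQR) by apply/T_gen/gen_hom_delta.
pose dsum X Y X' Y' (f : hom X X') (g : hom Y Y') : hom (X ++ Y) (X' ++ Y') :=
  hadd (hinl X' Y' \oh f \oh hprl X Y) (hinr X' Y' \oh g \oh hprr X Y).
have dsumT P Q P' Q' (u : hom P P') (w : hom Q Q') :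
    shom T u -> shom T w -> shom T (dsum _ _ _ _ u w).
  by move=> uT wT; apply: T_add; do !apply: shom_comp => //; apply: del.
have dsumK P Q P' Q' (u : hom P P') (w : hom Q Q') (u' : hom P' P) (w' : hom Q' Q) :
    u' \oh u =~ hid P -> w' \oh w =~ hid Q ->
    dsum _ _ _ _ u' w' \oh dsum _ _ _ _ u w =~ hid (P ++ Q).
  move=> uK wK; rewrite /dsum hcompDl !hcompDr.
  rewrite !hcompA.
  rewrite -(hcompA _ (hprl P' Q') (hinl P' Q')) -(hcompA _ (hprl P' Q') (hinr P' Q')).
  rewrite -(hcompA _ (hprr P' Q') (hinl P' Q')) -(hcompA _ (hprr P' Q') (hinr P' Q')).
  rewrite hprl_inl hprl_inr hprr_inl hprr_inr !hcomp1r !hcomp0r !hcomp0l.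
  rewrite -(hcompA _ u' u) -(hcompA _ w' w) uK wK !hcomp1r.
  by rewrite hadd0l hadd0r hsum_id.
exists (dsum _ _ _ _ f g); split; first exact: dsumT.
exists (dsum _ _ _ _ f' g'); split; [exact: dsumT|exact: dsumK..].
Qed.

Lemma iso_swap X Y : iso_in T (X ++ Y) (Y ++ X).
Proof.
have del P Q R PQR : shom T (@hdelta F P Q R PQR) by apply/T_gen/gen_hom_delta.
pose sw P Q : hom (P ++ Q) (Q ++ P) :=
  hadd (hinr Q P \oh hprl P Q) (hinl Q P \oh hprr P Q).
have swT P Q : shom T (sw P Q).
  by apply: T_add; apply: shom_comp; apply: del.
have swK P Q : sw Q P \oh sw P Q =~ hid (P ++ Q).
  rewrite /sw hcompDl !hcompDr !hcompA.
  rewrite -(hcompA _ (hprl Q P) (hinl Q P)) -(hcompA _ (hprl Q P) (hinr Q P)).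
  rewrite -(hcompA _ (hprr Q P) (hinl Q P)) -(hcompA _ (hprr Q P) (hinr Q P)).
  rewrite hprl_inl hprl_inr hprr_inl hprr_inr !hcomp1r !hcomp0r !hcomp0l.
  by rewrite hadd0l hadd0r haddC hsum_id.
exists (sw X Y); split; first exact: swT.
by exists (sw Y X); split.
Qed.

Lemma iso_perm X Y : perm_eq X Y -> iso_in T X Y.
Proof.
elim: X Y => [|x X IH] Y XY.
  by move: XY; rewrite perm_sym => /perm_nilP ->; apply: iso_refl.
have /splitPr E : x \in Y by rewrite -(perm_mem XY) mem_head.
case: E XY => Y1 Y2; rewrite perm_sym perm_catC /= perm_cons perm_catC perm_sym => XY.
apply: iso_trans (iso_sum (iso_refl [:: x]) (IH _ XY)) _.
rewrite catA -[x :: Y2]cat1s [in X in iso_in T _ X]catA.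
by apply: iso_sum (iso_refl _); apply: iso_swap.
Qed.

(** The equations t t' + c d' = 1, t' t = 1, d' c = 1, d' t = 0 and t' c = 0 say that the row and
    the column below are inverse to each other, and whiskering by x and y preserves them. *)
Lemma iso_redex x y :
  iso_in T [:: x ++ [:: Dn, Up & y]] [:: x ++ [:: Up, Dn & y]; x ++ y].
Proof.
set w := x ++ [:: Dn, Up & y]; set w1 := x ++ [:: Up, Dn & y]; set w2 := x ++ y.
pose ef (i j : nat) : mor F := if j is 0 then whisk x mor_tp y else whisk x (Gen gdp) y.
have eft i j : i < size [:: w] -> j < size [:: w1; w2] ->
    typed (ef i j) (comp_of [:: w] i) (comp_of [:: w1; w2] j).
  by case: i j => [|i] [|[|j]] //= _ _; [exact: whisk_typed typed_tpdn | exact: whisk_typed typed_dp].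
pose eg (i j : nat) : mor F := if i is 0 then whisk x mor_t y else whisk x (Gen gc) y.
have egt i j : i < size [:: w1; w2] -> j < size [:: w] ->
    typed (eg i j) (comp_of [:: w1; w2] i) (comp_of [:: w] j).
  by case: j i => [|i] [|[|j]] //= _ _; [exact: whisk_typed typed_tup | exact: whisk_typed typed_c].
pose f : hom [:: w] [:: w1; w2] := MkHom eft.
pose g : hom [:: w1; w2] [:: w] := MkHom egt.
have t1 := @typed_tup F; have t2 := @typed_tpdn F.
have t3 := @typed_c F; have t4 := @typed_dp F.
have stmW a b h : stm a b h -> stm (x ++ (a ++ y)) (x ++ (b ++ y)) (whisk x h y : mor F).
  by move=> sh; apply: stm_tens (stm_id _) (stm_tens sh (stm_id _)).
pose ct := cl [:: Up; Dn] [:: Dn; Up] (mor_t : mor F).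
pose ctp := cl [:: Dn; Up] [:: Up; Dn] (mor_tp : mor F).
pose cc := cl [::] [:: Dn; Up] (Gen gc : mor F).
pose cdp := cl [:: Dn; Up] [::] (Gen gdp : mor F).
have E1 := wclE x y t1; have E2 := wclE x y t2.
have E3 := wclE x y t3; have E4 := wclE x y t4.
exists f; split.
  apply: T_gen => -[|i] [|[|j]] //= _ _; first exact: (stmW _ _ _ (@stm_tp F)).
  exact: (stmW _ _ _ (@stm_dp F)).
exists g; split.
- apply: T_gen => -[|[|i]] [|j] //= _ _; first exact: (stmW _ _ _ (@stm_t F)).
  exact: (stmW _ _ _ (@stm_c F)).
- apply/heqP => -[|i] [|j] // _ _; rewrite hcl_comp // big_nat_recl // big_nat1.
  rewrite /hcl /= E1 E2 E3 E4 -(wcl_comp x y ct ctp) -(wcl_comp x y cc cdp).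
  by rewrite -(wcl_add x y (ccomp ct ctp)) cl_ttp subrK wcl_id.
apply/heqP => -[|[|i]] [|[|j]] // _ _; rewrite hcl_comp // big_nat1 /hcl /=.
- by rewrite E1 E2 -(wcl_comp x y ctp ct) cl_tpt wcl_id.
- by rewrite E1 E4 -(wcl_comp x y cdp ct) cl_dpt wcl0.
- by rewrite E2 E3 -(wcl_comp x y ctp cc) cl_tpc wcl0.
by rewrite E3 E4 -(wcl_comp x y cdp cc) cl_dpc wcl_id.
Qed.
End Biproducts.

(** * Normal forms of objects *)

(** The termination measure of rewriting: turning Dn Up into Up Dn removes one inversion, deleting
    the pair removes at least one. *)
Fixpoint inversions (w : word) : nat :=
  match w with
  | [::] => 0
  | Up :: w => inversions w
  | Dn :: w => count_mem Up w + inversions w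
  end.

Lemma inversions_cat x y : inversions (x ++ y) =
  inversions x + inversions y + count_mem Dn x * count_mem Up y.
Proof.
elim: x => [|[] x IH] /=; rewrite ?addn0 // IH ?count_cat.
by rewrite mulnDl mul1n -!addnA; congr addn; rewrite addnCA; congr addn; rewrite addnCA.
Qed.

Lemma redex_exists w : ~~ normal w -> exists x y, w = x ++ [:: Dn, Up & y].
Proof.
elim: w => [|[] w IH] //=.
  by move=> /IH[x [y ->]]; exists (Up :: x), y.
case: w IH => [|[] w] //= IH; first by exists [::], w.
by move=> /IH[x [y ->]]; exists (Dn :: x), y.
Qed.

Section NormalForm.
Context {F : comNzRingType}.
Implicit Types X Y N M : obj.

Definition wval (B : pzRingType) (x d : B) (w : word) : B :=
  (\prod_(o <- w) if o is Up then x else d)%R.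

Definition oval (B : pzRingType) (x d : B) (X : obj) : B :=
  (\sum_(w <- X) wval x d w)%R.

Lemma wval_cat (B : pzRingType) (x d : B) w w' :
  wval x d (w ++ w') = (wval x d w * wval x d w')%R.
Proof. exact: big_cat. Qed.

Lemma oval_cat (B : pzRingType) (x d : B) X Y :
  oval x d (X ++ Y) = (oval x d X + oval x d Y)%R.
Proof. exact: big_cat. Qed.

Lemma oval_tens (B : pzRingType) (x d : B) X Y :
  oval x d (otens X Y) = (oval x d X * oval x d Y)%R.
Proof.
rewrite /oval /otens big_allpairs_dep mulr_suml; apply: eq_bigr => w _.
by rewrite mulr_sumr; apply: eq_bigr => w' _; rewrite wval_cat.
Qed.

Variable T : subcat F.
Hypothesis T_ob : forall X, sob T X.
Hypothesis T_gen : forall X Y (f : Defs.hom F X Y), gen_hom f -> shom T f.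
Hypothesis T_add : forall X Y (f g : Defs.hom F X Y),
  shom T f -> shom T g -> shom T (hadd f g).

(** The last clause is carried along for the map from K0 to the Weyl algebra, which evaluates
    objects that need not be normal. *)
Definition normal_form X N : Prop := [/\ all normal N, iso_in T X N
  & forall (B : pzRingType) (x d : B), (d * x = x * d + 1)%R ->
      oval x d X = oval x d N].

Lemma exists_normal_form X : exists N, normal_form X N.
Proof.
have cat_nf X1 X2 N1 N2 : normal_form X1 N1 -> normal_form X2 N2 ->
    normal_form (X1 ++ X2) (N1 ++ N2).
  move=> [n1 i1 v1] [n2 i2 v2]; split; first by rewrite all_cat n1.
    exact: iso_sum.
  by move=> B x d xd; rewrite !oval_cat v1 ?v2.
elim: X => [|w X [N2 N2X]].
  by exists [::]; split=> //; apply: iso_refl.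
suff [N1 N1w] : exists N1, normal_form [:: w] N1.
  by exists (N1 ++ N2); rewrite -cat1s; apply: cat_nf.
have [n] := ubnP (inversions w); elim: n w => // n IH w.
have [nw _|/redex_exists[x [y ->]]] := boolP (normal w).
  exists [:: w]; split; [by rewrite /= nw | exact: iso_refl | by []].
rewrite ltnS !inversions_cat /= => wn.
have [|N1 N1w] := IH (x ++ [:: Up, Dn & y]); first by rewrite inversions_cat /=; lia.
have [|N2' N2w] := IH (x ++ y); first by rewrite inversions_cat /=; lia.
have [nn ni nv] := cat_nf _ _ _ _ N1w N2w.
exists (N1 ++ N2'); split=> //; first exact: iso_trans (iso_redex T_gen x y) ni.
move=> B a d ad; rewrite -nv // /oval /= !big_cons !big_nil /wval !big_cat !big_cons /=.
(* The relation assumed in [B] is the shadow of the redex isomorphism: both replace one summand by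
   the same two. *)
by rewrite !addr0 (mulrA d a) ad mulrDl mul1r mulrDr !mulrA.
Qed.

(** The removals come before all additions and offer n, n - 1, ..., n - i + 1 choices in turn; the
    additions offer none, and the final size must be m. *)
Lemma nroutes_nword n m i j :
  nroutes n m (nword i j) = if (i <= n) && (n + j == m + i) then n ^_ i else 0.
Proof.
elim: i n => [|i IH] n /=.
  rewrite addn0 ffactn0; elim: j n => [|j IH] n /=; first by rewrite addn0; case: eqP.
  by rewrite IH addSnnS.
case: n => [|n]; first by rewrite mul0n.
rewrite IH ltnS addnS addSn eqSS ffactnS; case: ifP => // _.
by rewrite muln0.
Qed.

(* At (n, m) = (i, j) the word Up^i Dn^j has i! routes, and the other normal
   words with routes are Up^k Dn^l with k < i. *)
Lemma perm_eq_nroutes N M : all normal N -> all normal M ->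
  (forall n m, \sum_(w <- N) nroutes n m w = \sum_(w <- M) nroutes n m w) ->
  perm_eq N M.
Proof.
move=> nN nM NM.
have cnt i j : count_mem (nword i j) N = count_mem (nword i j) M.
  elim/ltn_ind: i j => i IH j; have := NM i j.
  set P := fun w => (w != nword i j) && (nroutes i j w != 0).
  have split_sum K : \sum_(w <- K) nroutes i j w =
      count_mem (nword i j) K * i`! + \sum_(w <- [seq w <- K | P w]) nroutes i j w.
    rewrite big_filter (bigID (pred1 (nword i j))) /=; congr (_ + _).
      rewrite (eq_bigr (fun=> i`!)) => [|w /eqP ->]; last first.
        by rewrite nroutes_nword leqnn addnC eqxx ffactnn.
      by rewrite big_const_seq iter_addn_0 mulnC.
    rewrite [RHS](bigID (fun w => nroutes i j w != 0)) /= [X in (_ + X)%N]big1 ?addn0.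
      rewrite /P (bigID (fun w => nroutes i j w != 0)) /= [X in (_ + X)%N]big1 ?addn0.
        by apply: eq_bigl => w; rewrite -andbA andbb.
      by move=> w /andP[_ /negPn/eqP].
    by move=> w /andP[_ /negPn/eqP].
  rewrite (split_sum N) (split_sum M).
  (* Every word satisfying [P] is some Up^k Dn^l with k < i, so the induction hypothesis gives it
     the same multiplicity on both sides and these contributions cancel. *)
  have PNM : perm_eq [seq w <- N | P w] [seq w <- M | P w].
    apply/allP => w; rewrite mem_cat !mem_filter -andb_orr => /andP[Pw wNM].
    have /normal_nwordP[k [l wE]] : normal w.
      by case/orP: wNM => [/(allP nN)|/(allP nM)].
    rewrite /= !count_filter.
    have cE K : count (predI (pred1 w) P) K = count_mem w K.
      by apply: eq_count => w' /=; case: eqP => // ->; rewrite Pw.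
    rewrite !cE wE IH //; move: Pw; rewrite wE /P nroutes_nword.
    case: ifP => [/andP[ki /eqP ij]|]; last by rewrite eqxx andbF.
    rewrite ltn_neqAle ki andbT => /andP[+ _]; apply: contraNneq => ki'.
    by move: ij; rewrite ki' addnC => /addIn ->.
  by rewrite (perm_big _ PNM) => /addIn/eqP; rewrite eqn_pmul2r ?fact_gt0 // => /eqP.
apply/allP => w; rewrite mem_cat => wNM /=.
have /normal_nwordP[k [l ->]] : normal w.
  by case/orP: wNM => [/(allP nN)|/(allP nM)].
by rewrite cnt.
Qed.

Lemma iso_Heis X Y : iso_in T X Y -> iso_in (Heis F) X Y.
Proof. by move=> [f [_ [g [_ gf fg]]]]; exists f; split=> //; exists g. Qed.

Lemma iso_normal_perm N M : all normal N -> all normal M ->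
  iso_in (Heis F) N M -> perm_eq N M.
Proof. by move=> nN nM /iso_nroutes/perm_eq_nroutes; apply. Qed.

(** The isomorphism of the whole category serves only to equate numbers of routes; the one in [T] is
    rebuilt from the two normal forms and a permutation of their summands. *)
Lemma iso_Heis_iff X Y : iso_in (Heis F) X Y <-> iso_in T X Y.
Proof.
split; last exact: iso_Heis.
have [N [nN iN _]] := exists_normal_form X; have [M [nM iM _]] := exists_normal_form Y.
move=> XY; have NM : perm_eq N M.
  apply: iso_normal_perm => //.
  apply: (iso_trans (iso_sym (iso_Heis iN))).
  exact: iso_trans XY (iso_Heis iM).
apply: iso_trans iN _; apply: iso_trans (iso_sym iM).
exact: iso_perm.
Qed.

(** Isomorphic objects have normal forms that differ by a permutation, which a sum does not see.
    This is the well-definedness of the map from K0 to the Weyl algebra. *)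
Lemma iso_oval X Y (B : pzRingType) (x d : B) : (d * x = x * d + 1)%R ->
  iso_in T X Y -> oval x d X = oval x d Y.
Proof.
move=> xd XY.
have [N [nN iN ->]] := exists_normal_form X => //.
have [M [nM iM ->]] := exists_normal_form Y => //.
apply/perm_big/iso_normal_perm => //.
by apply/iso_Heis/(iso_trans (iso_sym iN))/(iso_trans XY iM).
Qed.
End NormalForm.

(** * Grothendieck rings *)

Section PresentedRingLift.
Local Open Scope ring_scope.
Variables (G : Type) (R : rterm G -> rterm G -> Prop) (B : pzRingType) (h : G -> B).

Fixpoint reval (t : rterm G) : B :=
  match t with
  | Rgen a => h a
  | Rzero => 0
  | Rone => 1
  | Radd s t => reval s + reval t
  | Ropp s => - reval s
  | Rmul s t => reval s * reval t
  end.

Hypothesis hR : forall s t, R s t -> reval s = reval t.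

Lemma reval_cong s t : rcong R s t -> reval s = reval t.
Proof.
elim=> {s t} /=.
- exact: hR.
- by [].
- by [].
- by move=> s t u _ -> _ ->.
- by move=> s s' t t' _ -> _ ->.
- by move=> s s' _ ->.
- by move=> s s' t t' _ -> _ ->.
- by move=> s t u; rewrite addrA.
- by move=> s t; rewrite addrC.
- by move=> t; rewrite add0r.
- by move=> t; rewrite addNr.
- by move=> s t u; rewrite mulrA.
- by move=> t; rewrite mul1r.
- by move=> t; rewrite mulr1.
- by move=> s t u; rewrite mulrDl.
- by move=> s t u; rewrite mulrDr.
Qed.

(** The compatibility proof is an argument of the map so that the morphism structures declared below
    can be attached to it. *)
Definition pres_lift (_ : forall s t, R s t -> reval s = reval t)
  (x : pres_ring R) : B := reval (repr x).
Local Notation lift := (pres_lift hR).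

Lemma pres_liftE t : lift (pres_cls R t) = reval t.
Proof. exact/reval_cong/pres_repr. Qed.

Lemma pres_addE' s t : pres_cls R s + pres_cls R t = pres_cls R (Radd s t).
Proof. exact: pres_addE. Qed.

Lemma pres_oppE' s : - pres_cls R s = pres_cls R (Ropp s).
Proof. exact: pres_oppE. Qed.

Lemma pres_mulE' s t : pres_cls R s * pres_cls R t = pres_cls R (Rmul s t).
Proof. exact: pres_mulE. Qed.

Fact pres_lift_zmod : zmod_morphism lift.
Proof.
move=> x y; rewrite -(pres_clsK x) -(pres_clsK y) pres_oppE' pres_addE'.
by rewrite !pres_liftE.
Qed.

Fact pres_lift_monoid : monoid_morphism lift.
Proof.
split=> [|x y]; first exact: (pres_liftE Rone).
by rewrite -(pres_clsK x) -(pres_clsK y) pres_mulE' !pres_liftE.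
Qed.

HB.instance Definition _ := GRing.isZmodMorphism.Build (pres_ring R) B lift pres_lift_zmod.
HB.instance Definition _ := GRing.isMonoidMorphism.Build (pres_ring R) B lift pres_lift_monoid.

Definition pres_rmorphism : {rmorphism pres_ring R -> B} := lift.

Lemma pres_rmorphismE a : pres_rmorphism (pres_cls R (Rgen a)) = h a.
Proof. exact: (pres_liftE (Rgen a)). Qed.

Lemma pres_rmorphism_ext (f g : {rmorphism pres_ring R -> B}) :
  (forall a, f (pres_cls R (Rgen a)) = g (pres_cls R (Rgen a))) -> f =1 g.
Proof.
move=> fg x; rewrite -(pres_clsK x); elim: (repr x) => [a|||s IHs t IHt|s IHs|s IHs t IHt].
- exact: fg.
- by rewrite !rmorph0.
- by rewrite !rmorph1.
- by rewrite -pres_addE' !rmorphD IHs IHt.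
- by rewrite -pres_oppE' !rmorphN IHs.
- by rewrite -pres_mulE' !rmorphM IHs IHt.
Qed.

End PresentedRingLift.

Section Grothendieck.
Local Open Scope ring_scope.
Context {F : comNzRingType}.
Variable T : subcat F.
Hypothesis T_ob : forall X, sob T X.
Hypothesis T_gen : forall X Y (f : Defs.hom F X Y), gen_hom f -> shom T f.
Hypothesis T_add : forall X Y (f g : Defs.hom F X Y),
  shom T f -> shom T g -> shom T (hadd f g).

Definition weyl (g : weyl_gen) : A1 := pres_cls weyl_rel (Rgen g).

Lemma weylE : weyl Wd * weyl Wx = weyl Wx * weyl Wd + 1.
Proof.
have /eqP := (pres_cls_eq weyl_rel _ _).2 (rcong_rel Weyl_rel).
rewrite -!pres_addE' -!pres_oppE' -!pres_mulE' -/(weyl _) -/(weyl _).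
by rewrite -addrA -opprD subr_eq0 => /eqP.
Qed.

Definition K0_ob (X : obj) : K0 T := K0_cls (exist _ X (T_ob X)).

Lemma K0_clsE (X : sobj T) : K0_cls X = K0_ob (sval X).
Proof.
by case: X => X TX; rewrite /K0_ob; congr K0_cls; congr exist; apply: Prop_irrelevance.
Qed.

Lemma K0_ob_iso X Y : iso_in T X Y -> K0_ob X = K0_ob Y.
Proof. by move=> XY; apply/pres_cls_eq/rcong_rel; apply: K0_iso. Qed.

Lemma K0_ob_cat X Y : K0_ob (X ++ Y) = K0_ob X + K0_ob Y.
Proof. by rewrite [RHS]pres_addE'; apply/pres_cls_eq/rcong_rel; apply: K0_sum. Qed.

Lemma K0_ob_unit : K0_ob ounit = 1.
Proof. by apply/pres_cls_eq/rcong_rel; apply: K0_unit. Qed.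

Lemma K0_ob_tens X Y : K0_ob (otens X Y) = K0_ob X * K0_ob Y.
Proof. by rewrite [RHS]pres_mulE'; apply/pres_cls_eq/rcong_rel; apply: K0_tens. Qed.

(** Sums and tensor products of objects become sums and products of classes, so K0 is generated by
    the classes of Up and Dn. *)
Lemma K0_ob_oval X : K0_ob X = oval (K0_ob oup) (K0_ob odn) X.
Proof.
elim: X => [|w X IH].
  (* The class of the zero object is idempotent for addition, as [[::] ++ [::]] is [[::]], hence it
     is 0. *)
  rewrite /oval big_nil; apply: (addrI (K0_ob [::])).
  by rewrite addr0 -K0_ob_cat.
rewrite -cat1s K0_ob_cat oval_cat IH; congr (_ + _); rewrite /oval big_seq1 /wval.
elim: w => [|o w IHw]; first by rewrite big_nil K0_ob_unit.
by rewrite big_cons -IHw; case: o; rewrite -K0_ob_tens.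
Qed.

Lemma K0_ob_weyl : K0_ob odn * K0_ob oup = K0_ob oup * K0_ob odn + 1.
Proof.
rewrite -!K0_ob_tens -K0_ob_unit -K0_ob_cat; apply: K0_ob_iso.
exact: (iso_redex T_gen [::] [::]).
Qed.

Fact K0_to_weyl_rel s t : @K0_rel F T s t ->
  reval (fun X : sobj T => oval (weyl Wx) (weyl Wd) (sval X)) s =
  reval (fun X : sobj T => oval (weyl Wx) (weyl Wd) (sval X)) t.
Proof.
case=> [X Y XY|X Y Z ZE|X XE|X Y Z ZE] /=; rewrite ?ZE ?XE.
- exact: (iso_oval T_ob T_gen T_add weylE XY).
- exact: oval_cat.
- by rewrite /oval big_seq1 /wval big_nil.
exact: oval_tens.
Qed.

Definition K0_to_weyl : {rmorphism K0 T -> A1} := pres_rmorphism K0_to_weyl_rel.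

Lemma K0_to_weylE X : K0_to_weyl (K0_ob X) = oval (weyl Wx) (weyl Wd) X.
Proof. exact: pres_rmorphismE. Qed.

Fact weyl_to_K0_rel s t : weyl_rel s t ->
  reval (fun g => if g is Wx then K0_ob oup else K0_ob odn) s =
  reval (fun g => if g is Wx then K0_ob oup else K0_ob odn) t.
Proof.
case=> /=; apply/eqP; rewrite -addrA -opprD subr_eq0; apply/eqP.
exact: K0_ob_weyl.
Qed.

Definition weyl_to_K0 : {rmorphism A1 -> K0 T} := pres_rmorphism weyl_to_K0_rel.

Lemma weyl_to_K0E g : weyl_to_K0 (weyl g) = if g is Wx then K0_ob oup else K0_ob odn.
Proof. exact: pres_rmorphismE. Qed.

Lemma weyl_to_K0_oval X : weyl_to_K0 (oval (weyl Wx) (weyl Wd) X) = K0_ob X.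
Proof.
rewrite K0_ob_oval rmorph_sum; apply: eq_bigr => w _; rewrite rmorph_prod.
by apply: eq_bigr => -[] _; rewrite weyl_to_K0E.
Qed.

Lemma K0_to_weylK : cancel K0_to_weyl weyl_to_K0.
Proof.
pose f : {rmorphism K0 T -> K0 T} := weyl_to_K0 \o K0_to_weyl.
pose g : {rmorphism K0 T -> K0 T} := idfun.
apply: (@pres_rmorphism_ext _ _ _ f g) => X.
rewrite -[pres_cls _ _]/(K0_cls X) K0_clsE /f /g /=.
by rewrite K0_to_weylE weyl_to_K0_oval.
Qed.

Lemma weyl_to_K0K : cancel weyl_to_K0 K0_to_weyl.
Proof.
pose f : {rmorphism A1 -> A1} := K0_to_weyl \o weyl_to_K0.
pose g : {rmorphism A1 -> A1} := idfun.
apply: (@pres_rmorphism_ext _ _ _ f g) => a.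
rewrite -[pres_cls _ _]/(weyl a) /f /g /= weyl_to_K0E.
by case: a; rewrite K0_to_weylE /oval big_seq1 /wval big_seq1.
Qed.

Lemma K0_to_weyl_bij : bijective K0_to_weyl.
Proof. by exists weyl_to_K0; [exact: K0_to_weylK | exact: weyl_to_K0K]. Qed.

Lemma weyl_to_K0_bij : bijective weyl_to_K0.
Proof. by exists K0_to_weyl; [exact: weyl_to_K0K | exact: K0_to_weylK]. Qed.

End Grothendieck.

(** * Passing from the predicate [is_field] to a field structure *)

Section FieldStructure.
Local Open Scope ring_scope.
Variable F : comNzRingType.
Hypothesis F_field : is_field F.

(** Inverses are chosen from the bare existence given by [is_field]; the value 0 at 0 is what the
    field structure demands. *)
Definition finv (x : F) : F :=
  if pselect (x = 0) is right x0 then projT1 (cid (F_field x0)) else 0.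

Fact finvP (x : F) : x != 0 -> finv x * x = 1.
Proof.
move=> x0; rewrite /finv; case: pselect => [/eqP|x0']; first by rewrite (negbTE x0).
by rewrite mulrC; case: cid.
Qed.

Fact finv0 : finv 0 = 0.
Proof. by rewrite /finv; case: pselect. Qed.

(** An alias indexed by the proof, to which a field structure can be attached while [F] remains an
    arbitrary ring. *)
Definition field_of of is_field F : Type := F.
Local Notation K := (field_of F_field).
HB.instance Definition _ := GRing.ComNzRing.on K.
HB.instance Definition _ := GRing.ComNzRing_isField.Build K finvP finv0.

End FieldStructure.

Lemma is_field_ind (P : comNzRingType -> Prop) :
  (forall K : fieldType, P K) -> forall F : comNzRingType, is_field F -> P F.
Proof.
move=> PK F F_field.
have := PK (field_of F_field : fieldType).
(* Destructing [F] lets conversion identify the ring under the alias with [F]. *)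
by case: F F_field.
Qed.

(** * Matrices respecting a colouring of rows and columns *)

Section GradedMatrices.
Local Open Scope ring_scope.

Definition graded (F : comNzRingType) (T : eqType) (m n : nat) (c : 'I_m -> T)
    (d : 'I_n -> T) (A : 'M[F]_(m, n)) : Prop :=
  forall i j, c i != d j -> A i j = 0.

Lemma graded_mul (F : comNzRingType) (T : eqType) (m n p : nat) (c : 'I_m -> T)
    (d : 'I_n -> T) (e : 'I_p -> T) (A : 'M[F]_(m, n)) (B : 'M[F]_(n, p)) :
  graded c d A -> graded d e B -> graded c e (A *m B).
Proof.
move=> Ag Bg i k ik; rewrite mxE big1 // => j _.
have [cd|cd] := eqVneq (c i) (d j); last by rewrite Ag ?mul0r.
by rewrite Bg ?mulr0 // -cd.
Qed.

(** A pseudo-inverse need not respect colours. But in an entry of the triple product between equal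
    colours, its entries between distinct colours only meet zeros of A, so they may be replaced by
    0. *)
Lemma graded_regular (F : comNzRingType) (T : eqType) (m n : nat) (c : 'I_m -> T)
    (d : 'I_n -> T) (A : 'M[F]_(m, n)) : is_field F -> graded c d A ->
  exists2 B : 'M[F]_(n, m), graded d c B & A *m B *m A = A.
Proof.
move=> F_field; move: A; apply: (@is_field_ind (fun F => forall A : 'M[F]_(m, n),
  graded c d A -> exists2 B : 'M[F]_(n, m), graded d c B & A *m B *m A = A) _ F F_field).
move=> {F F_field} K A Ag.
pose B := \matrix_(j, i) if d j == c i then pinvmx A j i else 0.
have Bg : graded d c B by move=> j i /negbTE dc; rewrite mxE dc.
exists B => //; apply/matrixP => i l; have [il|il] := eqVneq (c i) (d l); last first.
  by rewrite (graded_mul (graded_mul Ag Bg) Ag) // Ag.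
rewrite -[in RHS](mulmxKpV (submx_refl A)) !mxE; apply: eq_bigr => k _.
have [kl|kl] := eqVneq (c k) (d l); last by rewrite Ag // !mulr0.
congr (_ * _); rewrite !mxE; apply: eq_bigr => j _; rewrite mxE.
have [ij|ij] := eqVneq (c i) (d j); last by rewrite Ag // !mul0r.
by rewrite kl -il ij eqxx.
Qed.

(* Splits off rank one idempotents, by induction on the rank. *)
Lemma graded_split (F : comNzRingType) (T : eqType) (x0 : T) (n : nat)
    (c : 'I_n -> T) (E : 'M[F]_n) : is_field F -> graded c c E -> E *m E = E ->
  exists (s : seq T) (P : 'M[F]_(n, size s)) (Q : 'M[F]_(size s, n)),
    [/\ graded c (fun k => nth x0 s k) P, graded (fun k => nth x0 s k) c Q,
        P *m Q = E & Q *m P = 1%:M].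
Proof.
move=> F_field; move: E; apply: (@is_field_ind (fun F => forall E : 'M[F]_n,
  graded c c E -> E *m E = E ->
  exists (s : seq T) (P : 'M[F]_(n, size s)) (Q : 'M[F]_(size s, n)),
    [/\ graded c (fun k => nth x0 s k) P, graded (fun k => nth x0 s k) c Q,
        P *m Q = E & Q *m P = 1%:M]) _ F F_field).
move=> {F F_field} K E; have [r] := ubnP (\rank E).
elim: r E => // r IH E rE Eg EE.
have [E0|] := eqVneq E 0.
  exists [::], 0, 0; split; try by move=> i j; rewrite mxE.
    by rewrite mul0mx E0.
  by apply/matrixP => -[].
move=> /matrix0Pn[i [j Eij]].
have cij : c i = c j by apply/eqP; apply: contraNT Eij => /Eg ->.
(* As E is idempotent, row i times column j of E is [E i j]; dividing by it gives Q1 P1 = 1, and P1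
   Q1 is a rank one idempotent below E supported on the single colour c i = c j. *)
pose P1 := col j E; pose Q1 := (E i j)^-1 *: row i E.
have EP1 : E *m P1 = P1 by rewrite /P1 colE mulmxA EE.
have Q1E : Q1 *m E = Q1 by rewrite /Q1 -scalemxAl rowE -mulmxA EE.
have Q1P1 : Q1 *m P1 = 1%:M.
  apply/matrixP => k l; rewrite !ord1 /Q1 /P1 -scalemxAl colE rowE mulmxA.
  by rewrite -[delta_mx 0 i *m E *m E]mulmxA EE -rowE -colE !mxE eqxx mulVf.
pose E' := E - P1 *m Q1.
have P1E' : E' *m P1 = 0 by rewrite mulmxBl EP1 -mulmxA Q1P1 mulmx1 subrr.
have Q1E' : Q1 *m E' = 0 by rewrite mulmxBr Q1E mulmxA Q1P1 mul1mx subrr.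
have E'E : E' *m E = E' by rewrite mulmxBl EE -mulmxA Q1E.
have E'E' : E' *m E' = E'.
  by rewrite {2}/E' mulmxBr E'E mulmxA P1E' mul0mx subr0.
have gP1 k : c k != c j -> P1 k 0 = 0 by move=> kj; rewrite mxE Eg.
have gQ1 k : c j != c k -> Q1 0 k = 0.
  move=> jk; have Eik : E i k = 0 by apply: Eg; rewrite cij.
  by rewrite !mxE Eik mulr0.
have E'g : graded c c E'.
  move=> k l kl; rewrite !mxE Eg // big_ord1.
  have [kj|kj] := eqVneq (c k) (c j); last by rewrite gP1 // mul0r subr0.
  by rewrite gQ1 ?mulr0 ?subr0 // -kj.
(* The rank drops because E fixes the nonzero column P1 while E' kills it. *)
have rE' : (\rank E' < r)%N.
  apply: leq_trans (_ : \rank E <= r)%N => //.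
  have sub : (E' <= E)%MS by rewrite -E'E submxMl.
  rewrite ltn_neqAle mxrankS // andbT; apply/negP => /eqP rEE.
  have /submxP[X EX] : (E <= E')%MS by rewrite -(geq_leqif (mxrank_leqif_sup sub)) rEE.
  have P10 : P1 = 0 by rewrite -EP1 EX -mulmxA P1E' mulmx0.
  move: Q1P1; rewrite P10 mulmx0 => /matrixP/(_ 0 0); rewrite !mxE => /eqP.
  by rewrite eq_sym oner_eq0.
have [s [P [Q [gP gQ PQ QP]]]] := IH E' rE' E'g E'E'.
have Q1P : Q1 *m P = 0.
  have <- : E' *m P = P by rewrite -PQ -mulmxA QP mulmx1.
  by rewrite mulmxA Q1E' mul0mx.
have QP1 : Q *m P1 = 0.
  have <- : Q *m E' = Q by rewrite -PQ mulmxA QP mul1mx.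
  by rewrite -mulmxA P1E' mulmx0.
exists (c j :: s), (row_mx P1 P : 'M_(n, 1 + size s)), (col_mx Q1 Q : 'M_(1 + size s, n)).
split.
- move=> k l; have := splitK (l : 'I_(1 + size s)).
  case: (split _) => l' /= <-; first by rewrite (row_mxEl P1 P) !ord1 /=; apply: gP1.
  by rewrite (row_mxEr P1 P); apply: gP.
- move=> l k; have := splitK (l : 'I_(1 + size s)).
  case: (split _) => l' /= <-; first by rewrite (col_mxEu Q1 Q) !ord1 /=; apply: gQ1.
  by rewrite (col_mxEd Q1 Q); apply: gQ.
- by rewrite (mul_row_col P1 P Q1 Q) PQ addrC subrK.
rewrite (mul_col_row Q1 Q P1 P) Q1P1 Q1P QP1 QP.
by rewrite -(scalar_mx_block 1 (size s)).
Qed.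

End GradedMatrices.

(** * Semisimplicity of the generated subcategory *)

Section Semisimple.
Context {F : comNzRingType}.
Implicit Types X Y Z N M K : obj.
Local Notation hom := (Defs.hom F).
Local Notation HeisS := (Heis_s F).

Lemma Heis_s_ob X : sob HeisS X. Proof. by []. Qed.
Lemma Heis_s_gen X Y (f : hom X Y) : gen_hom f -> shom HeisS f. Proof. by []. Qed.
Lemma Heis_s_add X Y (f g : hom X Y) : shom HeisS f -> shom HeisS g -> shom HeisS (hadd f g).
Proof. by move=> fs gs; have [_ + _] := @linear_Heis_s F; apply. Qed.
Lemma Heis_s_scale X Y k (f : hom X Y) : shom HeisS f -> shom HeisS (hscale k f).
Proof. by move=> fs; have [_ _] := @linear_Heis_s F; apply. Qed.

Let nf := exists_normal_form Heis_s_ob Heis_s_gen Heis_s_add.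

(** * Simple objects of the subcategory *)

Lemma lin_simple_word w : normal w -> lin_simple HeisS [:: w].
Proof.
move=> nw; split=> // [f fs|k l].
  have nw1 : all normal [:: w] by rewrite /= nw.
  have [A fA] := gen_hom_smx nw1 nw1 fs.
  exists (A 0 0); rewrite fA /hid smx_delta smx_scale.
  by apply: smx_heq => -[|i] [|j] //= _ _ _; rewrite mulr1.
rewrite /hid smx_delta !smx_scale => /smx_inj/(_ 0 0 isT isT erefl).
by rewrite !mulr1.
Qed.

Lemma lin_simple_iso X Y : iso_in HeisS X Y -> lin_simple HeisS X -> lin_simple HeisS Y.
Proof.
move=> [a [aS [b [bS ba ab]]]] [_ endX injX].
have conj k : b \oh hscale k (hid Y) \oh a =~ hscale k (hid X).
  by rewrite hcompZr hcompZl hcomp1r ba.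
split=> // [f fs|k l kl].
  have [k fk] := endX (b \oh f \oh a) (shom_comp (shom_comp bS fs) aS).
  exists k; transitivity (a \oh (b \oh f \oh a) \oh b).
    by rewrite !hcompA ab hcomp1l -hcompA ab hcomp1r.
  by rewrite fk hcompZr hcompZl hcomp1r ab.
by apply: injX; rewrite -!conj kl.
Qed.

Lemma lin_simple_iso_word X : lin_simple HeisS X ->
  exists2 w, normal w & iso_in HeisS X [:: w].
Proof.
move=> simX; have [N [nN iN _]] := nf X.
have [_ endN injN] := lin_simple_iso iN simX.
case: N nN iN endN injN => [|v [|v' N]] /= nN iN endN injN.
(* On the zero object the scalars 1 and 0 act alike, against their faithfulness. *)
- by have /eqP := injN 1%R 0%R (fun i j (i0 : i < 0) => False_ind _ (notF i0)); rewrite oner_eq0.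
- by exists v => //; move: nN; rewrite andbT.
(* With two or more summands, the projection onto the first has diagonal entries 1 and 0 and is not
   a scalar. *)
have [k] := endN (smx _ _ (fun i j => ((i == 0) && (j == 0))%:R)%R) (@smx_gen _ _ _ _).
rewrite /hid smx_delta smx_scale => /smx_inj E.
have := E 1 1 isT isT erefl; have := E 0 0 isT isT erefl; rewrite !mulr1 /= => <-.
by move=> /eqP; rewrite eq_sym oner_eq0.
Qed.

Lemma opow_word a n : opow [:: [:: a]] n = [:: nseq n a].
Proof. by elim: n => //= n ->. Qed.

Lemma nwordE i j : otens (opow oup i) (opow odn j) = [:: nword i j].
Proof. by rewrite !opow_word. Qed.

Lemma lin_simpleP X : lin_simple HeisS X <->
  exists i j, iso_in HeisS X (otens (opow oup i) (opow odn j)).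
Proof.
split=> [/lin_simple_iso_word[w /normal_nwordP[i [j ->]] Xw]|[i [j]]].
  by exists i, j; rewrite nwordE.
rewrite nwordE => /iso_sym Xw.
exact: lin_simple_iso Xw (lin_simple_word (normal_nword i j)).
Qed.

Lemma nword_inj i j k l : nword i j = nword k l -> i = k /\ j = l.
Proof.
move=> E; have := congr1 (count_mem Up) E; have := congr1 (count_mem Dn) E.
by rewrite /nword !count_cat !count_nseq /= !mul1n !mul0n !addn0 !add0n.
Qed.

Lemma iso_nword_inj i j k l :
  iso_in HeisS (otens (opow oup i) (opow odn j)) (otens (opow oup k) (opow odn l)) ->
  i = k /\ j = l.
Proof.
rewrite !nwordE => /iso_Heis/iso_normal_perm.
rewrite /= !normal_nword => /(_ isT isT)/perm_mem/(_ (nword i j)).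
by rewrite !inE eqxx => /esym/eqP/nword_inj.
Qed.

Lemma Forall_words (P : obj -> Prop) N : all normal N ->
  (forall w, normal w -> P [:: w]) ->
  List.Forall P [seq [:: w] | w <- N].
Proof.
move=> nN Pw; elim: N nN => [|w N IH] /=; first by constructor.
by case/andP => nw nN; constructor; [exact: Pw | exact: IH].
Qed.

Lemma lin_semisimple_Heis_s : lin_semisimple HeisS.
Proof.
split; first exact: additive_Heis_s.
  move=> X _; have [N [nN iN _]] := nf X.
  exists [seq [:: w] | w <- N]; rewrite flatten_seq1; split=> //.
  exact: Forall_words lin_simple_word.
move=> X Y /lin_simple_iso_word[v nv Xv] /lin_simple_iso_word[w nw Yw] nXY f fs.
have vw : v != w.
  apply: contra_notN nXY => /eqP vw; rewrite vw in Xv.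
  exact: iso_trans Xv (iso_sym Yw).
have [a [aS [a' [a'S a'a aa']]]] := Xv.
have [b [bS [b' [b'S b'b bb']]]] := Yw.
have nv1 : all normal [:: v] by rewrite /= nv.
have nw1 : all normal [:: w] by rewrite /= nw.
have [A fA] := gen_hom_smx nv1 nw1 (shom_comp (shom_comp bS fs) a'S).
have f0 : b \oh f \oh a' =~ hzero [:: v] [:: w].
  rewrite fA smx_zero; apply: smx_heq => -[|i] [|j] //= _ _ vw'.
  by rewrite vw' eqxx in vw.
transitivity (b' \oh (b \oh f \oh a') \oh a).
  by rewrite !hcompA b'b hcomp1l -hcompA a'a hcomp1r.
by rewrite f0 hcomp0r hcomp0l.
Qed.

(** * The abelian structure over a field *)

Definition colour X (i : 'I_(size X)) : word := comp_of X i.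

Definition fmx m n (A : 'M[F]_(m, n)) (i j : nat) : F :=
  if insub i is Some i' then if insub j is Some j' then A i' j' else 0%R else 0%R.

Lemma fmxE m n (A : 'M[F]_(m, n)) (i : 'I_m) (j : 'I_n) : fmx A i j = A i j.
Proof. by rewrite /fmx !valK. Qed.

Definition hmx X Y (A : 'M[F]_(size X, size Y)) : hom X Y := smx X Y (fmx A).

(** Composition of morphisms skips the middle summands whose word differs from the source, whereas
    the matrix product runs over all of them; a graded A vanishes at those places. *)
Lemma hmx_comp X Y Z A B : graded (@colour X) (@colour Y) A ->
  @hmx Y Z B \oh @hmx X Y A =~ hmx (A *m B)%R.
Proof.
move=> Ag; rewrite /hmx smx_comp; apply: smx_heq => i k iX kZ _.
rewrite -[i]/(val (Ordinal iX)) -[k]/(val (Ordinal kZ)) fmxE mxE big_mkord.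
apply: eq_bigr => j _; rewrite !fmxE; case: eqP => // /eqP cij.
by rewrite Ag ?mul0r.
Qed.

Lemma hmx1 X : hid X =~ hmx 1%:M.
Proof.
rewrite /hid /hmx smx_delta; apply: smx_heq => i k iX kX _.
by rewrite -[i]/(val (Ordinal iX)) -[k]/(val (Ordinal kX)) fmxE mxE -val_eqE.
Qed.

Lemma hmx_inj X Y A B : graded (@colour X) (@colour Y) A ->
  graded (@colour X) (@colour Y) B -> hmx A =~ hmx B -> A = B.
Proof.
move=> Ag Bg /smx_inj AB; apply/matrixP => i j.
have [cij|cij] := eqVneq (colour i) (colour j); last by rewrite Ag ?Bg.
by rewrite -!fmxE AB.
Qed.

Lemma gen_hom_hmx X Y (f : hom X Y) : all normal X -> all normal Y -> gen_hom f ->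
  exists2 A, graded (@colour X) (@colour Y) A & f =~ hmx A.
Proof.
move=> nX nY /(gen_hom_smx nX nY)[A fA].
exists (\matrix_(i, j) if colour i == colour j then A i j else 0)%R.
  by move=> i j cij; rewrite mxE (negbTE cij).
rewrite fA; apply: smx_heq => i j iX jY ij.
by rewrite -[i]/(val (Ordinal iX)) -[j]/(val (Ordinal jY)) fmxE mxE /colour /= ij eqxx.
Qed.

Definition hsub X Y (f g : hom X Y) : hom X Y := hadd f (hscale (-1)%R g).

Lemma Heis_s_sub X Y (f g : hom X Y) : shom HeisS f -> shom HeisS g -> shom HeisS (hsub f g).
Proof. by move=> fs gs; apply: Heis_s_add => //; apply: Heis_s_scale. Qed.

Lemma hsubK X Y (f : hom X Y) : hsub f f =~ hzero X Y.
Proof.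
apply/heqP => i j iX jY.
by rewrite hcl_add // hcl_scale // scaleN1r subrr hcl0.
Qed.

Lemma hsub_eq0 X Y (f g : hom X Y) : hsub f g =~ hzero X Y -> f =~ g.
Proof.
move=> /heqP fg; apply/heqP => i j iX jY; have := fg i j iX jY.
by rewrite hcl_add // hcl_scale // scaleN1r hcl0 => /eqP; rewrite subr_eq0 => /eqP.
Qed.

#[local] Instance hsub_proper X Y :
  Proper (@heq F X Y ==> @heq F X Y ==> @heq F X Y) (@hsub X Y).
Proof. by move=> f f' ff g g' gg; rewrite /hsub ff gg. Qed.

Lemma hsub0 X Y (f : hom X Y) : hsub f (hzero X Y) =~ f.
Proof.
apply/heqP => i j iX jY.
by rewrite hcl_add // hcl_scale // hcl0 scaler0 addr0.
Qed.

Lemma hcompBl X Y Z (g g' : hom Y Z) (f : hom X Y) :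
  hsub g g' \oh f =~ hsub (g \oh f) (g' \oh f).
Proof. by rewrite /hsub hcompDl hcompZl. Qed.

Lemma hcompBr X Y Z (g : hom Y Z) (f f' : hom X Y) :
  g \oh hsub f f' =~ hsub (g \oh f) (g \oh f').
Proof. by rewrite /hsub hcompDr hcompZr. Qed.

Hypothesis F_field : is_field F.

(** Von Neumann regularity: f becomes a graded matrix between normal forms, and a graded generalised
    inverse is carried back. *)
Lemma Heis_s_regular X Y (f : hom X Y) : shom HeisS f ->
  exists2 g : hom Y X, shom HeisS g & f \oh g \oh f =~ f.
Proof.
move=> fs; have [N [nN [a [aS [a' [a'S a'a aa']]]] _]] := nf X.
have [M [nM [b [bS [b' [b'S b'b bb']]]] _]] := nf Y.
have [A Ag fA] := gen_hom_hmx nN nM (shom_comp (shom_comp bS fs) a'S).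
have [B Bg ABA] := graded_regular F_field Ag.
exists (a' \oh hmx B \oh b).
  by apply: shom_comp => //; apply: shom_comp => //; apply: smx_gen.
have fE : f =~ b' \oh hmx A \oh a.
  by rewrite -fA !hcompA b'b hcomp1l -hcompA a'a hcomp1r.
rewrite fE !hcompA -(hcompA _ a a') aa' hcomp1r -(hcompA _ b b') bb' hcomp1r.
rewrite -(hcompA b' _ (hmx B)) -(hcompA b' _ (hmx A)) hmx_comp // hmx_comp //.
by rewrite mulmxA ABA.
Qed.

Lemma Heis_s_split X (e : hom X X) : shom HeisS e -> e \oh e =~ e ->
  exists K (k : hom K X) (r : hom X K),
    [/\ shom HeisS k, shom HeisS r, k \oh r =~ e & r \oh k =~ hid K].
Proof.
move=> es ee; have [N [nN [a [aS [a' [a'S a'a aa']]]] _]] := nf X.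
have [E Eg eE] := gen_hom_hmx nN nN (shom_comp (shom_comp aS es) a'S).
have EE : (E *m E = E)%R.
  apply: (hmx_inj (graded_mul Eg Eg) Eg).
  transitivity (hmx E \oh hmx E); first by rewrite hmx_comp.
  rewrite -eE !hcompA.
  by rewrite -(hcompA _ a' a) a'a hcomp1r -(hcompA _ e e) ee.
(* The list of colours split off by [graded_split] is a list of words, hence itself an object, and
   serves as the image of e. *)
have [K [P [Q [Pg Qg PQ QP]]]] := graded_split [::] F_field Eg EE.
exists K, (a' \oh @hmx K N Q), (@hmx N K P \oh a); split.
- by apply: shom_comp => //; apply: smx_gen.
- by apply: shom_comp => //; apply: smx_gen.
- rewrite !hcompA -(hcompA a' _ (hmx P)) hmx_comp // PQ -eE.
  by rewrite !hcompA a'a hcomp1l -hcompA a'a hcomp1r.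
by rewrite !hcompA -(hcompA _ a a') aa' hcomp1r hmx_comp // QP -hmx1.
Qed.

(** If f g f = f, then 1 - g f is an idempotent killed by f and fixing everything that f kills; its
    image is the kernel. *)
Lemma Heis_s_kernel X Y (f : hom X Y) : shom HeisS f ->
  exists K (k : hom K X), is_kernel HeisS f k.
Proof.
move=> fs; have [g gs fgf] := Heis_s_regular fs.
pose e := hsub (hid X) (g \oh f).
have idX : shom HeisS (hid X : hom X X) by apply: shom_id.
have es : shom HeisS e by apply: Heis_s_sub => //; apply: shom_comp.
have fe : f \oh e =~ hzero X Y by rewrite hcompBr hcomp1r hcompA fgf hsubK.
have ee : e \oh e =~ e.
  by rewrite {1}/e hcompBl hcomp1l -hcompA fe hcomp0r hsub0.
have [K [k [r [ks rs kr rk]]]] := Heis_s_split es ee.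
exists K, k; split=> // [|W h hs fh].
  transitivity (f \oh (k \oh r) \oh k); first by rewrite -!hcompA rk hcomp1r.
  by rewrite kr fe hcomp0l.
exists (r \oh h); split; first exact: shom_comp.
  by rewrite hcompA kr /e hcompBl hcomp1l -hcompA fh hcomp0r hsub0.
by move=> h' _ kh'; rewrite -kh' hcompA rk hcomp1l.
Qed.

(** Dually, the cokernel is the image of the idempotent 1 - f g. *)
Lemma Heis_s_cokernel X Y (f : hom X Y) : shom HeisS f ->
  exists C (q : hom Y C), is_cokernel HeisS f q.
Proof.
move=> fs; have [g gs fgf] := Heis_s_regular fs.
pose e := hsub (hid Y) (f \oh g).
have idY : shom HeisS (hid Y : hom Y Y) by apply: shom_id.
have es : shom HeisS e by apply: Heis_s_sub => //; apply: shom_comp.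
have ef : e \oh f =~ hzero X Y by rewrite hcompBl hcomp1l fgf hsubK.
have ee : e \oh e =~ e.
  by rewrite {2}/e hcompBr hcomp1r hcompA ef hcomp0l hsub0.
have [C [k [r [ks rs kr rk]]]] := Heis_s_split es ee.
exists C, r; split=> // [|W h hs hf].
  transitivity (r \oh (k \oh r) \oh f); first by rewrite !hcompA rk hcomp1l.
  by rewrite kr -hcompA ef hcomp0r.
exists (h \oh k); split; first exact: shom_comp.
  by rewrite -hcompA kr /e hcompBr hcomp1r hcompA hf hcomp0l hsub0.
by move=> h' _ h'r; rewrite -h'r -hcompA rk hcomp1r.
Qed.

Lemma Heis_s_mono_split X Y (m : hom X Y) : is_mono HeisS m ->
  exists2 g : hom Y X, shom HeisS g & g \oh m =~ hid X.
Proof.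
move=> [ms minj]; have [g gs mgm] := Heis_s_regular ms; exists g => //.
apply: minj; [exact: shom_comp | exact: shom_id |].
by rewrite hcompA mgm hcomp1r.
Qed.

Lemma Heis_s_epi_split X Y (e : hom X Y) : is_epi HeisS e ->
  exists2 g : hom Y X, shom HeisS g & e \oh g =~ hid Y.
Proof.
move=> [es einj]; have [g gs ege] := Heis_s_regular es; exists g => //.
apply: einj; [exact: shom_comp | exact: shom_id |].
by rewrite ege hcomp1l.
Qed.

Lemma abelian_Heis_s : abelian_sub HeisS.
Proof.
split; first exact: additive_Heis_s.
split=> [X Y f fs|X Y f fs|X Y m mm|X Y e ee].
- exact: Heis_s_kernel.
- exact: Heis_s_cokernel.
- have [g gs gm] := Heis_s_mono_split mm; have [ms _] := mm.
  have fs : shom HeisS (hsub (hid Y) (m \oh g)).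
    by apply: Heis_s_sub; [exact: shom_id | exact: shom_comp].
  (* As g m = 1, the mono m is the kernel of 1 - m g: that (1 - m g) h = 0 means h = m (g h). *)
  exists Y, (hsub (hid Y) (m \oh g)); split=> //; split=> // [|W h hs].
    by rewrite hcompBl hcomp1l -hcompA gm hcomp1r hsubK.
  rewrite hcompBl hcomp1l => /hsub_eq0 hE.
  exists (g \oh h); split; first exact: shom_comp.
    by rewrite hcompA -hE.
  by move=> h' _ <-; rewrite hcompA gm hcomp1l.
have [g gs eg] := Heis_s_epi_split ee; have [es _] := ee.
have fs : shom HeisS (hsub (hid X) (g \oh e)).
  by apply: Heis_s_sub; [exact: shom_id | exact: shom_comp].
exists X, (hsub (hid X) (g \oh e)); split=> //; split=> // [|W h hs].
  by rewrite hcompBr hcomp1r hcompA eg hcomp1l hsubK.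
rewrite hcompBr hcomp1r => /hsub_eq0 hE.
exists (h \oh g); split; first exact: shom_comp.
  by rewrite -hcompA -hE.
by move=> h' _ <-; rewrite -hcompA eg hcomp1r.
Qed.

Lemma hscale1 X Y (f : hom X Y) : hscale 1%R f =~ f.
Proof. by apply/heqP => i j iX jY; rewrite hcl_scale // scale1r. Qed.

Lemma hscale0 X Y (f : hom X Y) : hscale 0%R f =~ hzero X Y.
Proof. by apply/heqP => i j iX jY; rewrite hcl_scale // scale0r. Qed.

Lemma hscaleA X Y k l (f : hom X Y) : hscale k (hscale l f) =~ hscale (k * l)%R f.
Proof. by apply/heqP => i j iX jY; rewrite !hcl_scale // scalerA. Qed.

Lemma lin_simple_nonzero X : lin_simple HeisS X -> ~ (hid X =~ (hzero X X : hom X X)).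
Proof.
move=> [_ _ injX] id0; have /eqP := oner_neq0 F; apply; apply: injX.
by rewrite hscale1 hscale0.
Qed.

(** A mono m has a retraction g, and m g is a scalar k with k k = k. In a field k is 0, whence m =
    0, or 1, whence m is an isomorphism. *)
Lemma lin_simple_ab X : lin_simple HeisS X -> ab_simple HeisS X.
Proof.
move=> simX; split=> //; first exact: lin_simple_nonzero.
move=> Z m mm; have [g gs gm] := Heis_s_mono_split mm; have [ms _] := mm.
have [_ endX injX] := simX.
have [k mgk] := endX (m \oh g) (shom_comp ms gs).
have kk : (k * k = k)%R.
  apply: injX; transitivity ((m \oh g) \oh (m \oh g)).
    by rewrite mgk hcompZl hcomp1l hscaleA.
  by rewrite hcompA -(hcompA m g m) gm hcomp1r mgk.
have [k0|k0] := pselect (k = 0%R).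
  left; transitivity (m \oh g \oh m); first by rewrite -hcompA gm hcomp1r.
  by rewrite mgk k0 hscale0 hcomp0l.
have k1 : k = 1%R.
  by have [y ky] := F_field k0; rewrite -[LHS]mulr1 -ky mulrA kk ky.
by right; split=> //; exists g; split=> //; rewrite mgk k1 hscale1.
Qed.

(** The inclusion of the first summand of a normal form is a nonzero split mono into X, so it is an
    isomorphism from a normal word. *)
Lemma ab_simple_lin X : ab_simple HeisS X -> lin_simple HeisS X.
Proof.
move=> [_ idX simX]; have [N [nN [a [aS [a' [a'S a'a aa']]]] _]] := nf X.
case: N nN a aS a' a'S a'a aa' => [|w N] /= nN a aS a' a'S a'a aa'.
  case: idX; rewrite -a'a; apply/heqP => i j iX jX; rewrite hcl_comp //.
  by rewrite big_geq.
have {nN} /andP[nw nN] := nN.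
pose m : hom [:: w] X := a' \oh hinl [:: w] N.
pose p : hom X [:: w] := hprl [:: w] N \oh a.
have pm : p \oh m =~ hid [:: w].
  by rewrite /p /m hcompA -(hcompA _ a a') aa' hcomp1r hprl_inl.
have ms : shom HeisS m by apply: shom_comp => //; apply: gen_hom_delta.
clearbody m p; have mm : is_mono HeisS m.
  split=> // W g h gs hs gh.
  by rewrite -[g]hcomp1l -[h]hcomp1l -pm -!hcompA gh.
have [m0|miso] := simX _ m mm.
  case: (lin_simple_nonzero (lin_simple_word nw)).
  by rewrite -pm m0 hcomp0r.
by apply: lin_simple_iso (lin_simple_word nw); exists m.
Qed.

Lemma ab_semisimple_Heis_s : ab_semisimple HeisS.
Proof.
split; first exact: abelian_Heis_s.
move=> X _; have [N [nN iN _]] := nf X.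
exists [seq [:: w] | w <- N]; rewrite flatten_seq1; split=> //.
by apply: Forall_words => // w nw; apply/lin_simple_ab/lin_simple_word.
Qed.

End Semisimple.

Theorem theoremA (F : comNzRingType) :
  exists S : subcat F,
    (* a replete semisimple monoidal subcategory *)
    [/\ replete S, monoidal_sub S, lin_semisimple S
      & is_field F -> ab_semisimple S] /\
    (* the Heisenberg isomorphism *)
    iso_in S (otens odn oup) (otens oup odn ++ ounit) /\
    (* the simple objects *)
    (forall X : obj, lin_simple S X <->
       exists i j : nat, iso_in S X (otens (opow oup i) (opow odn j))) /\
    (is_field F -> forall X : obj, ab_simple S X <->
       exists i j : nat, iso_in S X (otens (opow oup i) (opow odn j))) /\
    (forall i j k l : nat,
       iso_in S (otens (opow oup i) (opow odn j))
                (otens (opow oup k) (opow odn l)) -> i = k /\ j = l) /\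
    (* Grothendieck rings *)
    (exists phi : {rmorphism K0 S -> A1}, bijective phi) /\
    (is_field F -> has_pchar0 F ->
       exists psi : {rmorphism K0 S -> K0 (Heis F)},
         bijective psi /\
         forall X : sobj S, psi (K0_cls X) = K0_cls (heis_ob F (sval X))) /\
    (* isomorphism of objects *)
    (is_field F -> has_pchar0 F ->
       forall X Y : obj, iso_in (Heis F) X Y <-> iso_in S X Y).
Proof.
have H_ob X : sob (Heis F) X by [].
have H_gen X Y (f : Defs.hom F X Y) : gen_hom f -> shom (Heis F) f by [].
have H_add X Y (f g : Defs.hom F X Y) :
  shom (Heis F) f -> shom (Heis F) g -> shom (Heis F) (hadd f g) by [].
have S_ob := @Heis_s_ob F; have S_gen := @Heis_s_gen F; have S_add := @Heis_s_add F.
exists (Heis_s F); split.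
  split; [exact: replete_Heis_s | exact: monoidal_Heis_s | exact: lin_semisimple_Heis_s |].
  exact: ab_semisimple_Heis_s.
split; first exact: (iso_redex S_gen [::] [::]).
split; first exact: lin_simpleP.
split.
  move=> F_field X; rewrite -lin_simpleP.
  by split; [apply: ab_simple_lin | apply: lin_simple_ab].
split; first exact: iso_nword_inj.
pose phi := K0_to_weyl S_ob S_gen S_add.
(* The comparison of the two Grothendieck rings passes through the Weyl algebra: [phi] evaluates an
   object of the subcategory there, and [psi] returns the class of that object in the whole
   category. *)
pose psi := weyl_to_K0 H_ob H_gen.
split; first by exists phi; apply: K0_to_weyl_bij.
split; last by move=> _ _ X Y; apply: iso_Heis_iff.
move=> _ _; exists (psi \o phi : {rmorphism K0 (Heis_s F) -> K0 (Heis F)}); split.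
  apply: bij_comp; [exact: weyl_to_K0_bij | exact: K0_to_weyl_bij].
move=> X; rewrite (K0_clsE S_ob) (K0_clsE H_ob) /= /phi K0_to_weylE.
exact: weyl_to_K0_oval.
Qed.
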